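(* Let $f:\mathbb{R}^m\to\mathbb{R}$ be a $C^3$ function which is Morse, that is, all its critical points are non-degenerate ($\nabla^2 f$ is invertible at all critical points of $f$). Let $x_0$ be a random initial point, and let $\{x_n\}$ be a sequence constructed by New Q-Newton's method (defined in the context) from $x_0$, where the hyperparameters $\delta_0,\ldots,\delta_m$ are randomly chosen (randomness in the sense explained in the context). If $x_n$ converges to a point $x_\infty$, then $x_\infty$ is a local minimum of $f$ and the rate of convergence is quadratic, i.e. $\|x_{n+1}-x_\infty\|=O(\|x_n-x_\infty\|^2)$.
   Context: New Q-Newton's method. Fix $\alpha>0$ and pairwise distinct real numbers $\delta_0,\delta_1,\ldots,\delta_m$. For a symmetric invertible real $m\times m$ matrix $A$, let $pr_{A,+}$ and $pr_{A,-}$ be the orthogonal projections of $\mathbb{R}^m$ onto the span of the eigenvectors of $A$ with positive eigenvalues, respectively negative eigenvalues. For a $C^2$ function $f:\mathbb{R}^m\to\mathbb{R}$ and $x\in\mathbb{R}^m$ with $\nabla f(x)\neq 0$, let $\delta(x)=\delta_j$, where $j$ is the smallest index such that $\nabla^2 f(x)+\delta_j\|\nabla f(x)\|^{1+\alpha}\mathrm{Id}$ is invertible; if $\nabla f(x)=0$, put $\delta(x)=\delta_0$. Given an initial point $x_0$, define $$A_n=\nabla^2 f(x_n)+\delta(x_n)\|\nabla f(x_n)\|^{1+\alpha}\mathrm{Id},\quad v_n=A_n^{-1}\nabla f(x_n),\quad w_n=pr_{A_n,+}(v_n)-pr_{A_n,-}(v_n),\quad x_{n+1}=x_n-w_n.$$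 If $\nabla f(x_n)=0$, then $v_n=w_n=0$ and $x_{n+1}=x_n$. Randomness: the assertion is that there exists a set $E\subset\mathbb{R}$ of Lebesgue measure $0$, depending only on $f$ and $\alpha$, such that whenever $\delta_0,\ldots,\delta_m\notin E$ (''randomly chosen hyperparameters'') there is a set $\mathcal{A}\subset\mathbb{R}^m$ of Lebesgue measure $0$ such that the conclusion holds for every initial point $x_0\notin\mathcal{A}$ (''random initial point''). *)

(* Defs.v *)
From mathcomp Require Import all_boot all_order all_algebra.
From mathcomp Require Import all_classical all_reals all_analysis.

Set Implicit Arguments.
Unset Strict Implicit.
Unset Printing Implicit Defensive.

Import Order.TTheory GRing.Theory Num.Theory.
Import numFieldNormedType.Exports.

Local Open Scope classical_set_scope.
Local Open Scope ring_scope.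

(* Points of R^m are row vectors, so matrices act on the right; this is
   harmless below because the matrices involved (Hessians plus multiples of the
   identity) are symmetric. *)

Section Euclidean.
Context {R : realType} {m : nat}.
Implicit Types (x : 'rV[R]_m) (f : 'rV[R]_m -> R).

(* The library norm `|x| on row vectors is the sup norm, hence this one. *)
Definition enorm x : R := Num.sqrt (\sum_(i < m) x 0 i ^+ 2).

Definition partial f (i : 'I_m) x : R := 'D_(delta_mx 0 i) f x.

Fixpoint Ck (k : nat) f : Prop :=
  continuous f /\
  if k is k'.+1 then
    forall i : 'I_m,
      (forall x, derivable f x (delta_mx 0 i)) /\ Ck k' (partial f i)
  else True.

Definition gradient f x : 'rV[R]_m := \row_i partial f i x.

Definition hessian f x : 'M[R]_m := \matrix_(i, j) partial (partial f j) i x.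

Definition Morse f : Prop :=
  forall x, gradient f x = 0 -> hessian f x \in unitmx.

Definition local_min f x : Prop := \forall y \near x, f x <= f y.

(* Lebesgue outer measure on R^m: infimum of the total volume over countable
   covers by boxes.  The covers are indexed by a subset D of nat, so that the
   empty family is allowed; this matters for m = 0, where every box has
   volume 1. *)
Definition box (a b : 'rV[R]_m) : set 'rV[R]_m :=
  [set x | forall i, a 0 i <= x 0 i <= b 0 i].

Definition box_volume (a b : 'rV[R]_m) : R := \prod_(i < m) (b 0 i - a 0 i).

Definition lebesgue_outer (A : set 'rV[R]_m) : \bar R :=
  ereal_inf [set s | exists (D : set nat) (a b : nat -> 'rV[R]_m),
    [/\ forall k i, a k 0 i <= b k 0 i,
        A `<=` \bigcup_(k in D) box (a k) (b k) &
        s = \esum_(k in D) (box_volume (a k) (b k))%:E]].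

End Euclidean.

Section Spectral.
Context {R : realType} {m : nat}.
Implicit Types (A U : 'M[R]_m) (P : set R).

(* The row space of [kermx U^T] is the orthogonal complement of that of U. *)
Definition orth_proj U : 'M[R]_m := proj_mx U (kermx U^T).

(* [eigenspace A a] is 0 unless a is one of the finitely many eigenvalues of A,
   so the sum has finite support. *)
Definition eigenspan A P : 'M[R]_m :=
  \big[addsmx/0]_(a \in P) eigenspace A a.

Definition pr_pos A : 'M[R]_m := orth_proj (eigenspan A [set a | 0 < a]).
Definition pr_neg A : 'M[R]_m := orth_proj (eigenspan A [set a | a < 0]).

End Spectral.

Section NewQNewton.
Context {R : realType} {m : nat}.
Variables (f : 'rV[R]_m -> R) (alpha : R) (delta : 'I_m.+1 -> R).
Implicit Type x : 'rV[R]_m.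

Definition shifted_hessian (d : R) x : 'M[R]_m :=
  hessian f x + (d * enorm (gradient f x) `^ (1 + alpha))%:M.

Definition nqn_index x : 'I_m.+1 :=
  if gradient f x == 0 then ord0
  else [arg min_(j < ord0 | shifted_hessian (delta j) x \in unitmx) j].

Definition nqn_mx x : 'M[R]_m := shifted_hessian (delta (nqn_index x)) x.

Definition nqn_v x : 'rV[R]_m := gradient f x *m invmx (nqn_mx x).

Definition nqn_w x : 'rV[R]_m :=
  nqn_v x *m pr_pos (nqn_mx x) - nqn_v x *m pr_neg (nqn_mx x).

Definition nqn_step x : 'rV[R]_m := x - nqn_w x.

Definition nqn_seq (x0 : 'rV[R]_m) (n : nat) : 'rV[R]_m := iter n nqn_step x0.

End NewQNewton.

(* Main.v *)
From HB Require Import structures.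
Require Import Defs.
From mathcomp Require Import all_boot all_order all_algebra.
From mathcomp Require Import all_classical all_reals all_analysis.
From mathcomp Require Import ring lra.


(** Write [g] for the gradient, [D] for the Hessian, [c] for the power
    [1 + alpha] of the gradient norm, and [A_d = D + d c] for the shifted
    Hessian. Reflecting the negative directions of [A_d^-1 g] amounts to
    replacing [A_d] by its modulus [|A_d|], so the step with shift [d] is
    [H_d(x) = x - g |A_d|^-1].

    The sequence can only converge to a critical point: [g = w |A|] for the
    step length [w], which tends to [0] while [|A|] stays bounded
    ([limit_critical]). Let [p] be the limit and [S] the sign of [D(p)]. Near
    [p] the method is [H_d] for the first shift [d], and its strict derivative
    at [p] is [1 - S], which is [0] on the positive directions and [2] on the
    negative ones ([modulus_step_strict_diff_zero]).

    If there is a negative direction, two orbits that stay near [p] forever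
    cannot differ by a vector close to the negative directions, since they
    would separate geometrically. So the set of points whose orbit stays near
    [p] meets every line in some direction at most once, and it is null: its
    translates along that direction are disjoint and of equal size
    ([saddle_stay_null]). The initial points leading to a saddle lie in
    countably many iterated preimages of such sets ([trapped]). Otherwise
    [D(p)] is positive definite, [p] is a local minimum
    ([positive_hessian_local_min]), and the method is a Newton method with a
    perturbation of higher order ([fixed_step_quadratic]).

    It remains to see that preimages of null sets are null, which holds
    wherever the step is locally expanding by some factor, hence at every point
    where its strict derivative is injective. Fix a point with nonzero
    gradient. The derivative of the modulus is computed in an eigenbasis of
    [D]. As long as the signs of the eigenvalues of [A_d] do not change, the
    derivative of [H_d] is a rational function of [d]. Continued to infinite
    [d], whether or not the signs persist there, it becomes the identity; so
    its determinant vanishes for finitely many [d] only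
    ([finite_bad_shifts]). If uncountably many shifts had a set of bad points
    of positive measure, then some point would be bad for infinitely many
    shifts ([null_slices]). The exceptional set of shifts is thus countable,
    and critical points do no harm because they are fixed. *)

Import Order.TTheory GRing.Theory Num.Theory.
Import numFieldNormedType.Exports.

Local Open Scope classical_set_scope.
Local Open Scope ring_scope.

Set Implicit Arguments.
Unset Strict Implicit.
Unset Printing Implicit Defensive.

(** * Lebesgue outer measure and half spaces *)

Section OuterMeasure.
Context {R : realType} {m : nat}.
Local Notation mu := (@lebesgue_outer R m).
Local Open Scope ereal_scope.

Lemma box_volume_ge0 (a b : 'rV[R]_m) :
  (forall i, a ord0 i <= b ord0 i)%R -> (0 <= box_volume a b)%R.
Proof. by move=> ab; apply: prodr_ge0 => i _; rewrite subr_ge0. Qed.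

Lemma lebesgue_outer_ge0 A : 0 <= mu A.
Proof.
apply: le_ereal_inf_tmp => _ [D [a [b [ab _ ->]]]].
by apply: esum_ge0 => k _; rewrite lee_fin; apply: box_volume_ge0 => i; exact: ab.
Qed.

Lemma lebesgue_outer0 : mu set0 = 0.
Proof.
apply/eqP; rewrite eq_le lebesgue_outer_ge0 andbT.
apply: ereal_inf_lbound; exists set0, (fun=> 0%R), (fun=> 0%R).
by split => //; rewrite esum_set0.
Qed.

Lemma lebesgue_outer_box_le (a b : 'rV[R]_m) (A : set 'rV[R]_m) :
  (forall i, a ord0 i <= b ord0 i)%R -> A `<=` box a b ->
  mu A <= (box_volume a b)%:E.
Proof.
move=> ab Aab; apply: ereal_inf_lbound.
exists [set 0%N], (fun=> a), (fun=> b); split => // [x /Aab xab|].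
  by exists 0%N.
by rewrite esum_set1// lee_fin box_volume_ge0.
Qed.

Lemma lebesgue_outer_cover_lt (A : set 'rV[R]_m) (e : R) :
  (0 < e)%R -> mu A < +oo ->
  exists (D : set nat) (a b : nat -> 'rV[R]_m),
    [/\ (forall k i, a k ord0 i <= b k ord0 i)%R,
        A `<=` \bigcup_(k in D) box (a k) (b k) &
        \esum_(k in D) (box_volume (a k) (b k))%:E <= mu A + e%:E].
Proof.
move=> e0 Aoo.
have fA : mu A \is a fin_num by rewrite ge0_fin_numE// lebesgue_outer_ge0.
have [_ [D [a [b [ab Ac ->]]]] lt] := lb_ereal_inf_adherent e0 fA.
by exists D, a, b; split => //; exact: ltW lt.
Qed.

Lemma lebesgue_outer_sigma_subadditive A F :
  subset_sigma_subadditive mu A F.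
Proof.
move=> AF; have [[i ioo]|] := pselect (exists i, mu (F i) = +oo).
  rewrite (eseries_pinfty _ _ ioo) ?leey// => n _.
  by rewrite -ltNye (lt_le_trans _ (lebesgue_outer_ge0 _)).
rewrite -forallNE => Foo.
apply/lee_addgt0Pr => e e0.
rewrite (le_trans _ (epsilon_trick _ _ (ltW e0)))//; last first.
  by move=> n; exact: lebesgue_outer_ge0.
have /choice[G PG] n : exists G : set nat * ((nat -> 'rV[R]_m) * (nat -> 'rV[R]_m)),
    [/\ (forall k i, G.2.1 k ord0 i <= G.2.2 k ord0 i)%R,
        F n `<=` \bigcup_(k in G.1) box (G.2.1 k) (G.2.2 k) &
        \esum_(k in G.1) (box_volume (G.2.1 k) (G.2.2 k))%:E
          <= mu (F n) + (e / (2 ^ n.+1)%:R)%:E].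
  have e2 : (0 < e / (2 ^ n.+1)%:R)%R by rewrite divr_gt0// ltr0n expn_gt0.
  have Fn : mu (F n) < +oo by rewrite ltey; apply/eqP/Foo.
  by have [D [a [b H]]] := lebesgue_outer_cover_lt e2 Fn; exists (D, (a, b)).
have /card_esym/ppcard_eqP[h] := card_nat2.
pose g : nat * nat -> nat := (h^-1)%FUN.
have gK p : h (g p) = p by rewrite /g invK ?inE.
pose a k := (G (h k).1).2.1 (h k).2.
pose b k := (G (h k).1).2.2 (h k).2.
pose D := [set k | (G (h k).1).1 (h k).2].
apply: (@le_trans _ _ (\esum_(k in D) (box_volume (a k) (b k))%:E)).
  apply: ereal_inf_lbound; exists D, a, b; split => //.
    by move=> k i; have [+ _ _] := PG (h k).1; exact.
  move=> x /AF [n _ Fx]; have [_ /(_ _ Fx)[k Gk xk] _] := PG n.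
  by exists (g (n, k)); rewrite /D /a /b /= gK.
have -> : \esum_(k in D) (box_volume (a k) (b k))%:E =
    \esum_(n in setT) \esum_(k in (G n).1)
       (box_volume ((G n).2.1 k) ((G n).2.2 k))%:E.
  rewrite esum_esum; last first.
    move=> n k _ _; rewrite lee_fin; apply: box_volume_ge0 => i.
    by have [+ _ _] := PG n; exact.
  rewrite [RHS](@reindex_esum _ _ _ D _ h)//.
  split.
  - by move=> k Dk; split.
  - by move=> x y _ _ /(@inj _ _ _ h) -> //; rewrite inE.
  - by move=> [n k] [_ Gk]; exists (g (n, k)); rewrite /D /= gK.
rewrite -nneseries_esumT; last first.
  move=> n; apply: esum_ge0 => k _; rewrite lee_fin; apply: box_volume_ge0 => i.
  by have [+ _ _] := PG n; exact.
apply: lee_nneseries => // [n _ _|n _]; last by have [] := PG n.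
apply: esum_ge0 => k _; rewrite lee_fin; apply: box_volume_ge0 => i.
by have [+ _ _] := PG n; exact.
Qed.

End OuterMeasure.

HB.instance Definition _ (R : realType) (m : nat) :=
  isSubsetOuterMeasure.Build R 'rV[R]_m (@lebesgue_outer R m)
    lebesgue_outer0 lebesgue_outer_ge0 lebesgue_outer_sigma_subadditive.

Section HalfSpaces.
Context {R : realType} {m : nat}.
Local Notation mu := (@lebesgue_outer R m).
Local Open Scope ereal_scope.

(** The hyperplane [x_i = t], moved to the nearest face when it misses a box,
    cuts each box of a cover into two boxes whose volumes add up exactly. *)
Lemma half_space_measurable (i : 'I_m) (t : R) :
  mu.-caratheodory [set x : 'rV[R]_m | x ord0 i <= t]%R.
Proof.
set H := [set x | _].
apply: le_caratheodory_measurable => X /=.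
apply: le_ereal_inf_tmp => _ [D [a [b [ab XD ->]]]].
pose tau k := Num.max (a k ord0 i) (Num.min (b k ord0 i) t).
pose b' k : 'rV[R]_m := (\row_j if j == i then tau k else b k ord0 j)%R.
pose a' k : 'rV[R]_m := (\row_j if j == i then tau k else a k ord0 j)%R.
have atau k : (a k ord0 i <= tau k)%R by rewrite /tau le_max lexx.
have taub k : (tau k <= b k ord0 i)%R by rewrite /tau ge_max ab ge_min lexx.
have ab' k j : (a k ord0 j <= b' k ord0 j)%R.
  by rewrite mxE; case: eqP => [->|_]//.
have a'b k j : (a' k ord0 j <= b k ord0 j)%R.
  by rewrite mxE; case: eqP => [->|_]//.
apply: (@le_trans _ _ (\esum_(k in D) (box_volume (a k) (b' k))%:E +
   \esum_(k in D) (box_volume (a' k) (b k))%:E)).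
  apply: leeD; apply: ereal_inf_lbound; exists D.
  - exists a, b'; split => // x [/XD[k Dk xk] Hx]; exists k => // j.
    have /andP[aj bj] := xk j.
    rewrite aj mxE; case: eqP => [ji|_]//=.
    by rewrite /tau le_max le_min -ji bj/= ji (_ : (_ <= t)%R) ?orbT.
  - exists a', b; split => // x [/XD[k Dk xk] Hx]; exists k => // j.
    have /andP[aj bj] := xk j.
    rewrite bj mxE andbT; case: eqP => [ji|_]//=.
    rewrite /tau ge_max -ji aj/= ge_min; apply/orP; right.
    by rewrite ltW// ltNge; apply/negP; rewrite ji.
rewrite -esumD; last 2 first.
- by move=> k _; rewrite lee_fin box_volume_ge0.
- by move=> k _; rewrite lee_fin box_volume_ge0.
apply: le_esum => k Dk; rewrite -EFinD lee_fin.
rewrite /box_volume (bigD1 i)//= [X in (_ + X)%R](bigD1 i)//= [leRHS](bigD1 i)//=.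
rewrite !mxE eqxx.
rewrite (eq_bigr (fun j => b k ord0 j - a k ord0 j)%R); last first.
  by move=> j ji; rewrite mxE (negbTE ji).
rewrite [X in (_ + _ * X)%R](eq_bigr (fun j => b k ord0 j - a k ord0 j)%R); last first.
  by move=> j ji; rewrite mxE (negbTE ji).
rewrite le_eqVlt -mulrDl; apply/orP; left; apply/eqP; congr (_ * _)%R; ring.
Qed.

End HalfSpaces.

(** * Rational cubes and measurable sets *)

Section SupNorm.
Context {R : realType}.

Lemma mxnorm_le m n (A : 'M[R]_(m, n)) (e : R) : 0 <= e ->
  (forall i j, `|A i j| <= e) -> `|A| <= e.
Proof.
move=> e0 Ae; change (mx_norm A <= e); rewrite mx_normrE.
by apply/bigmax_leP; split => // -[i j] _; exact: Ae.
Qed.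

Lemma mxnorm_lt m n (A : 'M[R]_(m, n)) (e : R) : 0 < e ->
  (forall i j, `|A i j| < e) -> `|A| < e.
Proof.
move=> e0 Ae; change (mx_norm A < e); rewrite mx_normrE.
by apply/bigmax_ltP; split => // -[i j] _; exact: Ae.
Qed.

Lemma mxnorm_coord m n (A : 'M[R]_(m, n)) i j : `|A i j| <= `|A|.
Proof.
rewrite -[leRHS]/(mx_norm A) mx_normrE.
exact: (le_bigmax _ (fun ij : 'I_m * 'I_n => `|A ij.1 ij.2|) (i, j)).
Qed.

Lemma mxnorm_mul m n p (A : 'M[R]_(m, n)) (B : 'M[R]_(n, p)) :
  `|A *m B| <= n%:R * `|A| * `|B|.
Proof.
apply: mxnorm_le => [|i j]; first by rewrite !mulr_ge0.
rewrite mxE (le_trans (ler_norm_sum _ _ _))//.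
rewrite -[n in n%:R]card_ord -mulrA mulr_natl -sumr_const.
apply: ler_sum => k _; rewrite normrM ler_pM//; exact: mxnorm_coord.
Qed.

End SupNorm.

Section RationalCubes.
Context {R : realType} {m : nat}.
Local Notation mu := (@lebesgue_outer R m).

Definition qcube (c : 'rV[rat]_m * nat) : set 'rV[R]_m :=
  [set x | forall i, ratr (c.1 ord0 i) - c.2.+1%:R^-1 < x ord0 i
                  <= ratr (c.1 ord0 i) + c.2.+1%:R^-1].

(** Rational half-open cubes replace all neighborhoods in the countability
    arguments; being half-open, they are also differences of half spaces. *)
Lemma qcube_nbhs (x : 'rV[R]_m) (U : set 'rV[R]_m) : nbhs x U ->
  exists c, qcube c `<=` U /\ nbhs x (qcube c).
Proof.
move=> /nbhs_ballP[e /= e0 eU].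
have [n _ ne] : exists2 n, True & n.+1%:R^-1 < e / 2 :> R.
  have e2 : 0 < e / 2 by rewrite divr_gt0.
  have [N _ NP] := near_infty_natSinv_lt (PosNum e2).
  by exists N => //; exact: (NP N (leqnn N)).
pose s : R := n.+1%:R^-1.
have s0 : 0 < s by rewrite invr_gt0.
have /choice[q qP] i : exists q : rat, `|ratr q - x ord0 i| < s / 2.
  have /rat_in_itvoo[q] : x ord0 i - s / 2 < x ord0 i + s / 2 by lra.
  rewrite in_itv/= => /andP[q1 q2]; exists q.
  by rewrite ltr_norml; lra.
exists (\row_i q i, n); split => [y yc|].
  apply: eU; rewrite mx_norm_ball /ball_/=.
  apply: mxnorm_lt => // i j; rewrite !mxE ord1.
  move: (yc j) (qP j); rewrite !mxE/= -/s ltr_norml => /andP[y1 y2] /andP[q1 q2].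
  rewrite ltr_norml; rewrite -/s in ne; lra.
apply/nbhs_ballP; exists (s / 2) => /=; first by rewrite divr_gt0.
move=> y; rewrite mx_norm_ball /ball_/= => xy i.
rewrite !mxE/= -/s.
have := le_lt_trans (mxnorm_coord (x - y) ord0 i) xy.
have := qP i; rewrite !mxE !ltr_norml => /andP[q1 q2] /andP[y1 y2].
lra.
Qed.

Lemma null_subset (A B : set 'rV[R]_m) : A `<=` B -> mu B = 0%E -> mu A = 0%E.
Proof.
move=> AB B0; apply/eqP; rewrite eq_le lebesgue_outer_ge0 andbT -B0.
exact: (le_outer_measure (mu : {outer_measure set _ -> \bar R})).
Qed.

Lemma null_bigcup (F : nat -> set 'rV[R]_m) :
  (forall n, mu (F n) = 0%E) -> mu (\bigcup_n F n) = 0%E.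
Proof.
move=> F0; apply/eqP; rewrite eq_le lebesgue_outer_ge0 andbT.
apply: (le_trans (outer_measure_sigma_subadditive mu F)).
by rewrite eseries0// => i _ _; exact: F0.
Qed.

Lemma null_bigcup_countType (T : countType) (F : T -> set 'rV[R]_m) :
  (forall c, mu (F c) = 0%E) -> mu (\bigcup_c F c) = 0%E.
Proof.
move=> F0; pose G n := if unpickle n is Some c then F c else set0.
apply: (@null_subset _ (\bigcup_n G n)).
  by move=> x [c _ Fx]; exists (pickle c) => //; rewrite /G pickleK.
apply: null_bigcup => n; rewrite /G; by case: unpickle => //; exact: lebesgue_outer0.
Qed.

Lemma null_setU (A B : set 'rV[R]_m) :
  mu A = 0%E -> mu B = 0%E -> mu (A `|` B) = 0%E.
Proof.
move=> A0 B0; apply/eqP; rewrite eq_le lebesgue_outer_ge0 andbT.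
apply: (le_trans (outer_measureU2 mu A B)).
by rewrite [X in (X + _)%E]A0 [X in (_ + X)%E]B0 adde0.
Qed.

Lemma qcube_measurable c : mu.-caratheodory (qcube c).
Proof.
pose A n := if insub n is Some i then
   ~` ([set x : 'rV[R]_m | x ord0 i <= ratr (c.1 ord0 i) + c.2.+1%:R^-1] `&`
   ~` [set x | x ord0 i <= ratr (c.1 ord0 i) - c.2.+1%:R^-1]) else set0.
have -> : qcube c = ~` \bigcup_n A n.
  apply/seteqP; split => x /= xc.
    move=> [n _]; rewrite /A; case: insub => // i /=; apply.
    by have /andP[x1 x2] := xc i; split => //; apply/negP; rewrite -ltNge.
  move=> i; apply: contrapT => xi; apply: xc; exists (val i) => //.
  rewrite /A valK => -[/= x1 /negP]; rewrite -ltNge => x2.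
  by apply: xi; rewrite x1 x2.
apply: caratheodory_measurable_setC; apply: caratheodory_measurable_bigcup => n.
rewrite /A; case: insub => [i|]; last exact: caratheodory_measurable_set0.
apply: caratheodory_measurable_setC; apply: caratheodory_measurable_setI.
  exact: half_space_measurable.
by apply: caratheodory_measurable_setC; exact: half_space_measurable.
Qed.

Lemma open_measurable_outer (O : set 'rV[R]_m) : open O -> mu.-caratheodory O.
Proof.
move=> oO.
pose A n := if unpickle n is Some c then
  (if `[< qcube c `<=` O >] then qcube c else set0) else set0.
have -> : O = \bigcup_n A n.
  apply/seteqP; split => x.
    move=> Ox; have [c [cO xc]] := qcube_nbhs (open_nbhs_nbhs (conj oO Ox)).
    exists (pickle c) => //; rewrite /A pickleK asboolT//.
    exact: nbhs_singleton.
  by move=> [n _]; rewrite /A; case: unpickle => // c; case: asboolP => // cO /cO.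
apply: caratheodory_measurable_bigcup => n; rewrite /A.
case: unpickle => [c|]; last exact: caratheodory_measurable_set0.
case: ifP => _; [exact: qcube_measurable|exact: caratheodory_measurable_set0].
Qed.

End RationalCubes.

(** * Null sets and expanding maps *)

Section NullSets.
Context {R : realType} {m : nat}.
Local Notation mu := (@lebesgue_outer R m).

Lemma lebesgue_outer_diam_le (V : set 'rV[R]_m) (d : R) : 0 <= d ->
  (forall y z, V y -> V z -> `|y - z| <= d) ->
  (mu V <= ((2 * d) ^+ m)%:E)%E.
Proof.
move=> d0 Vd; have [->|/set0P[x Vx]] := eqVneq V set0.
  by rewrite lebesgue_outer0 lee_fin exprn_ge0// mulr_ge0.
pose a : 'rV[R]_m := \row_i (x ord0 i - d).
pose b : 'rV[R]_m := \row_i (x ord0 i + d).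
apply: (@le_trans _ _ (box_volume a b)%:E).
  apply: lebesgue_outer_box_le => [i|y Vy i].
    by rewrite !mxE; lra.
  have := le_trans (mxnorm_coord (y - x) ord0 i) (Vd _ _ Vy Vx).
  rewrite !mxE ler_norml => /andP[? ?]; lra.
rewrite lee_fin /box_volume.
under eq_bigr do rewrite !mxE opprB addrC addrA subrK -mulr2n -[d *+ 2]mulr_natl.
by rewrite prodr_const card_ord.
Qed.

Lemma outer_measure_finType_le (T : finType) (P : pred T) (F : T -> set 'rV[R]_m) :
  (mu (\bigcup_(t in [set` P]) F t) <= \sum_(t | P t) mu (F t))%E.
Proof.
rewrite bigcup_pred; elim/big_rec2 : _ => [|t y X _ yX].
  by rewrite lebesgue_outer0.
by apply: (le_trans (outer_measureU2 mu _ _)); exact: leeD2l.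
Qed.

Lemma prod_shift_le (l : 'I_m -> R) (e : R) : 0 < e ->
  exists2 s, 0 < s & \prod_i (l i + s) <= \prod_i l i + e.
Proof.
move=> e0; pose p : {poly R} := \prod_i ((l i)%:P + 'X).
have pE s : p.[s] = \prod_i (l i + s).
  by rewrite horner_prod; apply: eq_bigr => i _; rewrite !hornerE.
have /cvgrPdist_lt/(_ _ e0) := @continuous_horner R p 0.
move=> /nbhs_ballP[r /= r0 rP].
exists (r / 2); first by rewrite divr_gt0.
have /rP /= : ball (0 : R) r (r / 2).
  by rewrite /ball/= sub0r normrN gtr0_norm ?divr_gt0//; lra.
rewrite !pE ltr_norml => /andP[+ _].
under [X in _ < X - _ -> _]eq_bigr do rewrite addr0.
lra.
Qed.

(** The side [s] grid on a box of side lengths [b i - a i] has at most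
    [\prod_i ((b i - a i) / s + 1)] cells, and the preimage of a cell has
    diameter at most [s / c]. *)
Lemma expanding_preimage_box_le (W : set 'rV[R]_m) (h : 'rV[R]_m -> 'rV[R]_m)
    (c : R) (a b : 'rV[R]_m) : 0 < c -> (forall i, a ord0 i <= b ord0 i) ->
  (forall y z, W y -> W z -> c * `|y - z| <= `|h y - h z|) ->
  (mu (W `&` h @^-1` box a b) <= ((2 / c) ^+ m * box_volume a b)%:E)%E.
Proof.
move=> c0 ab Wc; apply/lee_addgt0Pr => e e0.
have C0 : 0 < (2 / c) ^+ m by rewrite exprn_gt0// divr_gt0.
have [s s0 sP] := prod_shift_le (fun i => b ord0 i - a ord0 i) (divr_gt0 e0 C0).
pose K i := (Num.truncn ((b ord0 i - a ord0 i) / s)).+1.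
pose Kmax := (\max_i K i)%N.
pose cell (f : {ffun 'I_m -> 'I_Kmax}) : set 'rV[R]_m :=
  [set y | forall i, a ord0 i + (f i)%:R * s <= y ord0 i
                     <= a ord0 i + (f i).+1%:R * s].
pose Q (i : 'I_m) : pred 'I_Kmax := fun j => (j < K i)%N.
have cov : W `&` h @^-1` box a b `<=`
    \bigcup_(f in [set` family Q]) (W `&` h @^-1` cell f).
  move=> x [Wx hx].
  have xK i : (Num.truncn ((h x ord0 i - a ord0 i) / s) < K i)%N.
    rewrite ltnS; apply: Num.Theory.le_truncn.
    by rewrite ler_pM2r ?invr_gt0//; have /andP[_] := hx i; lra.
  have KK i : (K i <= Kmax)%N by exact: leq_bigmax.
  pose f := [ffun i => Ordinal (leq_trans (xK i) (KK i))].
  exists f => /=; first by apply/familyP => i; rewrite ffunE /in_mem/= /Q/= xK.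
  split => // i; rewrite /f ffunE /=.
  set t := (h x ord0 i - a ord0 i) / s.
  have t0 : 0 <= t.
    by rewrite divr_ge0 ?(ltW s0)//; have /andP[+ _] := hx i; lra.
  have /andP[t1 t2] := Num.Theory.truncn_itv t0.
  have hE : h x ord0 i = a ord0 i + t * s.
    by rewrite /t divfK ?gt_eqF//; ring.
  rewrite hE; apply/andP; split; rewrite lerD2l ler_pM2r//; exact: ltW.
apply: (le_trans (le_outer_measure mu _ _ cov)).
apply: (le_trans (outer_measure_finType_le _ _)).
apply: (@le_trans _ _ (\sum_(f in family Q) (((2 / c) ^+ m * \prod_(i < m) s)%:E))%E).
  apply: lee_sum => f _.
  (* A set of diameter [s / c] lies in a cube of side [2 * (s / c)]. *)
  have -> : (2 / c) ^+ m * \prod_(i < m) s = (2 * (s / c)) ^+ m.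
    by rewrite prodr_const card_ord -exprMn; congr (_ ^+ _); field; rewrite gt_eqF.
  apply: lebesgue_outer_diam_le; first by rewrite divr_ge0 ?ltW.
  move=> y z [Wy hy] [Wz hz].
  rewrite ler_pdivlMr// mulrC; apply: (le_trans (Wc _ _ Wy Wz)).
  apply: mxnorm_le => [|i j]; first exact: ltW.
  rewrite ord1 !mxE; have /andP[? ?] := hy j; have /andP[? ?] := hz j.
  have fS : (f j).+1%:R * s = (f j)%:R * s + s by rewrite -natr1; ring.
  rewrite ler_norml; lra.
rewrite sumEFin lee_fin -mulr_sumr -(@bigA_distr_big_dep _ _ _ _ _ _ _ Q (fun _ _ => s)).
apply: (@le_trans _ _ ((2 / c) ^+ m * (box_volume a b + e / (2 / c) ^+ m))).
  rewrite ler_wpM2l ?(ltW C0)//; apply: le_trans sP.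
  apply: ler_prod => i _; rewrite sumr_ge0/=; last by move=> *; exact: ltW.
  rewrite -(big_ord_widen Kmax (fun=> s)) ?leq_bigmax//.
  rewrite sumr_const card_ord -mulr_natl /K -natr1 mulrDl mul1r lerD2r.
  rewrite -ler_pdivlMr//; rewrite Num.Theory.truncn_le.
  by rewrite divr_ge0 ?(ltW s0)// subr_ge0.
by rewrite mulrDr [(2 / c) ^+ m * (e / _)]mulrC divfK ?gt_eqF.
Qed.

(** The inverse of an expanding map is Lipschitz, so it at most multiplies
    the volumes of a cover by a constant. *)
Lemma null_preimage_expanding (W N : set 'rV[R]_m) (h : 'rV[R]_m -> 'rV[R]_m)
    (c : R) : 0 < c ->
  (forall y z, W y -> W z -> c * `|y - z| <= `|h y - h z|) ->
  mu N = 0%E -> W `<=` h @^-1` N -> mu W = 0%E.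
Proof.
move=> c0 Wc N0 WN.
have C0 : 0 < (2 / c) ^+ m by rewrite exprn_gt0// divr_gt0.
apply/eqP; rewrite eq_le lebesgue_outer_ge0 andbT.
apply/lee_addgt0Pr => e e0; rewrite add0e.
have Noo : (mu N < +oo)%E by rewrite N0.
have [D [a [b [ab Nab]]]] := lebesgue_outer_cover_lt (divr_gt0 e0 C0) Noo.
rewrite N0 add0e esum_mkcond -nneseries_esumT; last first.
  by move=> k; case: ifP => // _; rewrite lee_fin box_volume_ge0.
move=> De.
pose F k := if k \in D then W `&` h @^-1` box (a k) (b k) else set0.
apply: (@le_trans _ _ (\sum_(0 <= k <oo) mu (F k))%E).
  apply: lebesgue_outer_sigma_subadditive => x Wx.
  have [k Dk xk] := Nab _ (WN _ Wx).
  by exists k => //; rewrite /F mem_set.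
apply: (@le_trans _ _ (\sum_(0 <= k <oo) (((2 / c) ^+ m)%:E *
    if k \in D then (box_volume (a k) (b k))%:E else 0))%E).
  apply: lee_nneseries => // [k _ _|k _]; first exact: lebesgue_outer_ge0.
  rewrite /F; case: ifP => kD; last by rewrite lebesgue_outer0 mule0.
  by rewrite -EFinM; exact: expanding_preimage_box_le.
rewrite nneseriesZl; last first.
  by move=> k _; case: ifP => // _; rewrite lee_fin box_volume_ge0.
apply: (@le_trans _ _ (((2 / c) ^+ m)%:E * (e / (2 / c) ^+ m)%:E)%E).
  by apply: lee_wpmul2l => //; rewrite lee_fin ltW.
by rewrite -EFinM lee_fin mulrC divfK ?gt_eqF.
Qed.

End NullSets.

(** * Measurable families with finite slices *)

Section FiniteSlices.
Context {R : realType} {m : nat}.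
Local Notation mu := (@lebesgue_outer R m).

Definition expanding_on (W : set 'rV[R]_m) (h : 'rV[R]_m -> 'rV[R]_m) (c : R) :=
  forall y z, W y -> W z -> c * `|y - z| <= `|h y - h z|.

Lemma null_preimage_locally_expanding (V N : set 'rV[R]_m) (h : 'rV[R]_m -> 'rV[R]_m) :
  (forall x, V x -> exists2 U, nbhs x U & exists2 c, 0 < c & expanding_on U h c) ->
  mu N = 0%E -> mu (V `&` h @^-1` N) = 0%E.
Proof.
move=> Vh N0.
pose F (q : ('rV[rat]_m * nat) * nat) : set 'rV[R]_m :=
  if `[< expanding_on (qcube q.1) h q.2.+1%:R^-1 >]
  then qcube q.1 `&` h @^-1` N else set0.
apply: (@null_subset _ _ _ (\bigcup_q F q)).
  move=> x [Vx hx]; have [U xU [c c0 Uc]] := Vh _ Vx.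
  have [q [qU xq]] := qcube_nbhs xU.
  have [n _ nP] := near_infty_natSinv_lt (PosNum c0).
  exists (q, n) => //; rewrite /F asboolT; last first.
    move=> y z /qU yU /qU zU /=; apply: le_trans (Uc _ _ yU zU).
    by rewrite ler_wpM2r// ltW//; exact: (nP n (leqnn n)).
  by split => //; exact: nbhs_singleton.
apply: null_bigcup_countType => q; rewrite /F; case: asboolP => [qh|_].
  apply: (@null_preimage_expanding _ _ _ _ h q.2.+1%:R^-1 _ _ N0).
  - by rewrite invr_gt0.
  - by move=> y z [yq _] [zq _]; exact: qh.
  - by move=> x [].
exact: lebesgue_outer0.
Qed.

Lemma norm_ball_measurable (r : R) : mu.-caratheodory [set x : 'rV[R]_m | `|x| <= r].
Proof.
rewrite -[X in caratheodory_measurable _ X]setCK.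
apply: caratheodory_measurable_setC; apply: open_measurable_outer.
apply: closed_openC; apply: (@preimage_closed _ _ _ [set t | t <= r]).
  by move=> x _; exact: norm_continuous.
exact: closed_le.
Qed.

Lemma norm_ball_finite (r : R) : 0 <= r ->
  (mu [set x : 'rV[R]_m | (`|x| <= r)%R] < +oo)%E.
Proof.
move=> r0; apply: le_lt_trans (ltry ((2 * (r + r)) ^+ m)).
apply: lebesgue_outer_diam_le => [|y z /= yr zr]; first exact: addr_ge0.
by rewrite (le_trans (ler_normB _ _))// lerD.
Qed.

(** If infinitely many members [B d] met a ball in measure at least
    [e > 0], then the upper limit of a sequence of them would have positive
    measure, although each of its points lies in infinitely many [B d]. *)
Lemma big_slices_finite (B : R -> set 'rV[R]_m) (r e : R) :
  0 <= r -> 0 < e ->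
  (forall d, mu.-caratheodory (B d)) ->
  (forall x, finite_set [set d | B d x]) ->
  finite_set [set d | e%:E <= mu (B d `&` [set x | (`|x| <= r)%R])]%E.
Proof.
move=> r0 e0 mB Bfin; apply: contrapT => /infiniteP/ppcard_leP[f].
set K := [set x : 'rV[R]_m | `|x| <= r] in f *.
pose omu : {outer_measure set 'rV[R]_m -> \bar R} := mu.
pose nu : {measure set (caratheodory_type omu) -> \bar R} :=
  (omu : set (caratheodory_type omu) -> \bar R).
pose F n : set (caratheodory_type omu) := B (f n) `&` K.
have mF n : measurable (F n).
  by apply: caratheodory_measurable_setI => //; exact: norm_ball_measurable.
have Foo : (nu (\bigcup_(k >= 0%N) F k) < +oo)%E.
  apply: le_lt_trans (norm_ball_finite r0).
  by apply: (le_outer_measure mu) => x [k _ []].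
have cvgF := @lim_sup_set_cvg _ _ _ nu F mF Foo.
have : (e%:E <= nu (lim_sup_set F))%E.
  rewrite -(cvg_lim _ cvgF)//; apply: lime_ge.
    by apply/cvg_ex; eexists; exact: cvgF.
  apply: nearW => n.
  apply: (@le_trans _ _ (mu (F n))); last first.
    by apply: (le_outer_measure mu) => x Fx; exists n => /=.
  have := @funS _ _ _ _ f n I; exact.
have [->|/set0P[x Fx]] := eqVneq (lim_sup_set F) set0.
  by rewrite measure0 lee_fin leNgt e0.
move=> _.
have : finite_set [set n : nat | B (f n) x].
  apply: (@finite_preimage nat R _ (fun n => f n)) (Bfin x) => y z _ _.
  by move=> /(@inj _ _ _ f); apply; rewrite inE.
move=> /finite_seqP[X XE].
have [k /= Mk [Bk _]] := Fx (\max_(i <- X) i).+1 I.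
have kX : k \in X by have : [set` X] k by rewrite -XE.
by have := @leq_bigmax_seq _ X xpredT id k kX isT; rewrite leqNgt Mk.
Qed.

(** This replaces a Fubini argument on the product with the parameter line,
    and yields a countable exceptional set. *)
Lemma null_slices (B : R -> set 'rV[R]_m) :
  (forall d, mu.-caratheodory (B d)) ->
  (forall x, finite_set [set d | B d x]) ->
  exists2 E : set R, countable E & forall d, ~ E d -> mu (B d) = 0%E.
Proof.
move=> mB Bfin.
pose K N := [set x : 'rV[R]_m | `|x| <= N%:R].
pose E N := [set d | (N.+1%:R^-1)%:E <= mu (B d `&` K N)]%E.
exists (\bigcup_N E N).
  apply: bigcup_countable => // N _; apply: finite_set_countable.
  by apply: big_slices_finite => //; rewrite invr_gt0.
move=> d nEd.
apply: (@null_subset _ _ _ (\bigcup_N (B d `&` K N))).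
  move=> x Bx; exists (Num.truncn `|x|).+1 => //; split => //=; apply: ltW.
  by have /andP[] := Num.Theory.truncn_itv (normr_ge0 x).
apply: null_bigcup => N; apply/eqP; rewrite eq_le lebesgue_outer_ge0 andbT.
apply/lee_addgt0Pr => e e0; rewrite add0e.
have [n _ nP] := near_infty_natSinv_lt (PosNum e0).
pose M := maxn n N.
have : ~ E M d by move=> Ed; apply: nEd; exists M.
rewrite /E /= => /negP; rewrite -ltNge => /ltW lt.
apply: (@le_trans _ _ (mu (B d `&` K M))).
  apply: (le_outer_measure mu) => x [Bx Kx]; split => //; apply: (le_trans Kx).
  by rewrite ler_nat leq_maxr.
apply: (le_trans lt); rewrite lee_fin ltW//; apply: nP; exact: leq_maxl.
Qed.

Lemma not_countable_ex (E : set R) : countable E -> exists t, ~ E t.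
Proof.
move=> cE; apply: contrapT => nE.
have ET : E = setT by apply/seteqP; split => // t _; apply: contrapT => nt; apply: nE; exists t.
have cI : countable `[0 : R, 1]%classic.
  by apply: sub_countable cE; apply: subset_card_le; rewrite ET.
have := countable_lebesgue_measure0 cI.
rewrite lebesgue_measure_itv/= lte_fin ltr01 sube0 => /eqP.
by rewrite eqe oner_eq0.
Qed.

(** A closed set meeting each line parallel to [e] at most once has pairwise
    disjoint translates along [e], all of the same size, so [null_slices]
    forces this size to be zero. *)
Lemma null_of_line_sections (W : set 'rV[R]_m) (e : 'rV[R]_m) :
  closed W -> (forall x y t, W x -> W y -> x - y = t *: e -> t = 0) ->
  mu W = 0%E.
Proof.
move=> cW We.
pose B t := [set x | W (x - t *: e)].
have mB t : mu.-caratheodory (B t).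
  rewrite -[X in caratheodory_measurable _ X]setCK.
  apply: caratheodory_measurable_setC; apply: open_measurable_outer.
  apply: closed_openC.
  apply: (@preimage_closed 'rV[R]_m 'rV[R]_m (fun x => x - t *: e) W) => //.
  by move=> x _; apply: (@cvgB _ _ _ (nbhs x) _ id (fun=> t *: e)); [exact: cvg_id|exact: cvg_cst].
have Bfin x : finite_set [set t | B t x].
  have [[t Bt]|nB] := pselect (exists t, B t x); last first.
    by rewrite (_ : [set t | _] = set0)//; apply/seteqP; split => // t Bt; case: nB; exists t.
  apply: (@sub_finite_set _ _ [set t]); last exact: finite_set1.
  move=> s Bs /=; apply/eqP; rewrite -subr_eq0; apply/eqP.
  apply: (We _ _ _ Bt Bs); by rewrite opprB addrC addrA subrK scalerBl.
have [E cE EP] := null_slices mB Bfin.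
have [t nEt] := not_countable_ex cE.
apply: (@null_preimage_expanding _ _ _ _ (fun x => x + t *: e) 1 _ _ (EP _ nEt)) => //.
  by move=> y z _ _; rewrite mul1r opprD addrACA subrr addr0.
by move=> x Wx; rewrite /B /= addrK.
Qed.

End FiniteSlices.

(** * The real spectral theorem *)

Section Dot.
Context {R : realType}.

Definition dot n (u v : 'rV[R]_n) : R := (u *m v^T) ord0 ord0.

Lemma dotE n (u v : 'rV[R]_n) : dot u v = \sum_i u ord0 i * v ord0 i.
Proof. by rewrite /dot mxE; apply: eq_bigr => i _; rewrite mxE. Qed.

Lemma dotC n (u v : 'rV[R]_n) : dot u v = dot v u.
Proof. by rewrite !dotE; apply: eq_bigr => i _; rewrite mulrC. Qed.

Lemma dotDl n (u v w : 'rV[R]_n) : dot (u + v) w = dot u w + dot v w.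
Proof. by rewrite /dot mulmxDl mxE. Qed.

Lemma dotDr n (u v w : 'rV[R]_n) : dot w (u + v) = dot w u + dot w v.
Proof. by rewrite !(dotC w) dotDl. Qed.

Lemma dotZl n a (u v : 'rV[R]_n) : dot (a *: u) v = a * dot u v.
Proof. by rewrite /dot -scalemxAl mxE. Qed.

Lemma dotZr n a (u v : 'rV[R]_n) : dot u (a *: v) = a * dot u v.
Proof. by rewrite dotC dotZl dotC. Qed.

Lemma dotNl n (u v : 'rV[R]_n) : dot (- u) v = - dot u v.
Proof. by rewrite /dot mulNmx mxE. Qed.

Lemma dotNr n (u v : 'rV[R]_n) : dot u (- v) = - dot u v.
Proof. by rewrite dotC dotNl dotC. Qed.

Lemma norm_dot_le n (u v : 'rV[R]_n) : `|dot u v| <= n%:R * (`|u| * `|v|).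
Proof.
rewrite dotE -[n in n%:R]card_ord mulr_natl -sumr_const.
apply: (le_trans (ler_norm_sum _ _ _)); apply: ler_sum => i _.
by rewrite normrM ler_pM//; exact: mxnorm_coord.
Qed.

Lemma dot0l n (v : 'rV[R]_n) : dot 0 v = 0.
Proof. by rewrite /dot mul0mx mxE. Qed.

Lemma dot_mulmx n (A : 'M[R]_n) (u v : 'rV[R]_n) : dot (u *m A) v = dot u (v *m A^T).
Proof. by rewrite /dot trmx_mul trmxK mulmxA. Qed.

Lemma dot_ge0 n (u : 'rV[R]_n) : 0 <= dot u u.
Proof. by rewrite dotE sumr_ge0// => i _; rewrite -expr2 sqr_ge0. Qed.

Lemma dot_eq0 n (u : 'rV[R]_n) : dot u u = 0 -> u = 0.
Proof.
rewrite dotE => /eqP; rewrite psumr_eq0 => [/allP u0|i _]; last first.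
  by rewrite -expr2 sqr_ge0.
apply/rowP => i; rewrite mxE; apply/eqP.
by have := u0 i (mem_index_enum _); rewrite /= mulf_eq0 orbb.
Qed.

Lemma sqr_norm_le_dot n (u : 'rV[R]_n) : `|u| ^+ 2 <= dot u u.
Proof.
rewrite -ler_sqrt ?dot_ge0// sqrtr_sqr normr_id.
apply: mxnorm_le => [|i j]; first exact: sqrtr_ge0.
rewrite ord1 -sqrtr_sqr ler_sqrt ?dot_ge0// dotE (bigD1 j)//= -expr2 lerDl.
by apply: sumr_ge0 => k _; rewrite -expr2 sqr_ge0.
Qed.

Lemma dot_le n (u v : 'rV[R]_n) : dot u v <= n%:R * (`|u| * `|v|).
Proof. exact: le_trans (ler_norm _) (norm_dot_le _ _). Qed.

Lemma sum_continuous (T : topologicalType) n (F : 'I_n -> T -> R) :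
  (forall i, continuous (F i)) -> continuous (fun x => \sum_i F i x).
Proof.
by move=> cF; apply: (@continuous_big R^o) => //; exact: add_continuous.
Qed.

Lemma quad_continuous n (A : 'M[R]_n) :
  continuous (fun v : 'rV[R]_n => dot (v *m A) v).
Proof.
have -> : (fun v : 'rV[R]_n => dot (v *m A) v) =
    (fun v => \sum_j (\sum_k v ord0 k * A k j) * v ord0 j).
  by apply/funext => v; rewrite dotE; apply: eq_bigr => j _; rewrite mxE.
apply: sum_continuous => j v.
apply: continuousM; last exact: coord_continuous.
apply: sum_continuous => k {}v.
by apply: continuousM; [exact: coord_continuous|exact: cst_continuous].
Qed.

End Dot.

Section Spectral.
Context {R : realType} {m : nat}.

(** By compactness the quadratic form attains its maximum on the unit sphere
    of the complement of the rows of [U]; the inequality extends to all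
    vectors of the complement by homogeneity. *)
Lemma rayleigh_max k (A : 'M[R]_m) (U : 'M[R]_(k, m)) : (k < m)%N ->
  exists v : 'rV[R]_m, [/\ dot v v = 1, U *m v^T = 0 &
    forall w : 'rV[R]_m, U *m w^T = 0 -> dot (w *m A) w <= dot (v *m A) v * dot w w].
Proof.
move=> km.
pose S := [set v : 'rV[R]_m | dot v v = 1 /\ U *m v^T = 0].
have normalize (u : 'rV[R]_m) : u != 0 -> U *m u^T = 0 ->
    S ((Num.sqrt (dot u u))^-1 *: u).
  move=> u0 Ou; have du : 0 < dot u u.
    by rewrite lt_def dot_ge0 andbT; apply: contraNneq u0 => /dot_eq0 ->.
  split; last by rewrite linearZ/= -scalemxAr Ou scaler0.
  rewrite dotZl dotZr mulrA -expr2 exprVn sqr_sqrtr ?dot_ge0//.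
  by rewrite mulVf// gt_eqF.
have [v Sv vmax] : exists2 v, S v & forall w, S w -> dot (w *m A) w <= dot (v *m A) v.
  suff [ne [cS fS]] : S !=set0 /\ compact S /\
      {within S, continuous (fun v : 'rV[R]_m => dot (v *m A) v)}.
    have [v /set_mem Sv vmax] := EVT_max_rV ne cS fS.
    by exists v => // w Sw; apply: vmax; rewrite inE.
  split; last split.
  - have : kermx U^T != 0.
      rewrite -mxrank_eq0 mxrank_ker -lt0n subn_gt0 mxrank_tr.
      exact: leq_ltn_trans (rank_leq_row _) km.
    move=> /rowV0Pn[u /sub_kermxP uO u0].
    exists ((Num.sqrt (dot u u))^-1 *: u); apply: normalize => //.
    by rewrite -(trmxK U) -trmx_mul uO trmx0.
  - apply: bounded_closed_compact.
      exists 1; split; first exact: num_real.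
      move=> r r1 v [v1 _] /=; apply/ltW/(le_lt_trans _ r1).
      rewrite -(@ler_pXn2r R 2) ?nnegrE// expr1n -v1.
      exact: sqr_norm_le_dot.
    rewrite (_ : S = (fun v => dot (v *m 1%:M) v) @^-1` [set 1] `&`
       \bigcap_(i in [set: 'I_k]) (fun v => \sum_j U i j * v ord0 j) @^-1` [set 0]).
      apply: closedI.
        apply: (@preimage_closed _ R^o) => [v _|]; first exact: quad_continuous.
        exact: closed_eq.
      apply: closed_bigI => i _.
      apply: (@preimage_closed _ R^o) => [v _|]; last exact: closed_eq.
      apply: sum_continuous => j {}v.
      by apply: continuousM; [exact: cst_continuous|exact: coord_continuous].
    apply/seteqP; split => v /=.
      move=> [v1 Ov]; split; first by rewrite mulmx1.
      move=> i _ /=; transitivity ((U *m v^T) i ord0); last by rewrite Ov mxE.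
      by rewrite mxE; apply: eq_bigr => j _; rewrite mxE.
    rewrite mulmx1 => -[v1 Ov]; split => //; apply/colP => i; rewrite mxE [RHS]mxE.
    by rewrite -[RHS](Ov i I); apply: eq_bigr => j _; rewrite mxE.
  - apply: continuous_subspaceT; exact: quad_continuous.
exists v; have [v1 Ov] := Sv; split => // w Ow.
have [->|w0] := eqVneq w 0; first by rewrite mul0mx !dot0l mulr0.
have dw : 0 < dot w w.
  by rewrite lt_def dot_ge0 andbT; apply: contraNneq w0 => /dot_eq0 ->.
have := vmax _ (normalize _ w0 Ow).
rewrite -scalemxAl dotZl dotZr mulrA -expr2 exprVn sqr_sqrtr ?dot_ge0//.
by rewrite mulrC ler_pdivrMr.
Qed.

(** A maximizer [v] of the quadratic form on the complement of the
    eigenvectors found so far is the next eigenvector: if the residual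
    [h = v *m A - t *: v] were nonzero, moving from [v] in the direction [h]
    would increase the quotient to first order. *)
Lemma spectral_extend k (A : 'M[R]_m) : A^T = A -> (k <= m)%N ->
  exists (U : 'M[R]_(k, m)) (l : 'rV[R]_k),
    U *m U^T = 1%:M /\ U *m A = diag_mx l *m U.
Proof.
move=> sA; elim: k => [|k IH] km.
  by exists 0, 0; split; apply/matrixP; case.
have [U [l [OO OA]]] := IH (ltnW km).
have [v [v1 Ov vmax]] := rayleigh_max A U km.
pose t := dot (v *m A) v.
have [h hE] : exists h, h = v *m A - t *: v by eexists.
have vO : v *m U^T = 0 by rewrite -[v]trmxK -trmx_mul Ov trmx0.
have Oh : U *m h^T = 0.
  rewrite hE linearB/= mulmxBr trmx_mul sA mulmxA OA -mulmxA Ov mulmx0.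
  by rewrite linearZ/= -scalemxAr Ov scaler0 subr0.
have hv : dot h v = 0 by rewrite hE dotDl -scaleNr dotZl v1 mulr1 subrr.
have h0 : h = 0.
  apply: dot_eq0; apply/eqP; rewrite eq_le dot_ge0 andbT leNgt; apply/negP => hh.
  pose q := dot (h *m A) h.
  have vAh : dot (v *m A) h = dot h h.
    by rewrite -[v *m A](subrK (t *: v)) -hE dotDl dotZl (dotC v) hv mulr0 addr0.
  have hAv : dot (h *m A) v = dot h h by rewrite dot_mulmx sA dotC vAh.
  have key s : 2 * s * dot h h <= s ^+ 2 * (t * dot h h - q).
    have := vmax (v + s *: h).
    rewrite linearD/= mulmxDr Ov add0r linearZ/= -scalemxAr Oh scaler0 => /(_ erefl).
    rewrite mulmxDl -scalemxAl !dotDl !dotDr !dotZl !dotZr v1 (dotC v h) hv hAv vAh -/t -/q.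
    nra.
  pose K := `|t * dot h h - q| + 1.
  have K0 : 0 < K by rewrite ltr_wpDl.
  have := key (dot h h / K); apply/negP; rewrite -ltNge.
  apply: (@le_lt_trans _ _ ((dot h h / K) ^+ 2 * K)).
    rewrite ler_wpM2l ?sqr_ge0//; apply: (le_trans (ler_norm _)).
    by rewrite /K lerDl.
  have -> : (dot h h / K) ^+ 2 * K = (dot h h / K) * dot h h.
    by field; rewrite gt_eqF.
  by rewrite ltr_pM2r// ltr_pMl ?divr_gt0//; lra.
have vA : v *m A = t *: v by apply/eqP; rewrite -subr_eq0 -hE h0.
rewrite -addn1; exists (col_mx U v), (row_mx l (t%:M)); split.
  rewrite tr_col_mx mul_col_row OO Ov vO.
  have -> : v *m v^T = 1%:M by apply/matrixP => i j; rewrite !ord1 -[LHS]/(dot v v) v1 mxE.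
  by rewrite -scalar_mx_block.
rewrite mul_col_mx diag_mx_row mul_block_col !mul0mx add0r addr0 OA; congr col_mx.
rewrite vA; apply/matrixP => i j; rewrite !mxE big_ord1 !mxE !ord1 eqxx.
by rewrite !mulr1n.
Qed.

Theorem real_spectral (A : 'M[R]_m) : A^T = A ->
  exists (U : 'M[R]_m) (l : 'rV[R]_m),
    U *m U^T = 1%:M /\ U *m A = diag_mx l *m U.
Proof. by move=> sA; exact: spectral_extend. Qed.

End Spectral.

(** * Orthogonal projections on sums of eigenspaces *)

Section SpectralProj.
Import finmap.
Context {R : realType} {m : nat}.

Lemma row_diag_mul n p (l : 'rV[R]_n) (A : 'M[R]_(n, p)) i :
  row i (diag_mx l *m A) = l ord0 i *: row i A.
Proof. by apply/rowP => j; rewrite mul_diag_mx !mxE. Qed.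

Lemma orth_proj_id_row (U : 'M[R]_m) (W : 'rV[R]_m) :
  (W <= U)%MS -> W *m orth_proj U = W.
Proof.
move=> WU; apply: proj_mx_id => //.
apply/eqP; rewrite -submx0; apply/rV_subP => w; rewrite sub_capmx.
move=> /andP[/submxP[x wx] /sub_kermxP wU]; rewrite submx0; apply/eqP.
by apply: dot_eq0; rewrite /dot {2}wx trmx_mul mulmxA wU mul0mx mxE.
Qed.

Lemma orth_proj_0 (U : 'M[R]_m) (W : 'rV[R]_m) : (W *m U^T = 0) -> W *m orth_proj U = 0.
Proof.
move=> WU; apply: proj_mx_0; last exact/sub_kermxP.
apply/eqP; rewrite -submx0; apply/rV_subP => w; rewrite sub_capmx.
move=> /andP[/submxP[x wx] /sub_kermxP wU]; rewrite submx0; apply/eqP.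
by apply: dot_eq0; rewrite /dot {2}wx trmx_mul mulmxA wU mul0mx mxE.
Qed.

Lemma finite_roots (p : {poly R}) : p != 0 -> finite_set [set x | root p x].
Proof.
move=> p0; apply: contrapT => /(infinite_set_fset (size p))[B BP sB].
have rB : all (root p) B by apply/allP => x xB; exact: BP.
by have := max_poly_roots p0 rB (fset_uniq B); rewrite ltnNge sB.
Qed.

(** The eigenvalues are roots of the characteristic polynomial, hence finite
    in number: the sum defining the span is a true finite sum. *)
Lemma eigenspan_sub (A : 'M[R]_m) (P : set R) (a : R) (v : 'rV[R]_m) :
  P a -> v *m A = a *: v -> (v <= eigenspan A P)%MS.
Proof.
move=> Pa /eigenspaceP va; rewrite /eigenspan; case: finite_supportP => [|X XP X0 _].
  case; apply: sub_finite_set (finite_roots (monic_neq0 (char_poly_monic A))).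
  by move=> b [_ /= /eqP b0]; rewrite -eigenvalue_root_char.
have [aX|/(X0 _ Pa) a0] := boolP (a \in X); last first.
  by move: va; rewrite a0 submx0 => /eqP ->; exact: sub0mx.
by rewrite (big_rem a aX)/=; apply: submx_trans va (addsmxSl _ _).
Qed.

Lemma eigenspan_orth (A : 'M[R]_m) (P : set R) (w : 'rV[R]_m) :
  (forall a v, P a -> v *m A = a *: v -> dot v w = 0) ->
  w *m (eigenspan A P)^T = 0.
Proof.
move=> Pw.
suff : (eigenspan A P <= kermx w^T)%MS.
  by move=> /sub_kermxP uw; rewrite -(trmxK w) -trmx_mul uw trmx0.
rewrite /eigenspan; case: finite_supportP => [|X XP _ _].
  by rewrite big_nil sub0mx.
rewrite big_seq; elim/big_rec : _ => [|a U aX UW]; first exact: sub0mx.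
rewrite addsmx_sub UW andbT; apply/rV_subP => v /eigenspaceP va.
apply/sub_kermxP/matrixP => i j; rewrite !ord1 [RHS]mxE.
exact: Pw (XP _ aX) va.
Qed.

(** Eigenvectors of a symmetric matrix for different eigenvalues are
    orthogonal. So a row of [U] lies in the span when its eigenvalue satisfies
    [P], and is orthogonal to the span otherwise. *)
Lemma orth_proj_eigenspan (A U : 'M[R]_m) (l : 'rV[R]_m) (P : set R) :
  A^T = A -> U *m U^T = 1%:M -> U *m A = diag_mx l *m U ->
  orth_proj (eigenspan A P) =
  U^T *m diag_mx (\row_i (`[< P (l ord0 i) >])%:R) *m U.
Proof.
move=> sA UU UA.
have UtU : U^T *m U = 1%:M by exact: mulmx1C.
suff UP : U *m orth_proj (eigenspan A P) =
    diag_mx (\row_i (`[< P (l ord0 i) >])%:R) *m U.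
  by rewrite -mulmxA -UP mulmxA UtU mul1mx.
have rowA i : row i U *m A = l ord0 i *: row i U.
  by rewrite -row_mul UA row_diag_mul.
apply/row_matrixP => i; rewrite row_mul row_diag_mul mxE.
case: asboolP => [Pi|nPi].
  rewrite scale1r; apply: orth_proj_id_row.
  exact: eigenspan_sub Pi (rowA i).
rewrite scale0r; apply: orth_proj_0; apply: eigenspan_orth => a v Pa va.
have : (a - l ord0 i) * dot v (row i U) = 0.
  by rewrite mulrBl -!dotZl -va dot_mulmx sA rowA dotZr dotZl subrr.
move=> /eqP; rewrite mulf_eq0 subr_eq0 => /orP[/eqP ai|/eqP//].
by case: nPi; rewrite -ai.
Qed.

End SpectralProj.

(** * Sign and modulus of a symmetric matrix *)

HB.lock Definition sgnmx (R : realType) (m : nat) (A : 'M[R]_m) : 'M[R]_m :=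
  pr_pos A - pr_neg A.

HB.lock Definition absmx (R : realType) (m : nat) (A : 'M[R]_m) : 'M[R]_m :=
  A *m sgnmx A.

Section AbsMatrix.
Context {R : realType} {m : nat}.
Implicit Types (A P Q X Y : 'M[R]_m).

Lemma sgnmx_def A : sgnmx A = pr_pos A - pr_neg A.
Proof. by rewrite sgnmx.unlock. Qed.

Lemma absmx_def A : absmx A = A *m sgnmx A.
Proof. by rewrite absmx.unlock. Qed.

Definition spectral_basis A (U : 'M[R]_m) (l : 'rV[R]_m) :=
  U *m U^T = 1%:M /\ U *m A = diag_mx l *m U.

Definition in_basis (U : 'M[R]_m) (l : 'rV[R]_m) := U^T *m diag_mx l *m U.

Lemma in_basis_sym U l : (in_basis U l)^T = in_basis U l.
Proof. by rewrite /in_basis !trmx_mul trmxK tr_diag_mx mulmxA. Qed.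

Lemma in_basis_mul U l k : U *m U^T = 1%:M ->
  in_basis U l *m in_basis U k = in_basis U (\row_i (l ord0 i * k ord0 i)).
Proof.
move=> UU; rewrite /in_basis !mulmxA -[_ *m U *m U^T]mulmxA UU mulmx1.
by rewrite -[_ *m diag_mx l *m diag_mx k]mulmxA mulmx_diag.
Qed.

Lemma in_basis1 U : U *m U^T = 1%:M -> in_basis U (const_mx 1) = 1%:M.
Proof. by move=> /mulmx1C UU; rewrite /in_basis diag_const_mx mulmx1. Qed.

Lemma spectral_basisE A U l : spectral_basis A U l -> A = in_basis U l.
Proof.
by move=> [UU UA]; rewrite /in_basis -mulmxA -UA mulmxA (mulmx1C UU) mul1mx.
Qed.

Lemma sgnmxE A U l : A^T = A -> spectral_basis A U l ->
  sgnmx A = in_basis U (\row_i Num.sg (l ord0 i)).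
Proof.
move=> sA [UU UA].
rewrite sgnmx_def /pr_pos /pr_neg !(orth_proj_eigenspan _ sA UU UA).
rewrite /in_basis -mulmxBl -mulmxBr -raddfB/=; congr (_ *m diag_mx _ *m _).
apply/rowP => i; rewrite !mxE !asboolb.
by case: (ltrgtP (l ord0 i) 0) => h; rewrite ?subr0 ?sub0r ?subrr//=;
  [rewrite ltr0_sg|rewrite gtr0_sg|rewrite h sgr0].
Qed.

Lemma absmxE A U l : A^T = A -> spectral_basis A U l ->
  absmx A = in_basis U (\row_i `|l ord0 i|).
Proof.
move=> sA Al; have [UU _] := Al.
rewrite absmx_def (sgnmxE sA Al) {1}(spectral_basisE Al) in_basis_mul//.
by congr in_basis; apply/rowP => i; rewrite !mxE mulrC normrEsg.
Qed.

Lemma spectral_basis_neq0 A U l i :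
  spectral_basis A U l -> A \in unitmx -> l ord0 i != 0.
Proof.
move=> [UU UA] uA; apply/negP => /eqP li0.
have : row i U *m A = 0 by rewrite -row_mul UA row_diag_mul li0 scale0r.
move=> /(congr1 (mulmx^~ (invmx A))); rewrite mulmxK// mul0mx => Ui0.
have : (U *m U^T) i i = 0.
  have -> : (U *m U^T) i i = dot (row i U) (row i U).
    by rewrite dotE mxE; apply: eq_bigr => j _; rewrite !mxE.
  by rewrite Ui0 dot0l.
by rewrite UU mxE eqxx => /eqP; rewrite oner_eq0.
Qed.

Lemma sgnmx_sym A : A^T = A -> (sgnmx A)^T = sgnmx A.
Proof.
move=> sA; have [U [l Ul]] := real_spectral sA.
by rewrite (sgnmxE sA Ul) in_basis_sym.
Qed.

Lemma sgnmx_sqr A : A^T = A -> A \in unitmx -> sgnmx A *m sgnmx A = 1%:M.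
Proof.
move=> sA uA; have [U [l Ul]] := real_spectral sA; have [UU _] := Ul.
rewrite (sgnmxE sA Ul) in_basis_mul// -(in_basis1 UU); congr in_basis.
apply/rowP => i; rewrite !mxE -expr2 sqr_sg.
by rewrite (spectral_basis_neq0 _ Ul uA).
Qed.

Lemma sgnmx_comm A : A^T = A -> sgnmx A *m A = A *m sgnmx A.
Proof.
move=> sA; have [U [l Ul]] := real_spectral sA; have [UU _] := Ul.
rewrite (sgnmxE sA Ul) (spectral_basisE Ul) !in_basis_mul//; congr in_basis.
by apply/rowP => i; rewrite !mxE mulrC.
Qed.

Lemma absmx_sym A : A^T = A -> (absmx A)^T = absmx A.
Proof. by move=> sA; rewrite absmx_def trmx_mul sgnmx_sym// sA sgnmx_comm. Qed.

Lemma absmx_sqr A : A^T = A -> A \in unitmx -> absmx A *m absmx A = A *m A.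
Proof.
move=> sA uA; rewrite absmx_def -{2}(sgnmx_comm sA) mulmxA -[A *m _ *m _]mulmxA.
by rewrite sgnmx_sqr// mulmx1.
Qed.

Lemma absmx_unit A : A^T = A -> A \in unitmx -> absmx A \in unitmx.
Proof.
move=> sA uA; rewrite absmx_def unitmx_mul uA /=.
by have /mulmx1_unit[] := sgnmx_sqr sA uA.
Qed.

Lemma sgnmx_norm_le1 A : A^T = A -> A \in unitmx -> `|sgnmx A| <= 1.
Proof.
move=> sA uA; apply: mxnorm_le => // i j.
have d1 : dot (row i (sgnmx A)) (row i (sgnmx A)) = 1.
  transitivity ((sgnmx A *m (sgnmx A)^T) i i).
    by rewrite dotE mxE; apply: eq_bigr => k _; rewrite !mxE.
  by rewrite sgnmx_sym// sgnmx_sqr// mxE eqxx.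
have := mxnorm_coord (row i (sgnmx A)) ord0 j; rewrite mxE => /le_trans; apply.
by rewrite -(@ler_pXn2r R 2) ?nnegrE// expr1n -d1; exact: sqr_norm_le_dot.
Qed.

(** Quantitative invertibility; it is an open condition on [A]. *)
Definition coercive (k : R) A := forall v : 'rV[R]_m, k * `|v| <= `|v *m A|.

Definition positive_by (k : R) P :=
  forall v : 'rV[R]_m, k * dot v v <= dot (v *m P) v.

Lemma coercive_unit k A : 0 < k -> coercive k A -> A \in unitmx.
Proof.
move=> k0 kA; rewrite -row_free_unit -kermx_eq0; apply/eqP.
apply/row_matrixP => i; rewrite row0; apply/eqP; rewrite -normr_le0.
have := kA (row i (kermx A)); rewrite -row_mul mulmx_ker row0 normr0.
by rewrite pmulr_rle0.
Qed.

Lemma unit_coercive A : A \in unitmx -> exists2 k, 0 < k & coercive k A.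
Proof.
move=> uA; pose K := m%:R * `|invmx A| + 1.
have K0 : 0 < K by rewrite ltr_wpDl// mulr_ge0.
exists K^-1; first by rewrite invr_gt0.
move=> v; rewrite ler_pdivrMl// -{1}[v](mulmxK uA).
apply: (le_trans (mxnorm_mul _ _)).
by rewrite mulrAC ler_wpM2r// /K lerDl.
Qed.

Lemma coercive_perturb k A B : coercive k A -> m%:R * `|A - B| <= k / 2 ->
  coercive (k / 2) B.
Proof.
move=> kA AB v; have -> : v *m B = v *m A - v *m (A - B).
  by rewrite mulmxBr opprB addrC subrK.
apply: le_trans (lerB_dist _ _).
have := mxnorm_mul v (A - B); have := kA v.
have : m%:R * `|A - B| * `|v| <= k / 2 * `|v| by rewrite ler_wpM2r.
nra.
Qed.

Lemma spectral_eigen_le k A U l i : spectral_basis A U l -> coercive k A ->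
  k <= `|l ord0 i|.
Proof.
move=> [UU UA] kA.
have : k * `|row i U| <= `|l ord0 i| * `|row i U|.
  by have := kA (row i U); rewrite -row_mul UA row_diag_mul normrZ.
rewrite ler_pM2r// normr_gt0; apply/negP => /eqP Ui0.
have : (U *m U^T) i i = dot (row i U) (row i U).
  by rewrite dotE mxE; apply: eq_bigr => j _; rewrite !mxE.
by rewrite Ui0 dot0l UU mxE eqxx => /eqP; rewrite oner_eq0.
Qed.

Lemma dot_in_basis U l (v : 'rV[R]_m) :
  dot (v *m in_basis U l) v = \sum_i l ord0 i * (v *m U^T) ord0 i ^+ 2.
Proof.
rewrite /in_basis /dot.
have -> : v *m (U^T *m diag_mx l *m U) *m v^T =
    (v *m U^T *m diag_mx l) *m (v *m U^T)^T by rewrite trmx_mul trmxK !mulmxA.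
rewrite -[LHS]/(dot _ _) dotE; apply: eq_bigr => i _.
by rewrite mul_mx_diag mxE expr2 mulrAC mulrC.
Qed.

(** Every eigenvalue of a [k]-coercive matrix has modulus at least [k]. *)
Lemma absmx_positive k A : A^T = A -> coercive k A -> positive_by k (absmx A).
Proof.
move=> sA kA v; have [U [l Ul]] := real_spectral sA; have [UU _] := Ul.
rewrite (absmxE sA Ul) dot_in_basis -{1}[v]mulmx1 -(in_basis1 UU) dot_in_basis.
rewrite mulr_sumr; apply: ler_sum => i _; rewrite !mxE mul1r ler_wpM2r ?sqr_ge0//.
exact: spectral_eigen_le Ul kA.
Qed.

Lemma sgnmx_positive k A : A^T = A -> 0 < k -> positive_by k A -> sgnmx A = 1%:M.
Proof.
move=> sA k0 kA; have [U [l Ul]] := real_spectral sA; have [UU UA] := Ul.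
rewrite (sgnmxE sA Ul) -(in_basis1 UU); congr in_basis; apply/rowP => i.
rewrite !mxE gtr0_sg//.
have rr : dot (row i U) (row i U) = 1.
  transitivity ((U *m U^T) i i); last by rewrite UU mxE eqxx.
  by rewrite dotE mxE; apply: eq_bigr => j _; rewrite !mxE.
have := kA (row i U); rewrite -row_mul UA row_diag_mul dotZl rr !mulr1.
exact: lt_le_trans.
Qed.

Lemma positive_norm k P (v : 'rV[R]_m) : 0 < k -> positive_by k P ->
  k * `|v| <= m%:R * `|v *m P|.
Proof.
move=> k0 kP; have [->|v0] := eqVneq v 0; first by rewrite normr0 mulr0 mulr_ge0.
have v1 : 0 < `|v| by rewrite normr_gt0.
rewrite -(ler_pM2r v1) -(mulrA k) -expr2 -(mulrA m%:R).
apply: le_trans (dot_le _ _); apply: le_trans (kP v).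
by rewrite ler_pM2l// sqr_norm_le_dot.
Qed.

(** The Frobenius inner product turns coercivity of [P] and [Q] into
    coercivity of the Sylvester operator [X |-> P X + X Q]. *)
Lemma sylvester_le k P Q X Y : 0 < k -> P^T = P ->
  positive_by k P -> positive_by k Q -> P *m X + X *m Q = Y ->
  k * `|X| <= m%:R * `|Y|.
Proof.
move=> k0 sP kP kQ PXQ.
pose F X Y := \sum_i dot (row i X) (row i Y).
have FT V W : F V W = F V^T W^T.
  rewrite /F; under eq_bigr do rewrite dotE.
  under [RHS]eq_bigr do rewrite dotE.
  rewrite exchange_big; apply: eq_bigr => i _; apply: eq_bigr => j _.
  by rewrite !mxE.
have F2 V : F V V = \sum_i \sum_j V i j ^+ 2.
  by apply: eq_bigr => i _; rewrite dotE; apply: eq_bigr => j _; rewrite !mxE expr2.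
have Fle V : `|V| ^+ 2 <= F V V.
  have F0 : 0 <= F V V by apply: sumr_ge0 => i _; exact: dot_ge0.
  rewrite -ler_sqrt// sqrtr_sqr normr_id.
  apply: mxnorm_le => [|i j]; first exact: sqrtr_ge0.
  rewrite -sqrtr_sqr ler_sqrt// F2 (bigD1 i)//= (bigD1 j)//= -addrA lerDl.
  rewrite addr_ge0//; apply: sumr_ge0 => k1 _; first exact: sqr_ge0.
  by apply: sumr_ge0 => k2 _; exact: sqr_ge0.
have Fge V : F V V <= (m%:R * `|V|) ^+ 2.
  rewrite F2; have -> : (m%:R * `|V|) ^+ 2 = \sum_(i < m) \sum_(j < m) `|V| ^+ 2.
    by rewrite !sumr_const !card_ord -[RHS]mulr_natl -[X in _ = _ * X]mulr_natl; ring.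
  apply: ler_sum => i _; apply: ler_sum => j _.
  by rewrite -real_normK ?num_real// ler_pXn2r ?nnegrE// mxnorm_coord.
have FQ : k * F X X <= F X (X *m Q).
  rewrite /F mulr_sumr; apply: ler_sum => i _.
  by rewrite row_mul [leRHS]dotC; exact: kQ.
have FP : k * F X X <= F X (P *m X).
  rewrite FT [in leRHS]FT trmx_mul sP /F mulr_sumr; apply: ler_sum => i _.
  by rewrite row_mul [leRHS]dotC; exact: kP.
have FD : F X Y = F X (P *m X) + F X (X *m Q).
  rewrite -PXQ /F -big_split/=; apply: eq_bigr => i _.
  by rewrite raddfD/= dotDr.
(* The weight leaves half of the coercivity [2 * k * F X X]. *)
have Fam : F X Y <= k * F X X + F Y Y / (4 * k).
  rewrite /F mulr_sumr mulr_suml -big_split/=; apply: ler_sum => i _.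
  rewrite !dotE mulr_sumr mulr_suml -big_split/=; apply: ler_sum => j _.
  set x := row i X ord0 j; set y := row i Y ord0 j.
  have -> : k * (x * x) + y * y / (4 * k) = x * y + (2 * k * x - y) ^+ 2 / (4 * k).
    by field; rewrite gt_eqF.
  by rewrite lerDl divr_ge0 ?sqr_ge0// mulr_ge0// ltW.
have : (2 * k * `|X|) ^+ 2 <= (m%:R * `|Y|) ^+ 2.
  apply: le_trans (Fge Y).
  have : k * F X X <= F Y Y / (4 * k) by lra.
  rewrite ler_pdivlMr ?mulr_gt0// => kF.
  apply: le_trans kF; have := Fle X.
  have k2 : 0 < k ^+ 2 by rewrite exprn_gt0.
  nra.
rewrite ler_pXn2r ?nnegrE ?mulr_ge0 ?(ltW k0)//; apply: le_trans.
by have := mulr_ge0 (ltW k0) (normr_ge0 X); lra.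
Qed.

End AbsMatrix.

(** * Mean value theorem and strict derivatives *)

Section LineMVT.
Context {R : realType} {V : normedModType R}.

Lemma is_derive_line (h : V -> R) (a v : V) (t : R) :
  derivable h (a + t *: v) v ->
  is_derive t (1 : R) (fun s : R => h (a + s *: v)) ('D_v h (a + t *: v)).
Proof.
move=> hd.
have E : (fun s : R => s^-1 *: (((fun s : R => h (a + s *: v)) \o shift t)
      (s *: (1 : R)) - h (a + t *: v))) =
    (fun s => s^-1 *: ((h \o shift (a + t *: v)) (s *: v) - h (a + t *: v))).
  apply/funext => s /=; congr (_ *: (h _ - _)).
  by rewrite -[s *: 1]/(s * 1) mulr1 scalerDl addrCA.
by split; rewrite /derivable /derive E.
Qed.

Lemma mvt_line (h : V -> R) (a v : V) (c : R) :
  (forall t, derivable h (a + t *: v) v) ->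
  exists t, [/\ `|t| <= `|c|, 0 <= t * c &
    h (a + c *: v) - h a = c * 'D_v h (a + t *: v)].
Proof.
move=> hd.
pose phi (t : R) := h (a + t *: v).
have dphi (t : R) : is_derive t (1 : R) phi ('D_v h (a + t *: v)).
  exact: is_derive_line.
have cphi : continuous phi.
  move=> t; apply/differentiable_continuous/derivable1_diffP.
  by have [] := dphi t.
have phi0 : phi 0 = h a by rewrite /phi scale0r addr0.
have [c0|c0] := leP 0 c.
  have [t] := MVT_segment c0 (fun t _ => dphi t) (continuous_subspaceT cphi).
  rewrite in_itv/= => /andP[t0 tc] E; exists t; split; [by rewrite !ger0_norm|exact: mulr_ge0|].
  by rewrite -phi0 -[h (a + _)]/(phi c) E subr0 mulrC.
have [t] := MVT_segment (ltW c0) (fun t _ => dphi t) (continuous_subspaceT cphi).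
rewrite in_itv/= => /andP[t0 tc] E; exists t; split.
- by rewrite !ler0_norm ?(ltW c0)// lerN2.
- by rewrite nmulr_lge0.
rewrite -phi0 -[h (a + _)]/(phi c) -opprB E; ring.
Qed.

End LineMVT.

Section StrictDiff.
Context {R : realType} {m : nat}.
Local Notation V := 'rV[R]_m.

(** Both arguments of the difference vary. This strong form of
    differentiability is what makes [F] injective with a Lipschitz inverse
    near a point where [L] is injective. *)
Definition strict_diff {W : normedModType R} (F : V -> W) (x : V) (L : V -> W) :=
  forall e, 0 < e -> \forall p \near (x, x),
    `|F p.1 - F p.2 - L (p.1 - p.2)| <= e * `|p.1 - p.2|.

Definition loc_lip {W : normedModType R} (F : V -> W) (x : V) :=
  exists2 K, 0 < K & \forall p \near (x, x), `|F p.1 - F p.2| <= K * `|p.1 - p.2|.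

Lemma near_pairP (x : V) (Q : V * V -> Prop) :
  (\forall p \near (x, x), Q p) <->
  exists2 r, 0 < r & forall y z, `|y - x| < r -> `|z - x| < r -> Q (y, z).
Proof.
split.
  move=> [[A B] [/= xA xB] AB].
  have /nbhs_ballP[r /= r0 rAB] : nbhs x (A `&` B) by exact: filterI.
  exists r => // y z yr zr; apply: AB; split => /=.
    by have [] : (A `&` B) y by apply: rAB; rewrite mx_norm_ball /ball_/= distrC.
  by have [] : (A `&` B) z by apply: rAB; rewrite mx_norm_ball /ball_/= distrC.
move=> [r r0 rQ]; exists (ball x r, ball x r).
  by split; exact: nbhsx_ballx.
move=> [y z] /= [yr zr].
by apply: rQ; rewrite distrC; [move: yr|move: zr]; rewrite mx_norm_ball.
Qed.

Lemma near_normP (x : V) (Q : V -> Prop) :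
  (\forall y \near x, Q y) <-> exists2 r, 0 < r & forall y, `|y - x| < r -> Q y.
Proof.
split.
  move=> /nbhs_ballP[r /= r0 rQ]; exists r => // y yr.
  by apply: rQ; rewrite mx_norm_ball /ball_/= distrC.
move=> [r r0 rQ]; apply/nbhs_ballP; exists r => //= y.
by rewrite mx_norm_ball /ball_/= distrC => /rQ.
Qed.

Lemma near_fst_snd (x : V) (Q : V -> Prop) : (\forall y \near x, Q y) ->
  \forall p \near (x, x), Q p.1 /\ Q p.2.
Proof.
by move=> /near_normP[r r0 rQ]; apply/near_pairP; exists r => // y z /rQ + /rQ.
Qed.

Lemma near_diag (x : V) (Q : V * V -> Prop) : (\forall p \near (x, x), Q p) ->
  \forall y \near x, Q (y, x).
Proof.
move=> /near_pairP[r r0 rQ]; apply/near_normP; exists r => // y yr.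
by apply: rQ => //; rewrite subrr normr0.
Qed.

(** Change one coordinate at a time from [z] to [y] and apply the mean value
    theorem to each change. *)
Lemma C1_strict_diff (h : V -> R) (x : V) : Ck 1 h ->
  strict_diff (W := R^o) h x (fun u => \sum_k u ord0 k * partial h k x).
Proof.
move=> [_ hC] e e0.
pose e' := e / m.+1%:R.
have e'0 : 0 < e' by rewrite divr_gt0.
have : \forall y \near x, forall k, `|partial h k y - partial h k x| <= e'.
  have H k : \forall y \near x, `|partial h k y - partial h k x| <= e'.
    have [_ [pc _]] := hC k.
    have /cvgrPdist_le/(_ _ e'0) := pc x.
    by apply: filterS => y; rewrite distrC.
  exact: (@filter_forall _ _ (fun k y => `|partial h k y - partial h k x| <= e') _ _ H).
(* The mean value point lies within [|y_k - z_k| < 2 * r / 3] of [z_k]. *)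
move=> /near_normP[r r0 rP]; apply/near_pairP; exists (r / 3); first by rewrite divr_gt0.
move=> y z yr zr /=.
pose w (k : nat) : V := \row_i if (i < k)%N then y ord0 i else z ord0 i.
have wm : w m = y by apply/rowP => i; rewrite mxE ltn_ord.
have w0 : w 0%N = z by apply/rowP => i; rewrite mxE ltn0.
have wS (k : 'I_m) : w k.+1 = w k + (y - z) ord0 k *: delta_mx ord0 k.
  apply/rowP => i; rewrite !mxE ltnS leq_eqVlt eqxx/=.
  have [->|ik] := eqVneq i k; first by rewrite ?eqxx ?ltnn/= mulr1 addrC subrK.
  by rewrite (inj_eq val_inj) (negbTE ik) /= mulr0 addr0.
have step (k : 'I_m) : `|h (w k.+1) - h (w k) - (y - z) ord0 k * partial h k x|
    <= e' * `|y - z|.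
  have hd t : derivable h (w k + t *: delta_mx ord0 k) (delta_mx ord0 k).
    by have [+ _] := hC k; exact.
  have [t [tc _ E]] := mvt_line ((y - z) ord0 k) hd.
  rewrite wS E -mulrBr normrM mulrC ler_pM//; last exact: mxnorm_coord.
  apply: rP.
  apply: mxnorm_lt => // i j; have -> : i = ord0 by rewrite ord1.
  rewrite !mxE /=.
  have yj := le_lt_trans (mxnorm_coord (y - x) ord0 j) yr.
  have zj := le_lt_trans (mxnorm_coord (z - x) ord0 j) zr.
  have [jk|jk] := eqVneq j k; last first.
    rewrite mulr0 addr0; move: yj zj; rewrite !mxE; case: ifP => _; lra.
  rewrite jk ltnn mulr1.
  move: tc yj zj; rewrite jk !mxE.
  set Y := y ord0 k; set Z := z ord0 k; set X := x ord0 k.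
  rewrite ler_norml !ltr_norml => /andP[t1 t2] /andP[y1 y2] /andP[z1 z2].
  have : `|Y - Z| < 2 * (r / 3) by rewrite ltr_norml; lra.
  move=> YZ; lra.
rewrite -{1}wm -{1}w0 -(telescope_sumr (fun k => h (w k)) (leq0n m)).
rewrite big_mkord -sumrB; apply: (le_trans (ler_norm_sum _ _ _)).
apply: (@le_trans _ _ (\sum_(k < m) (e' * `|y - z|))).
  by apply: ler_sum => k _; exact: step.
rewrite sumr_const card_ord -mulr_natl mulrA ler_wpM2r//.
by rewrite /e' mulrCA ger_pMr// ler_pdivrMr// mul1r ler_nat.
Qed.

End StrictDiff.

(** * Symmetry of second derivatives *)

Section C1Calculus.
Context {R : realType} {m : nat}.
Local Notation V := 'rV[R]_m.
Implicit Types (h f : V -> R) (x y z : V).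

(** The differential of [h] at [x] applied to [u]. *)
Definition dirder h x (u : V) : R := \sum_k u ord0 k * partial h k x.

Lemma dirderZ h x (s : R) (u : V) : dirder h x (s *: u) = s * dirder h x u.
Proof.
by rewrite /dirder mulr_sumr; apply: eq_bigr => k _; rewrite mxE mulrA.
Qed.

Lemma dirder_delta h x i : dirder h x (delta_mx ord0 i) = partial h i x.
Proof.
rewrite /dirder (bigD1 i)//= big1 ?addr0 => [|j ji]; first by rewrite mxE !eqxx mul1r.
by rewrite mxE (negbTE ji) mul0r.
Qed.

Lemma C1_is_derive h x (v : V) : Ck 1 h -> is_derive x v h (dirder h x v).
Proof.
move=> /(C1_strict_diff x) hs.
have H : (fun s : R => s^-1 *: ((h \o shift x) (s *: v) - h x)) @ 0^' --> (dirder h x v : R).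
  apply/cvgrPdist_le => e e0.
  have v1 : 0 < `|v| + 1 by rewrite ltr_wpDl.
  have /near_diag/near_normP[r r0 rP] := hs (e / (`|v| + 1)) (divr_gt0 e0 v1).
  apply/nbhs_ballP; exists (r / (`|v| + 1)) => /=; first by rewrite divr_gt0.
  move=> s; rewrite /ball/= sub0r normrN => sr s0.
  have sv : `|s *: v| < r.
    rewrite normrZ; apply: (@le_lt_trans _ _ (`|s| * (`|v| + 1))).
      by rewrite ler_wpM2l// lerDl.
    by rewrite -ltr_pdivlMr.
  have := rP (s *: v + x); rewrite addrK => /(_ sv) /=.
  rewrite -[\sum_k _]/(dirder h x (s *: v)) dirderZ normrZ => H.
  have sN : 0 < `|s| by rewrite normr_gt0.
  rewrite -(ler_pM2l sN) -normrM mulrBr distrC /GRing.scale/= mulrA divff// mul1r.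
  apply: (le_trans H); rewrite mulrCA ler_wpM2l// mulrAC ler_pdivrMr//.
  by rewrite ler_wpM2l ?(ltW e0)// lerDl.
split; first by apply/cvg_ex; eexists; exact: H.
exact: (cvg_lim _ H).
Qed.

Lemma C1_mvt h x y : Ck 1 h -> exists t, [/\ 0 <= t, t <= 1 &
  h y - h x = dirder h (x + t *: (y - x)) (y - x)].
Proof.
move=> hC.
have [t|t [t1 t0 E]] := mvt_line (h := h) (a := x) (v := y - x) 1.
  by have [] := C1_is_derive (x + t *: (y - x)) (y - x) hC.
exists t; rewrite mulr1 in t0; split => //.
  by move: t1; rewrite normr1 ger0_norm.
move: E; rewrite scale1r [x + (y - x)]addrC subrK mul1r => ->.
by have [_ ->] := C1_is_derive (x + t *: (y - x)) (y - x) hC.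
Qed.

Lemma CkW k h : Ck k.+1 h -> Ck k h.
Proof.
elim: k h => [|k IH] h; first by case.
move=> [ch hC]; split => // i; have [hd hi] := hC i; split => //; exact: IH.
Qed.

Lemma Ck_partial k h i : Ck k.+1 h -> Ck k (partial h i).
Proof. by move=> [_ hC]; have [] := hC i. Qed.

(** Both mixed partials are limits of the same second difference quotient. *)
Lemma second_difference f x i j (e : R) : Ck 2 f -> 0 < e ->
  exists2 r, 0 < r & forall s, 0 < s -> s < r ->
  `|(f (x + s *: delta_mx ord0 i + s *: delta_mx ord0 j) -
     f (x + s *: delta_mx ord0 i) - f (x + s *: delta_mx ord0 j) + f x)
    - s ^+ 2 * partial (partial f j) i x| <= s ^+ 2 * e.
Proof.
move=> fC e0.
have /near_pairP[r r0 rP] := C1_strict_diff x (Ck_partial j fC) e0.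
exists (r / 2); first by rewrite divr_gt0.
move=> s s0 sr.
pose k y := f (y + s *: delta_mx ord0 i) - f y.
have fd y : is_derive y (delta_mx ord0 j) f (partial f j y).
  by rewrite -dirder_delta; apply: C1_is_derive; exact: CkW.
have fd' y : is_derive y (delta_mx ord0 j) (fun y => f (y + s *: delta_mx ord0 i))
    (partial f j (y + s *: delta_mx ord0 i)).
  have [D1 D2] := fd (y + s *: delta_mx ord0 i).
  have E : (fun t : R => t^-1 *: (((fun y => f (y + s *: delta_mx ord0 i)) \o shift y)
       (t *: delta_mx ord0 j) - f (y + s *: delta_mx ord0 i))) =
    (fun t => t^-1 *: ((f \o shift (y + s *: delta_mx ord0 i)) 
      (t *: delta_mx ord0 j) - f (y + s *: delta_mx ord0 i))).
    by apply/funext => t /=; rewrite addrA.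
  by split; rewrite /derivable /derive E.
have kd y : is_derive y (delta_mx ord0 j) k
    (partial f j (y + s *: delta_mx ord0 i) - partial f j y).
  exact: is_deriveB.
have [t|t [ts t0 E]] := mvt_line (h := k) (a := x) (v := delta_mx ord0 j) s.
  by have [] := kd (x + t *: delta_mx ord0 j).
have -> : f (x + s *: delta_mx ord0 i + s *: delta_mx ord0 j) -
     f (x + s *: delta_mx ord0 i) - f (x + s *: delta_mx ord0 j) + f x =
   k (x + s *: delta_mx ord0 j) - k x.
  by rewrite /k (addrAC x (s *: delta_mx ord0 j)); ring.
rewrite E; have [_ ->] := kd (x + t *: delta_mx ord0 j).
set y := x + t *: delta_mx ord0 j.
have dn k' (q : R) : `|q *: delta_mx ord0 k' : V| <= `|q|.
  apply: mxnorm_le => // a b; rewrite !mxE normrM ler_piMr// ger0_norm//.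
  by case: (_ && _).
have ts' : `|t| <= s by rewrite (le_trans ts)// gtr0_norm.
have yr : `|y - x| < r.
  rewrite /y addrC addKr (le_lt_trans (dn _ _))// (le_lt_trans ts')//; lra.
have yr' : `|y + s *: delta_mx ord0 i - x| < r.
  have -> : y + s *: delta_mx ord0 i - x = t *: delta_mx ord0 j + s *: delta_mx ord0 i.
    by rewrite /y addrC !addrA addNr add0r.
  apply: (le_lt_trans (ler_normD _ _)).
  apply: (@le_lt_trans _ _ (s + s)); last by lra.
  by apply: lerD; apply: (le_trans (dn _ _)) => //; rewrite gtr0_norm.
have := rP _ _ yr' yr => /=.
have -> : y + s *: delta_mx ord0 i - y = s *: delta_mx ord0 i by rewrite addrC addKr.
rewrite -[\sum_k _]/(dirder (partial f j) x (s *: delta_mx ord0 i)).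
rewrite dirderZ dirder_delta => H.
rewrite expr2 -!mulrA -mulrBr normrM gtr0_norm// ler_pM2l//.
apply: (le_trans H); rewrite mulrC ler_wpM2r ?(ltW e0)//.
by rewrite (le_trans (dn _ _))// gtr0_norm.
Qed.

Lemma partialC f x i j : Ck 2 f ->
  partial (partial f j) i x = partial (partial f i) j x.
Proof.
move=> fC; apply/eqP; rewrite -subr_eq0 -normr_le0; apply/ler_addgt0Pr => e e0.
have e2 : 0 < e / 2 by rewrite divr_gt0.
have [r1 r10 P1] := second_difference x i j fC e2.
have [r2 r20 P2] := second_difference x j i fC e2.
pose s := Num.min r1 r2 / 2.
have s0 : 0 < s by rewrite divr_gt0// lt_min r10.
have sm : s < Num.min r1 r2 by rewrite /s; have := s0; rewrite /s; lra.
move: sm; rewrite lt_min => /andP[s1 s2].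
have ss : 0 < s ^+ 2 by rewrite exprn_gt0.
have aux (G A B : R) : `|G - s ^+ 2 * A| <= s ^+ 2 * (e / 2) ->
    `|G - s ^+ 2 * B| <= s ^+ 2 * (e / 2) -> `|A - B| <= e.
  rewrite !ler_norml => /andP[a1 a2] /andP[b1 b2].
  by apply/andP; split; rewrite -(ler_pM2l ss); lra.
rewrite add0r; apply: aux (P1 s s0 s1) _.
have := P2 s s0 s2; rewrite (addrAC x (s *: delta_mx ord0 j)).
by rewrite (addrAC (f _) (- f (x + s *: delta_mx ord0 j))).
Qed.

End C1Calculus.

(** * Calculus of strict derivatives *)

Section StrictDiffAlgebra.
Context {R : realType} {m : nat}.
Local Notation V := 'rV[R]_m.

Lemma strict_diff_loc_lip {W : normedModType R} (F : V -> W) x L K : 0 <= K ->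
  (forall u, `|L u| <= K * `|u|) -> strict_diff F x L -> loc_lip F x.
Proof.
move=> K0 LK /(_ 1 ltr01) Fs; exists (K + 1); first by rewrite ltr_wpDl.
apply: filterS Fs => p; rewrite mul1r mulrDl mul1r => H.
rewrite -[F p.1 - F p.2](subrK (L (p.1 - p.2))).
by apply: (le_trans (ler_normD _ _)); rewrite addrC lerD.
Qed.

Lemma loc_lip_near {W : normedModType R} (F : V -> W) x e : loc_lip F x -> 0 < e ->
  \forall y \near x, `|F y - F x| <= e.
Proof.
move=> [K K0 /near_diag /= FK] e0.
have xe : \forall y \near x, `|y - x| < e / K.
  by apply/near_normP; exists (e / K) => //; rewrite divr_gt0.
apply: filterS2 FK xe => y yK ye; apply: (le_trans yK).
by rewrite mulrC -ler_pdivlMr// ltW.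
Qed.

Lemma loc_lip_near_pair {W : normedModType R} (F : V -> W) x e : loc_lip F x -> 0 < e ->
  \forall p \near (x, x), `|F p.1 - F x| <= e /\ `|F p.2 - F x| <= e.
Proof. by move=> Fx e0; exact: (near_fst_snd (loc_lip_near Fx e0)). Qed.

Lemma strict_diff_mx p q (F : V -> 'M[R]_(p, q)) x (L : V -> 'M[R]_(p, q)) :
  (forall i j, strict_diff (W := R^o) (fun y => F y i j) x (fun u => L u i j)) ->
  strict_diff F x L.
Proof.
move=> FL e e0.
have H (ij : 'I_p * 'I_q) := FL ij.1 ij.2 e e0.
have H' : \forall w \near (x, x), forall ij : 'I_p * 'I_q,
    `|F w.1 ij.1 ij.2 - F w.2 ij.1 ij.2 - L (w.1 - w.2) ij.1 ij.2| <=
     e * `|w.1 - w.2|.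
  exact: (@filter_forall _ _ (fun (ij : 'I_p * 'I_q) (w : V * V) => _) _ _ H).
apply: filterS H' => w Hw.
apply: mxnorm_le => [|i j]; first by rewrite mulr_ge0 ?(ltW e0).
by have := Hw (i, j); rewrite !mxE.
Qed.

Lemma strict_diff_comp (phi : R -> R) (q : V -> R) x (L : V -> R) (d : R) :
  (forall e, 0 < e -> exists2 r, 0 < r & forall a b, `|a - q x| <= r ->
     `|b - q x| <= r -> `|phi a - phi b - d * (a - b)| <= e * `|a - b|) ->
  loc_lip (W := R^o) q x -> strict_diff (W := R^o) q x L ->
  strict_diff (W := R^o) (phi \o q) x (fun u => d * L u).
Proof.
move=> phid qs qL e e0.
have [K K0 qK] := qs.
have d0 : 0 < `|d| + 1 by rewrite ltr_wpDl.
have [r r0 rP] := phid (e / 2 / K) (divr_gt0 (divr_gt0 e0 (ltr0Sn R 1)) K0).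
have e1 : 0 < e / 2 / (`|d| + 1) by rewrite !divr_gt0.
near=> p.
have [p1 p2] : `|q p.1 - q x| <= r /\ `|q p.2 - q x| <= r.
  by near: p; exact: loc_lip_near_pair.
have H1 := rP _ _ p1 p2.
have H2 : `|q p.1 - q p.2| <= K * `|p.1 - p.2| by near: p.
have H3 : `|q p.1 - q p.2 - L (p.1 - p.2)| <= e / 2 / (`|d| + 1) * `|p.1 - p.2|.
  by near: p; exact: qL.
rewrite /=; have -> : phi (q p.1) - phi (q p.2) - d * L (p.1 - p.2) =
  (phi (q p.1) - phi (q p.2) - d * (q p.1 - q p.2)) +
  d * (q p.1 - q p.2 - L (p.1 - p.2)) by ring.
apply: (le_trans (ler_normD _ _)); rewrite normrM.
have -> : e * `|p.1 - p.2| = e / 2 * `|p.1 - p.2| + e / 2 * `|p.1 - p.2| by field.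
apply: lerD.
  apply: (le_trans H1); apply: (@le_trans _ _ (e / 2 / K * (K * `|p.1 - p.2|))).
    by rewrite ler_wpM2l// !divr_ge0// ltW.
  by rewrite mulrA divfK ?gt_eqF.
apply: (@le_trans _ _ ((`|d| + 1) * (e / 2 / (`|d| + 1) * `|p.1 - p.2|))).
  by rewrite ler_pM// lerDl.
by rewrite mulrA [(_ + 1) * _]mulrC divfK ?gt_eqF.
Unshelve. all: by end_near.
Qed.

(** From the polarized difference of squares
    [dot a a - dot b b = dot (a - b) (a + b)]. *)
Lemma strict_diff_dot_sqr n (g : V -> 'rV[R]_n) x (D : 'M[R]_(m, n)) :
  strict_diff g x (mulmx^~ D) ->
  strict_diff (W := R^o) (fun y => dot (g y) (g y)) x
    (fun u => dot (u *m D) (g x + g x)).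
Proof.
move=> gD e e0.
have gs : loc_lip g x.
  apply: (@strict_diff_loc_lip _ _ _ _ (m%:R * `|D|)) gD; first by rewrite mulr_ge0.
  by move=> u; rewrite (le_trans (mxnorm_mul _ _))// mulrAC.
pose K := 2 * `|g x| + 2.
have K0 : 0 < K by rewrite ltr_wpDl// mulr_ge0.
pose N := n%:R + 1 : R.
have N0 : 0 < N by rewrite ltr_wpDl.
pose M := m%:R * `|D| + 1.
have M0 : 0 < M by rewrite ltr_wpDl// mulr_ge0.
have a0 : 0 < e / 2 / (N * K) by rewrite !divr_gt0// mulr_gt0.
have b0 : 0 < e / 2 / (N * M) / 2 by rewrite !divr_gt0// mulr_gt0.
near=> p.
have [y1 z1] : `|g p.1 - g x| <= 1 /\ `|g p.2 - g x| <= 1.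
  by near: p; exact: loc_lip_near_pair.
have [yb zb] : `|g p.1 - g x| <= e / 2 / (N * M) / 2 /\ `|g p.2 - g x| <= e / 2 / (N * M) / 2.
  by near: p; exact: loc_lip_near_pair.
have H : `|g p.1 - g p.2 - (p.1 - p.2) *m D| <= e / 2 / (N * K) * `|p.1 - p.2|.
  by near: p; exact: gD.
set y := p.1 in y1 yb H *; set z := p.2 in z1 zb H *.
have nle : n%:R <= N by rewrite lerDl.
have -> : dot (g y) (g y) - dot (g z) (g z) - dot ((y - z) *m D) (g x + g x) =
   dot (g y - g z - (y - z) *m D) (g y + g z)
   + dot ((y - z) *m D) ((g y - g x) + (g z - g x)).
  rewrite !(dotDl, dotDr, dotNl, dotNr) (dotC (g z) (g y)).
  ring.
have dn (a b : 'rV[R]_n) : `|dot a b| <= N * (`|a| * `|b|).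
  by rewrite (le_trans (norm_dot_le _ _))// ler_wpM2r// mulr_ge0.
apply: (le_trans (ler_normD _ _)).
have -> : e * `|y - z| = e / 2 * `|y - z| + e / 2 * `|y - z| by field.
apply: lerD; apply: (le_trans (dn _ _)).
  have gK : `|g y + g z| <= K.
    have -> : g y + g z = (g y - g x) + (g z - g x) + (g x + g x).
      by rewrite addrACA subrK subrK.
    apply: (le_trans (ler_normD _ _)).
    have := ler_normD (g y - g x) (g z - g x); have := ler_normD (g x) (g x).
    by rewrite /K; lra.
  apply: (@le_trans _ _ (N * (e / 2 / (N * K) * `|y - z| * K))).
    by rewrite ler_pM2l// ler_pM.
  by rewrite le_eqVlt; apply/orP; left; apply/eqP; field; rewrite !gt_eqF.
have DM : `|(y - z) *m D| <= M * `|y - z|.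
  rewrite (le_trans (mxnorm_mul _ _))// mulrAC ler_wpM2r// lerDl//.
apply: (@le_trans _ _ (N * ((M * `|y - z|) * (e / 2 / (N * M))))).
  rewrite ler_pM2l// ler_pM//.
  by apply: (le_trans (ler_normD _ _)); lra.
by rewrite le_eqVlt; apply/orP; left; apply/eqP; field; rewrite !gt_eqF.
Unshelve. all: by end_near.
Qed.

End StrictDiffAlgebra.

(** * Gradient, Hessian and shifted Hessian *)

Section PowerStrict.
Context {R : realType}.

Lemma powR_strict (b q0 : R) : 0 < q0 -> exists d, forall e, 0 < e ->
  exists2 r, 0 < r & forall s t, `|s - q0| <= r -> `|t - q0| <= r ->
    `|s `^ b - t `^ b - d * (s - t)| <= e * `|s - t|.
Proof.
move=> q00; pose d := b * q0 `^ (b - 1); exists d => e e0.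
have cont : {for q0, continuous (fun x : R => b * x `^ (b - 1))}.
  apply: continuousM; first exact: cst_continuous.
  apply/differentiable_continuous/derivable1_diffP.
  by apply: derivable_powR; rewrite in_itv/= q00.
have /cvgrPdist_le/(_ _ e0)/nbhs_ballP[r /= r0 rP] := cont.
pose r' := Num.min (r / 2) (q0 / 2).
have r'0 : 0 < r' by rewrite lt_min !divr_gt0.
have r'r : r' < r by rewrite (@le_lt_trans _ _ (r / 2)) ?ge_min ?lexx//; lra.
have r'q : r' <= q0 / 2 by rewrite ge_min lexx orbT.
exists r' => // s t; wlog st : s t / t <= s.
  move=> W sr tr; have [ts|/ltW st] := leP t s; first exact: W.
  have E : s `^ b - t `^ b - d * (s - t) = - (t `^ b - s `^ b - d * (t - s)) by ring.
  by rewrite E normrN (distrC s t); exact: W.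
move=> sr tr.
have dpow x : x \in `]t, s[%R -> is_derive x (1 : R) (@powR R ^~ b) (b * x `^ (b - 1)).
  rewrite in_itv/= => /andP[tx xs]; apply: is_derive1_powR.
  by move: tr; rewrite ler_norml => /andP[? _]; lra.
have cpow : {within `[t, s], continuous (@powR R ^~ b)}.
  apply: derivable_within_continuous => x; rewrite in_itv/= => /andP[tx xs].
  apply: derivable_powR; rewrite in_itv/= andbT.
  by move: tr; rewrite ler_norml => /andP[? _]; lra.
have [x] := MVT_segment st dpow cpow.
rewrite in_itv/= => /andP[tx xs] ->.
rewrite -mulrBl normrM ler_wpM2r// distrC; apply: rP.
rewrite /ball/=; apply: le_lt_trans r'r.
by move: sr tr; rewrite !ler_norml => /andP[? ?] /andP[? ?]; lra.
Qed.

(** On [[0, 1]] the derivative [(1 + a) * x `^ a] is at most [1 + a]; at [0],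
    where the power need not be differentiable on both sides, the bound is
    [s `^ (1 + a) <= s]. *)
Lemma powR_lip (a s t : R) : 0 < a -> 0 <= s <= 1 -> 0 <= t <= 1 ->
  `|s `^ (1 + a) - t `^ (1 + a)| <= (1 + a) * `|s - t|.
Proof.
move=> a0; wlog st : s t / t <= s.
  move=> W sr tr; have [ts|/ltW st] := leP t s; first exact: W.
  by rewrite distrC (distrC s t); exact: W.
move=> /andP[s0 s1] /andP[t0 t1].
have [t00|tneq0] := eqVneq t 0.
  have a1 : 1 + a != 0 by rewrite gt_eqF// ltr_pwDl// ltW.
  rewrite t00 powR0// !subr0 !ger0_norm ?powR_ge0//.
  have [->|sn0] := eqVneq s 0; first by rewrite powR0// mulr0.
  have s00 : 0 < s by rewrite lt_def sn0.
  apply: (@le_trans _ _ s); last by rewrite ler_peMl// lerDl ltW.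
  by apply: ge1r_powR; rewrite ?s00// lerDl ltW.
have t00 : 0 < t by rewrite lt_def tneq0.
have dpow x : x \in `]t, s[%R ->
    is_derive x (1 : R) (@powR R ^~ (1 + a)) ((1 + a) * x `^ (1 + a - 1)).
  rewrite in_itv/= => /andP[tx xs]; apply: is_derive1_powR.
  exact: lt_trans tx.
have cpow : {within `[t, s], continuous (@powR R ^~ (1 + a))}.
  apply: derivable_within_continuous => x; rewrite in_itv/= => /andP[tx xs].
  by apply: derivable_powR; rewrite in_itv/= andbT (lt_le_trans t00).
have [x] := MVT_segment st dpow cpow.
rewrite in_itv/= => /andP[tx xs] ->.
have a1 : 0 <= 1 + a by rewrite addr_ge0// ltW.
rewrite normrM ler_wpM2r// ger0_norm ?mulr_ge0 ?powR_ge0//.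
rewrite ler_piMr// [1 + a]addrC addrK.
have x01 : 0 <= x <= 1 by rewrite (le_trans t0)//= (le_trans xs).
have := @ge0_ler_powR R a (ltW a0) x 1.
rewrite !nnegrE powR1; have /andP[x0 x1] := x01; by apply.
Qed.

End PowerStrict.

Section EuclideanNorm.
Context {R : realType} {m : nat}.

Lemma enormE (u : 'rV[R]_m) : enorm u = Num.sqrt (dot u u).
Proof. by rewrite /enorm dotE; congr Num.sqrt; apply: eq_bigr => i _; rewrite expr2. Qed.

Lemma enorm_ge0 (u : 'rV[R]_m) : 0 <= enorm u.
Proof. exact: sqrtr_ge0. Qed.

Lemma enorm_sqr (u : 'rV[R]_m) : enorm u ^+ 2 = dot u u.
Proof. by rewrite enormE sqr_sqrtr// dot_ge0. Qed.

Lemma enorm_eq0 (u : 'rV[R]_m) : enorm u = 0 -> u = 0.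
Proof. by move=> u0; apply: dot_eq0; rewrite -enorm_sqr u0 expr0n. Qed.

Lemma enorm0 : enorm (0 : 'rV[R]_m) = 0.
Proof. by rewrite enormE dot0l sqrtr0. Qed.

Lemma norm_le_enorm (u : 'rV[R]_m) : `|u| <= enorm u.
Proof.
by rewrite -(@ler_pXn2r R 2) ?nnegrE ?enorm_ge0// enorm_sqr sqr_norm_le_dot.
Qed.

Lemma enorm_le_norm (u : 'rV[R]_m) : enorm u <= m%:R * `|u|.
Proof.
rewrite -(@ler_pXn2r R 2) ?nnegrE ?enorm_ge0 ?mulr_ge0// enorm_sqr.
apply: (le_trans (dot_le _ _)); rewrite expr2 mulrACA ler_wpM2r ?mulr_ge0//.
by rewrite -natrM ler_nat; case: (m) => // k; rewrite leq_pmulr.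
Qed.

Lemma enorm_lip (u v : 'rV[R]_m) : `|enorm u - enorm v| <= m%:R * `|u - v|.
Proof.
wlog uv : u v / enorm v <= enorm u.
  move=> W; have [?|/ltW ?] := leP (enorm v) (enorm u); first exact: W.
  by rewrite distrC (distrC u v); exact: W.
rewrite ger0_norm ?subr_ge0//.
have [u0|un0] := eqVneq (enorm u) 0.
  by rewrite u0 (le_trans (_ : _ <= 0)) ?mulr_ge0// sub0r oppr_le0 enorm_ge0.
have s0 : 0 < enorm u + enorm v.
  by rewrite ltr_pwDl ?enorm_ge0// lt_def un0 enorm_ge0.
rewrite -(ler_pM2r s0).
have -> : (enorm u - enorm v) * (enorm u + enorm v) = dot (u - v) (u + v).
  rewrite -subr_sqr !enorm_sqr !(dotDl, dotDr, dotNl, dotNr) (dotC v u).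
  ring.
apply: (le_trans (dot_le _ _)); rewrite -mulrA ler_wpM2l// ler_wpM2l//.
by apply: (le_trans (ler_normD _ _)); apply: lerD; exact: norm_le_enorm.
Qed.

End EuclideanNorm.

Section Hessian.
Context {R : realType} {m : nat}.
Local Notation V := 'rV[R]_m.
Variables (f : V -> R) (alpha : R).
Hypothesis (a0 : 0 < alpha) (fC : Ck 3 f).

Let fC2 : Ck 2 f. Proof. exact: CkW. Qed.

Lemma gradient_strict_diff x : strict_diff (gradient f) x (mulmx^~ (hessian f x)).
Proof.
apply: strict_diff_mx => i j.
have -> : (fun y => gradient f y i j) = partial f j.
  by apply/funext => y; rewrite mxE.
have -> : (fun u : V => (u *m hessian f x) i j) =
    (fun u => \sum_k u ord0 k * partial (partial f j) k x).
  apply/funext => u; rewrite mxE; apply: eq_bigr => k _.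
  by rewrite mxE (_ : i = ord0)// ord1.
by apply: C1_strict_diff; exact: Ck_partial.
Qed.

Lemma gradient_loc_lip x : loc_lip (gradient f) x.
Proof.
apply: (@strict_diff_loc_lip _ _ _ _ _ _ (m%:R * `|hessian f x|)) (gradient_strict_diff x).
  exact: mulr_ge0.
by move=> u; rewrite (le_trans (mxnorm_mul _ _))// mulrAC.
Qed.

Lemma hessian_sym x : (hessian f x)^T = hessian f x.
Proof. by apply/matrixP => i j; rewrite !mxE partialC. Qed.

Definition hess_deriv x (u : V) : 'M[R]_m :=
  \matrix_(i, j) dirder (partial (partial f j) i) x u.

Lemma hessian_strict_diff x : strict_diff (hessian f) x (hess_deriv x).
Proof.
apply: strict_diff_mx => i j.
have -> : (fun y => hessian f y i j) = partial (partial f j) i.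
  by apply/funext => y; rewrite mxE.
have -> : (fun u : V => hess_deriv x u i j) = dirder (partial (partial f j) i) x.
  by apply/funext => u; rewrite mxE.
by apply: C1_strict_diff; do 2!apply: Ck_partial.
Qed.

Lemma dirder_le h x (u : V) : `|dirder h x u| <= (\sum_k `|partial h k x|) * `|u|.
Proof.
rewrite /dirder mulr_suml; apply: (le_trans (ler_norm_sum _ _ _)).
by apply: ler_sum => k _; rewrite normrM mulrC ler_wpM2l// mxnorm_coord.
Qed.

Lemma hess_deriv_le x : exists2 K, 0 <= K & forall u, `|hess_deriv x u| <= K * `|u|.
Proof.
pose c i j := \sum_k `|partial (partial (partial f j) i) k x|.
have c0 i j : 0 <= c i j by apply: sumr_ge0.
exists (\sum_i \sum_j c i j); first by do 2![apply: sumr_ge0 => ? _].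
move=> u; apply: mxnorm_le => [|i j].
  by rewrite mulr_ge0//; do 2![apply: sumr_ge0 => ? _].
rewrite mxE (le_trans (dirder_le _ _ _))// ler_wpM2r// -/(c i j).
move: c c0 => c c0; rewrite (bigD1 i)//= (bigD1 j)//= -addrA lerDl addr_ge0//.
  by apply: sumr_ge0.
by do 2![apply: sumr_ge0 => ? _].
Qed.

Lemma hessian_loc_lip x : loc_lip (hessian f) x.
Proof.
have [K K0 HK] := hess_deriv_le x.
exact: strict_diff_loc_lip K0 HK (hessian_strict_diff x).
Qed.

Definition shift_scale x : R := enorm (gradient f x) `^ (1 + alpha).

Lemma shift_scale0 x : gradient f x = 0 -> shift_scale x = 0.
Proof.
by move=> g0; rewrite /shift_scale g0 enorm0 powR0// gt_eqF// ltr_pwDl// ltW.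
Qed.

Lemma shift_scale_gt0 x : gradient f x != 0 -> 0 < shift_scale x.
Proof.
move=> g0; apply: powR_gt0; rewrite lt_def enorm_ge0 andbT.
by apply: contraNneq g0 => /enorm_eq0 ->.
Qed.

(** The factor is the power [(1 + alpha) / 2] of the squared gradient norm,
    which is positive away from critical points. *)
Lemma shift_scale_strict_diff x : gradient f x != 0 ->
  exists a : V, strict_diff (W := R^o) shift_scale x (fun u => dot u a).
Proof.
move=> g0.
pose q y := dot (gradient f y) (gradient f y).
have q0 : 0 < q x by rewrite lt_def dot_ge0 andbT; apply: contraNneq g0 => /dot_eq0 ->.
have qd := strict_diff_dot_sqr (gradient_strict_diff x).
have E u : dot (u *m hessian f x) (gradient f x + gradient f x) =
    dot u ((gradient f x + gradient f x) *m hessian f x).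
  by rewrite dot_mulmx hessian_sym.
have qs : loc_lip (W := R^o) q x.
  pose w := (gradient f x + gradient f x) *m hessian f x.
  apply: (@strict_diff_loc_lip _ _ _ _ _ _ (m%:R * `|w|)) qd; first exact: mulr_ge0.
  move=> u; rewrite E -/w -mulrA (mulrC `|w|); exact: norm_dot_le.
have [d dP] := powR_strict ((1 + alpha) / 2) q0.
exists (d *: ((gradient f x + gradient f x) *m hessian f x)).
have -> : (fun u : V => dot u (d *: ((gradient f x + gradient f x) *m hessian f x)))
    = (fun u => d * dot (u *m hessian f x) (gradient f x + gradient f x)).
  by apply/funext => u; rewrite dotZr E.
have -> : shift_scale = (@powR R ^~ ((1 + alpha) / 2)) \o q.
  apply/funext => y; rewrite /shift_scale enormE /= -powR12_sqrt ?dot_ge0//.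
  by rewrite -powRrM mulrC.
exact: strict_diff_comp.
Qed.

(** At a critical point the gradient norm is below [1] nearby, where the
    power [1 + alpha > 1] is Lipschitz. *)
Lemma shift_scale_loc_lip x : loc_lip (W := R^o) shift_scale x.
Proof.
have [g0|g0] := eqVneq (gradient f x) 0; last first.
  have [a ad] := shift_scale_strict_diff g0.
  apply: (@strict_diff_loc_lip _ _ _ _ _ _ (m%:R * `|a|)) ad; first exact: mulr_ge0.
  move=> u; rewrite -mulrA (mulrC `|a|); exact: norm_dot_le.
have [K K0 gK] := gradient_loc_lip x.
have m1 : 0 < m%:R + 1 :> R by rewrite ltr_wpDl.
exists ((1 + alpha) * ((m%:R + 1) * K)).
  by rewrite !mulr_gt0// ltr_pwDl// ltW.
near=> p.
have [p1 p2] : `|gradient f p.1 - gradient f x| <= (m%:R + 1)^-1 /\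
               `|gradient f p.2 - gradient f x| <= (m%:R + 1)^-1.
  by near: p; apply: loc_lip_near_pair (gradient_loc_lip x) _; rewrite invr_gt0.
have pK : `|gradient f p.1 - gradient f p.2| <= K * `|p.1 - p.2| by near: p.
have small u : `|u - gradient f x| <= (m%:R + 1)^-1 -> 0 <= enorm u <= 1.
  rewrite g0 subr0 => u1; rewrite enorm_ge0/=.
  apply: (le_trans (enorm_le_norm _)).
  rewrite (le_trans (ler_wpM2l _ u1))// ler_pdivrMr// mul1r lerDl//.
apply: (le_trans (powR_lip a0 (small _ p1) (small _ p2))).
rewrite -!mulrA ler_wpM2l//; first by rewrite addr_ge0// ltW.
apply: (le_trans (enorm_lip _ _)); rewrite ler_pM// ?lerDl//.
Unshelve. all: by end_near.
Qed.

Local Notation A := (shifted_hessian f alpha).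

Lemma shifted_sym d x : (A d x)^T = A d x.
Proof. by rewrite /shifted_hessian linearD/= hessian_sym tr_scalar_mx. Qed.

Lemma scalar_mx_norm n (a : R) : `|a%:M : 'M[R]_n| <= `|a|.
Proof.
apply: mxnorm_le => // i j; rewrite mxE; case: (_ == _) => //=.
by rewrite mulr0n normr0.
Qed.

Lemma shifted_loc_lip d x : loc_lip (A d) x.
Proof.
have [K K0 HK] := hessian_loc_lip x.
have [L L0 cL] := shift_scale_loc_lip x.
exists (K + `|d| * L); first by rewrite ltr_pwDl// mulr_ge0// ltW.
apply: filterS2 HK cL => p H c.
rewrite /shifted_hessian opprD addrACA -raddfB/= (le_trans (ler_normD _ _))//.
rewrite mulrDl lerD// (le_trans (scalar_mx_norm _ _))// -mulrBr normrM -mulrA.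
by rewrite ler_wpM2l.
Qed.

(** The vector [a] does not depend on [d]: the derivative is affine in the
    shift, as the count of the bad shifts requires. *)
Lemma shifted_strict_diff x : gradient f x != 0 -> exists a : V, forall d,
  strict_diff (A d) x (fun u => hess_deriv x u + (d * dot u a)%:M).
Proof.
move=> g0; have [a ad] := shift_scale_strict_diff g0; exists a => d e e0.
have d1 : 0 < `|d| + 1 by rewrite ltr_wpDl.
have e2 : 0 < e / 2 by rewrite divr_gt0.
apply: filterS2 (hessian_strict_diff x e2) (ad _ (divr_gt0 e2 d1)) => p H c.
rewrite /shifted_hessian; set u := p.1 - p.2.
have aux (X Y H' : 'M[R]_m) (r s t : R) : X + r%:M - (Y + s%:M) - (H' + t%:M) =
    (X - Y - H') + (r - s - t)%:M.
  by apply/matrixP => i j; rewrite !mxE; case: (_ == _); rewrite ?mulr1n ?mulr0n; ring.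
rewrite aux -!mulrBr.
apply: (le_trans (ler_normD _ _)).
have -> : e * `|u| = e / 2 * `|u| + e / 2 * `|u| by field.
apply: lerD => //; apply: (le_trans (scalar_mx_norm _ _)); rewrite normrM.
apply: (@le_trans _ _ ((`|d| + 1) * (e / 2 / (`|d| + 1) * `|u|))).
  by rewrite ler_pM// lerDl.
by rewrite mulrA [(_ + 1) * _]mulrC divfK ?gt_eqF.
Qed.

End Hessian.

(** * Strict derivative of the modulus *)

Section PairAsymptotics.
Context {R : realType} {m : nat}.
Local Notation V := 'rV[R]_m.
Variable x : V.

(** Orders of magnitude of functions of two points near the diagonal point
    [(x, x)], relative to the distance of the two points. A function that is
    strictly differentiable has a [pair_small] remainder, and one that is
    locally Lipschitz has a [pair_big] difference. *)
Definition pair_small {W : normedModType R} (F : V * V -> W) :=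
  forall e, 0 < e -> \forall p \near (x, x), `|F p| <= e * `|p.1 - p.2|.
Definition pair_big {W : normedModType R} (F : V * V -> W) :=
  exists2 K, 0 < K & \forall p \near (x, x), `|F p| <= K * `|p.1 - p.2|.
Definition pair_van {W : normedModType R} (F : V * V -> W) :=
  forall e, 0 < e -> \forall p \near (x, x), `|F p| <= e.
Definition pair_bnd {W : normedModType R} (F : V * V -> W) :=
  exists2 K, 0 < K & \forall p \near (x, x), `|F p| <= K.

Lemma near_all (Q : V * V -> Prop) : (forall p, Q p) -> \forall p \near (x, x), Q p.
Proof. by move=> HQ; apply/near_pairP; exists 1. Qed.

Lemma pair_smallD {W : normedModType R} (F G : V * V -> W) :
  pair_small F -> pair_small G -> pair_small (fun p => F p + G p).
Proof.
move=> sF sG e e0; have e2 : 0 < e / 2 by rewrite divr_gt0.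
apply: filterS2 (sF _ e2) (sG _ e2) => p Fp Gp.
apply: (le_trans (ler_normD _ _)); have := lerD Fp Gp; rewrite -mulrDl.
by have -> : e / 2 + e / 2 = e by field.
Qed.

Lemma pair_smallN {W : normedModType R} (F : V * V -> W) :
  pair_small F -> pair_small (fun p => - F p).
Proof. by move=> sF e /sF; apply: filterS => p; rewrite normrN. Qed.

Lemma pair_smallB {W : normedModType R} (F G : V * V -> W) :
  pair_small F -> pair_small G -> pair_small (fun p => F p - G p).
Proof. by move=> sF /pair_smallN; exact: pair_smallD. Qed.

Lemma pair_small_near_eq {W : normedModType R} (F G : V * V -> W) :
  (\forall p \near (x, x), F p = G p) -> pair_small F -> pair_small G.
Proof. by move=> FG sF e /sF; apply: filterS2 FG => p ->. Qed.

Lemma pair_bigD {W : normedModType R} (F G : V * V -> W) :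
  pair_big F -> pair_big G -> pair_big (fun p => F p + G p).
Proof.
move=> [K K0 FK] [L L0 GL]; exists (K + L); first exact: addr_gt0.
apply: filterS2 FK GL => p Fp Gp; rewrite mulrDl.
by apply: (le_trans (ler_normD _ _)); exact: lerD.
Qed.

Lemma pair_bigN {W : normedModType R} (F : V * V -> W) : pair_big F -> pair_big (fun p => - F p).
Proof. by move=> [K K0 FK]; exists K => //; apply: filterS FK => p; rewrite normrN. Qed.

Lemma pair_bnd_cst {W : normedModType R} (c : W) : pair_bnd (fun=> c).
Proof.
by exists (`|c| + 1); [rewrite ltr_wpDl|apply: near_all => p; rewrite lerDl].
Qed.

Lemma pair_big_sub : pair_big (fun p => p.1 - p.2).
Proof. by exists 1 => //; apply: near_all => p; rewrite mul1r. Qed.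

Lemma mul_le_factor (k : nat) (a b c d : R) : 0 <= a -> 0 <= b ->
  a <= c -> b <= d -> k%:R * a * b <= (k%:R + 1) * (c * d).
Proof.
move=> a0 b0 ac bd; rewrite -mulrA; apply: ler_pM => //; first exact: mulr_ge0.
  by rewrite lerDl.
exact: ler_pM.
Qed.

Lemma pair_bnd_mul_big k n q (F : V * V -> 'M[R]_(k, n)) (G : V * V -> 'M[R]_(n, q)) :
  pair_bnd F -> pair_big G -> pair_big (fun p => F p *m G p).
Proof.
move=> [K K0 FK] [L L0 GL]; exists ((n%:R + 1) * (K * L)).
  by rewrite !mulr_gt0// ltr_wpDl.
apply: filterS2 FK GL => p Fp Gp; apply: (le_trans (mxnorm_mul _ _)).
apply: (le_trans (mul_le_factor n _ _ Fp Gp)) => //.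
by rewrite le_eqVlt; apply/orP; left; apply/eqP; ring.
Qed.

Lemma pair_big_mul_bnd k n q (F : V * V -> 'M[R]_(k, n)) (G : V * V -> 'M[R]_(n, q)) :
  pair_big F -> pair_bnd G -> pair_big (fun p => F p *m G p).
Proof.
move=> [K K0 FK] [L L0 GL]; exists ((n%:R + 1) * (K * L)).
  by rewrite !mulr_gt0// ltr_wpDl.
apply: filterS2 FK GL => p Fp Gp; apply: (le_trans (mxnorm_mul _ _)).
apply: (le_trans (mul_le_factor n _ _ Fp Gp)) => //.
by rewrite le_eqVlt; apply/orP; left; apply/eqP; ring.
Qed.

Lemma pair_van_mul_big k n q (F : V * V -> 'M[R]_(k, n)) (G : V * V -> 'M[R]_(n, q)) :
  pair_van F -> pair_big G -> pair_small (fun p => F p *m G p).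
Proof.
move=> vF [L L0 GL] e e0.
have n1 : 0 < n%:R + 1 :> R by rewrite ltr_wpDl.
apply: filterS2 (vF _ (divr_gt0 (divr_gt0 e0 n1) L0)) GL => p Fp Gp.
apply: (le_trans (mxnorm_mul _ _)).
apply: (le_trans (mul_le_factor n _ _ Fp Gp)) => //.
by rewrite le_eqVlt; apply/orP; left; apply/eqP; field; rewrite !gt_eqF.
Qed.

Lemma pair_big_mul_van k n q (F : V * V -> 'M[R]_(k, n)) (G : V * V -> 'M[R]_(n, q)) :
  pair_big F -> pair_van G -> pair_small (fun p => F p *m G p).
Proof.
move=> [L L0 FL] vG e e0.
have n1 : 0 < n%:R + 1 :> R by rewrite ltr_wpDl.
apply: filterS2 FL (vG _ (divr_gt0 (divr_gt0 e0 n1) L0)) => p Fp Gp.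
apply: (le_trans (mxnorm_mul _ _)).
apply: (le_trans (mul_le_factor n _ _ Fp Gp)) => //.
by rewrite le_eqVlt; apply/orP; left; apply/eqP; field; rewrite !gt_eqF.
Qed.

Lemma pair_bnd_mul_small k n q (F : V * V -> 'M[R]_(k, n)) (G : V * V -> 'M[R]_(n, q)) :
  pair_bnd F -> pair_small G -> pair_small (fun p => F p *m G p).
Proof.
move=> [L L0 FL] sG e e0.
have n1 : 0 < n%:R + 1 :> R by rewrite ltr_wpDl.
apply: filterS2 FL (sG _ (divr_gt0 (divr_gt0 e0 n1) L0)) => p Fp Gp.
apply: (le_trans (mxnorm_mul _ _)).
apply: (le_trans (mul_le_factor n _ _ Fp Gp)) => //.
by rewrite le_eqVlt; apply/orP; left; apply/eqP; field; rewrite !gt_eqF.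
Qed.

Lemma pair_small_mul_bnd k n q (F : V * V -> 'M[R]_(k, n)) (G : V * V -> 'M[R]_(n, q)) :
  pair_small F -> pair_bnd G -> pair_small (fun p => F p *m G p).
Proof.
move=> sF [L L0 GL] e e0.
have n1 : 0 < n%:R + 1 :> R by rewrite ltr_wpDl.
apply: filterS2 (sF _ (divr_gt0 (divr_gt0 e0 n1) L0)) GL => p Fp Gp.
apply: (le_trans (mxnorm_mul _ _)).
apply: (le_trans (mul_le_factor n _ _ Fp Gp)) => //.
by rewrite le_eqVlt; apply/orP; left; apply/eqP; field; rewrite !gt_eqF.
Qed.

Lemma loc_lip_van {W : normedModType R} (F : V -> W) : loc_lip F x ->
  pair_van (fun p => F p.1 - F x) /\ pair_van (fun p => F p.2 - F x).
Proof.
by move=> sF; split=> e e0; apply: filterS (loc_lip_near_pair sF e0) => p [].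
Qed.

Lemma pair_vanN {W : normedModType R} (F : V * V -> W) : pair_van F -> pair_van (fun p => - F p).
Proof. by move=> sF e /sF; apply: filterS => p; rewrite normrN. Qed.

Lemma loc_lip_bnd {W : normedModType R} (F : V -> W) : loc_lip F x ->
  pair_bnd (fun p => F p.1) /\ pair_bnd (fun p => F p.2).
Proof.
move=> sF; split; exists (1 + `|F x|); rewrite ?ltr_pwDl//;
  apply: filterS (loc_lip_near_pair sF ltr01) => p [p1 p2].
  by rewrite -[F p.1](subrK (F x)) (le_trans (ler_normD _ _))// lerD.
by rewrite -[F p.2](subrK (F x)) (le_trans (ler_normD _ _))// lerD.
Qed.

End PairAsymptotics.

Section ModulusExpansion.
Context {R : realType} {m : nat}.
Local Notation V := 'rV[R]_m.
Variables (x : V) (A : V -> 'M[R]_m).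
Hypotheses (sA : forall y, (A y)^T = A y) (lA : loc_lip A x) (uA : A x \in unitmx).
Local Notation P y := (absmx (A y)).

Lemma coercive_near : exists2 k, 0 < k & \forall y \near x, coercive k (A y).
Proof.
have [k k0 kA] := unit_coercive uA.
have m1 : 0 < m%:R + 1 :> R by rewrite ltr_wpDl.
exists (k / 2); first by rewrite divr_gt0.
have := loc_lip_near lA (divr_gt0 (divr_gt0 k0 (ltr0Sn R 1)) m1).
apply: filterS => y yA; apply: (coercive_perturb kA); rewrite distrC.
apply: (@le_trans _ _ ((m%:R + 1) * (k / 2 / (m%:R + 1)))).
  by rewrite ler_pM// lerDl.
by rewrite mulrC divfK ?gt_eqF.
Qed.

Lemma unit_near : \forall y \near x, A y \in unitmx.
Proof.
by have [k k0] := coercive_near; apply: filterS => y; exact: coercive_unit.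
Qed.

(** [X = P p.1 - P p.2] solves the Sylvester equation
    [P p.1 X + X P p.2 = A p.1 ^ 2 - A p.2 ^ 2], and both moduli are uniformly
    positive near [x]. *)
Lemma modulus_loc_lip : loc_lip (fun y => P y) x.
Proof.
have [k k0 kA] := coercive_near.
have [A1 A2] := loc_lip_bnd lA.
have [K K0 YK] : pair_big x (fun p => A p.1 *m (A p.1 - A p.2) + (A p.1 - A p.2) *m A p.2).
  by apply: pair_bigD; [apply: pair_bnd_mul_big|apply: pair_big_mul_bnd].
have m1 : 0 < m%:R + 1 :> R by rewrite ltr_wpDl.
exists ((m%:R + 1) * K / k); first by rewrite !mulr_gt0// invr_gt0.
apply: filterS2 (near_fst_snd kA) YK => p [c1 c2] Yp.
have Q1 := absmx_positive (sA p.1) c1; have Q2 := absmx_positive (sA p.2) c2.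
have := @sylvester_le _ _ k _ _ (P p.1 - P p.2) _ k0 (absmx_sym (sA p.1)) Q1 Q2 erefl.
have -> : P p.1 *m (P p.1 - P p.2) + (P p.1 - P p.2) *m P p.2 =
    A p.1 *m (A p.1 - A p.2) + (A p.1 - A p.2) *m A p.2.
  have u1 := coercive_unit k0 c1; have u2 := coercive_unit k0 c2.
  rewrite !mulmxBr !mulmxBl (absmx_sqr (sA p.1) u1) (absmx_sqr (sA p.2) u2).
  by rewrite !addrA !subrK.
move=> H; rewrite mulrAC ler_pdivlMr// mulrC; apply: (le_trans H).
by rewrite -mulrA; apply: ler_pM => //; rewrite lerDl.
Qed.

Lemma sylvester_small (k : R) (P0 : 'M[R]_m) (E F : V * V -> 'M[R]_m) :
  0 < k -> P0^T = P0 -> positive_by k P0 ->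
  (\forall p \near (x, x), P0 *m E p + E p *m P0 = F p) ->
  pair_small x F -> pair_small x E.
Proof.
move=> k0 sP kP EF sF e e0.
have m1 : 0 < m%:R + 1 :> R by rewrite ltr_wpDl.
apply: filterS2 EF (sF _ (divr_gt0 (mulr_gt0 e0 k0) m1)) => p Ep Fp.
have H := sylvester_le k0 sP kP kP Ep.
rewrite -(ler_pM2l k0); apply: (le_trans H).
apply: (@le_trans _ _ ((m%:R + 1) * (e * k / (m%:R + 1) * `|p.1 - p.2|))).
  by apply: ler_pM => //; rewrite lerDl.
by rewrite le_eqVlt; apply/orP; left; apply/eqP; field; rewrite gt_eqF.
Qed.

Let zmod_aux1 (t1 t2 t3 t4 : 'M[R]_m) :
  t1 + t2 = - (t3 - t1) - (t4 - t2) + (t3 + t4).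
Proof. by apply/matrixP => i j; rewrite !mxE; ring. Qed.

Let zmod_aux2 (t1 t2 t3 t4 t5 t6 : 'M[R]_m) :
  t1 + t3 - (t5 + t6) = t1 - t2 + t3 - t4 + t2 - t5 + t4 - t6.
Proof. by apply/matrixP => i j; rewrite !mxE; ring. Qed.

(** Linearize [P ^ 2 = A ^ 2]: the derivative [X] solves the Sylvester
    equation with coefficients frozen at [x], and by the Sylvester bound the
    remainder is as small as the error of freezing the coefficients. *)
Lemma modulus_strict_diff (B X : V -> 'M[R]_m) :
  strict_diff A x B ->
  (forall u, P x *m X u + X u *m P x = A x *m B u + B u *m A x) ->
  strict_diff (fun y => P y) x X.
Proof.
move=> AB PX.
have [k k0 kA] := coercive_near.
have kAx := nbhs_singleton kA.
have lP := modulus_loc_lip.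
have [vA1 vA2] := loc_lip_van lA; have [vP1 vP2] := loc_lip_van lP.
apply: (@sylvester_small k (P x)
  (fun p => P p.1 - P p.2 - X (p.1 - p.2))
  (fun p => - (P p.1 - P x) *m (P p.1 - P p.2) + (P p.1 - P p.2) *m - (P p.2 - P x)
     + ((A p.1 - A x) *m (A p.1 - A p.2) + (A p.1 - A p.2) *m (A p.2 - A x))
     + (A x *m (A p.1 - A p.2 - B (p.1 - p.2)) + (A p.1 - A p.2 - B (p.1 - p.2)) *m A x))) => //.
- by rewrite absmx_sym.
- exact: absmx_positive.
- have := near_fst_snd unit_near; apply: filterS => p [u1 u2] /=.
  set u := p.1 - p.2; set dA := A p.1 - A p.2; set dP := P p.1 - P p.2.
  have E1 : P p.1 *m dP + dP *m P p.2 = A p.1 *m dA + dA *m A p.2.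
    rewrite /dP /dA !mulmxBr !mulmxBl.
    rewrite (absmx_sqr (sA p.1) u1) (absmx_sqr (sA p.2) u2).
    by rewrite !addrA !subrK.
  have E2 := PX u.
  rewrite mulmxBr mulmxBl addrACA -opprD E2.
  have -> : P x *m dP + dP *m P x = - (P p.1 - P x) *m dP + dP *m - (P p.2 - P x)
      + (A p.1 *m dA + dA *m A p.2).
    rewrite -E1 mulNmx mulmxN (mulmxBl (P p.1) (P x) dP) (mulmxBr dP (P p.2) (P x)).
    exact: zmod_aux1.
  rewrite -[LHS]addrA -[RHS]addrA; congr (_ + _).
  rewrite (mulmxBl (A p.1) (A x) dA) (mulmxBr dA (A p.2) (A x)).
  rewrite (mulmxBr (A x) dA) (mulmxBl dA _ (A x)) !addrA; exact: zmod_aux2.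
- apply: pair_smallD; [apply: pair_smallD|apply: pair_smallD].
  + apply: pair_smallD; [apply: pair_van_mul_big (pair_vanN vP1) lP|
      exact: pair_big_mul_van lP (pair_vanN vP2)].
  + apply: pair_smallD; [exact: pair_van_mul_big vA1 lA|exact: pair_big_mul_van lA vA2].
  + exact: pair_bnd_mul_small (pair_bnd_cst _ _) AB.
  + exact: pair_small_mul_bnd AB (pair_bnd_cst _ _).
Qed.

End ModulusExpansion.

(** * Expansion of the step *)

Section StepExpansion.
Context {R : realType} {m : nat}.
Local Notation V := 'rV[R]_m.
Variables (x : V) (A : V -> 'M[R]_m) (g : V -> V) (D : 'M[R]_m).
Hypotheses (sA : forall y, (A y)^T = A y) (lA : loc_lip A x) (uA : A x \in unitmx).
Hypothesis gD : strict_diff g x (mulmx^~ D).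
Local Notation P y := (absmx (A y)).

(** Row-vector form of the step: [invmx B] followed by the reflection of the
    negative directions is the inverse of the modulus of [B]. *)
Definition modulus_step (B : 'M[R]_m) (v : V) : V := v *m invmx (absmx B).
Local Notation w y := (modulus_step (A y) (g y)).

Let lg : loc_lip g x.
Proof.
apply: (@strict_diff_loc_lip _ _ _ _ _ _ (m%:R * `|D|)) gD; first exact: mulr_ge0.
by move=> u; rewrite (le_trans (mxnorm_mul _ _))// mulrAC.
Qed.

Let lP : loc_lip (fun y => P y) x. Proof. exact: modulus_loc_lip. Qed.

Let wP : \forall y \near x, w y *m P y = g y.
Proof.
apply: filterS (unit_near lA uA) => y uy.
by rewrite /modulus_step mulmxKV// absmx_unit.
Qed.

Let posP : exists2 k, 0 < k & \forall y \near x, positive_by k (P y).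
Proof.
have [k k0 kA] := coercive_near lA uA; exists k => //.
by apply: filterS kA => y ky; exact: absmx_positive.
Qed.

Let dwP : \forall p \near (x, x),
  (w p.1 - w p.2) *m P p.1 = (g p.1 - g p.2) - w p.2 *m (P p.1 - P p.2).
Proof.
apply: filterS (near_fst_snd wP) => p [w1 w2].
by rewrite mulmxBl mulmxBr w1 w2 opprB addrA subrK.
Qed.

Let w_bnd : pair_bnd x (fun p => w p.2).
Proof.
have [k k0 kP] := posP; have [_ [K K0 gK]] := loc_lip_bnd lg.
have m1 : 0 < m%:R + 1 :> R by rewrite ltr_wpDl.
exists ((m%:R + 1) * K / k); first by rewrite !mulr_gt0// invr_gt0.
apply: filterS3 (near_fst_snd kP) (near_fst_snd wP) gK => p [_ k2] [_ w2] gp.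
rewrite ler_pdivlMr// mulrC; apply: (le_trans (positive_norm (w p.2) k0 k2)).
by rewrite w2 ler_pM// lerDl.
Qed.

Let dwP_big : pair_big x (fun p => (w p.1 - w p.2) *m P p.1).
Proof.
have [K K0 HK] : pair_big x (fun p => (g p.1 - g p.2) + - (w p.2 *m (P p.1 - P p.2))).
  by apply: pair_bigD => //; apply: pair_bigN; exact: pair_bnd_mul_big.
by exists K => //; apply: filterS2 dwP HK => p ->.
Qed.

Lemma modulus_step_loc_lip : loc_lip (fun y => w y) x.
Proof.
have [k k0 kP] := posP; have [K K0 HK] := dwP_big.
have m1 : 0 < m%:R + 1 :> R by rewrite ltr_wpDl.
exists ((m%:R + 1) * K / k); first by rewrite !mulr_gt0// invr_gt0.
apply: filterS2 (near_fst_snd kP) HK => p [k1 _] Hp.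
rewrite mulrAC ler_pdivlMr// mulrC.
apply: (le_trans (positive_norm (w p.1 - w p.2) k0 k1)).
by rewrite -mulrA ler_pM// lerDl.
Qed.

Let zmod_aux1 (a b c e : V) : a - b - c - (a - c - e) = e - b.
Proof. by apply/rowP => i; rewrite !mxE; ring. Qed.

Let zmod_aux2 (y z a b s : V) : (y - a) - (z - b) - (y - z - s) = - (a - b - s).
Proof. by apply/rowP => i; rewrite !mxE; ring. Qed.

Let zmod_aux3 (u u0 g0 ud v v0 vx : V) :
  u - u0 - (g0 - ud) + (v - v0) + (v0 - vx) = u - (g0 - v) - (u0 - ud + vx).
Proof. by apply/rowP => i; rewrite !mxE; ring. Qed.

Let zmod_aux4 (y z a b : V) : y - a - (z - b) = y - z - (a - b).
Proof. by apply/rowP => i; rewrite !mxE; ring. Qed.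

(** Write [w] for the modulus step. As [w] vanishes at [x], the variation of
    the modulus only contributes to second order, and [w p.1 - w p.2] is
    [(p.1 - p.2) *m A x *m invmx |A x|] to first order. The last two factors
    multiply to the sign of [A x], so the full step doubles the negative
    directions and kills the positive ones. *)
Lemma modulus_step_strict_diff_zero : g x = 0 -> D = A x ->
  strict_diff (fun y => y - w y) x (fun u => u *m (1%:M - sgnmx (A x))).
Proof.
move=> gx DA.
have lw := modulus_step_loc_lip.
have wx : w x = 0 by rewrite /modulus_step gx mul0mx.
have [_ vw] := loc_lip_van lw; have [vP _] := loc_lip_van lP.
have uP := absmx_unit (sA x) uA.
have SP : sgnmx (A x) *m P x = A x.
  by rewrite absmx_def mulmxA sgnmx_comm// -mulmxA sgnmx_sqr// mulmx1.
have S1 : pair_small x (fun p => (w p.1 - w p.2 - (p.1 - p.2) *m sgnmx (A x)) *m P x).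
  apply: (@pair_small_near_eq _ _ _ _
    (fun p => (g p.1 - g p.2 - (p.1 - p.2) *m D)
      - (w p.2 - w x) *m (P p.1 - P p.2)
      - (w p.1 - w p.2) *m (P p.1 - P x))).
    apply: filterS dwP => p E; rewrite wx subr0.
    rewrite [in RHS]mulmxBl -[_ *m sgnmx _ *m _]mulmxA SP DA.
    rewrite (mulmxBr (w p.1 - w p.2)) E; exact: zmod_aux1.
  apply: pair_smallB; first apply: pair_smallB => //.
  - exact: pair_van_mul_big.
  - exact: pair_big_mul_van.
have S2 := pair_small_mul_bnd S1 (pair_bnd_cst x (invmx (P x))).
move=> e e0; apply: filterS (S2 e e0) => p; rewrite mulmxK//.
rewrite mulmxBr mulmx1 => H.
by rewrite zmod_aux2 normrN.
Qed.

(** Subtracting [w p.2 *m P p.2 = g p.2] from [w p.1 *m P p.1 = g p.1] gives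
    the variation of [w] times the modulus, so the expansion of the step is
    taken after multiplication by [P p.1], where no inverse appears. *)
Lemma modulus_step_expansion (X : V -> 'M[R]_m) :
  strict_diff (fun y => P y) x X ->
  pair_small x (fun p => ((p.1 - w p.1) - (p.2 - w p.2)) *m P p.1
     - ((p.1 - p.2) *m (P x - D) + w x *m X (p.1 - p.2))).
Proof.
move=> PX.
have lw := modulus_step_loc_lip.
have [_ vw] := loc_lip_van lw; have [vP _] := loc_lip_van lP.
apply: (@pair_small_near_eq _ _ _ _
  (fun p => (p.1 - p.2) *m (P p.1 - P x) - (g p.1 - g p.2 - (p.1 - p.2) *m D)
    + (w p.2 - w x) *m (P p.1 - P p.2)
    + w x *m (P p.1 - P p.2 - X (p.1 - p.2)))).
  apply: filterS dwP => p E.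
  have -> : p.1 - w p.1 - (p.2 - w p.2) = (p.1 - p.2) - (w p.1 - w p.2).
    exact: zmod_aux4.
  rewrite (mulmxBl (p.1 - p.2)) E (mulmxBr (p.1 - p.2)) (mulmxBr (p.1 - p.2) (P x)).
  rewrite (mulmxBl (w p.2) (w x)) (mulmxBr (w x) (P p.1 - P p.2)).
  exact: zmod_aux3.
apply: pair_smallD; first apply: pair_smallD; first apply: pair_smallB => //.
- exact: (pair_big_mul_van (pair_big_sub x) vP).
- exact: pair_van_mul_big.
- exact: pair_bnd_mul_small (pair_bnd_cst _ _) PX.
Qed.

Lemma expanding_of_expansion (M : V -> V) (c : R) :
  0 < c -> (forall u, c * `|u| <= `|M u|) ->
  pair_small x (fun p => ((p.1 - w p.1) - (p.2 - w p.2)) *m P p.1 - M (p.1 - p.2)) ->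
  exists2 U, nbhs x U & exists2 c', 0 < c' &
    expanding_on U (fun y => y - w y) c'.
Proof.
move=> c0 Mc HM.
have [[K K0 PK] _] := loc_lip_bnd lP.
have m1 : 0 < m%:R + 1 :> R by rewrite ltr_wpDl.
have c2 : 0 < c / 2 by rewrite divr_gt0.
pose Q (p : V * V) := c / 2 / ((m%:R + 1) * K) * `|p.1 - p.2| <=
   `|(p.1 - w p.1) - (p.2 - w p.2)|.
have /near_pairP[r r0 rQ] : \forall p \near (x, x), Q p.
  apply: filterS2 (HM _ c2) PK => p Hp Kp; rewrite /Q.
  rewrite mulrAC ler_pdivrMr ?mulr_gt0//.
  set dH := _ - _ - _ in Hp *.
  have := Mc (p.1 - p.2); have := mxnorm_mul dH (P p.1).
  have := lerB_dist (M (p.1 - p.2)) (dH *m P p.1); rewrite distrC => h1 h2 h3.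
  have h4 : m%:R * `|dH| * `|P p.1| <= `|dH| * ((m%:R + 1) * K).
    rewrite mulrAC [leLHS]mulrC; apply: ler_wpM2l => //.
    by apply: ler_pM => //; rewrite lerDl.
  have h5 : c * `|p.1 - p.2| = c / 2 * `|p.1 - p.2| + c / 2 * `|p.1 - p.2| by field.
  lra.
exists [set y | `|y - x| < r].
  by apply/near_normP; exists r.
exists (c / 2 / ((m%:R + 1) * K)); first by rewrite !divr_gt0// mulr_gt0.
by move=> y z yr zr; exact: (rQ y z).
Qed.

End StepExpansion.

(** * Rational functions at infinity *)

Section RationalAtInfinity.
Context {R : realType}.
Implicit Types (K : set R) (h : R -> R) (L : R).

(** On [K], the function [h] coincides with a rational function of [d] whose
    value at infinity is [L]; [p] and [q] are polynomials in [d^-1]. *)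
Definition rational_to K h L := exists p q : {poly R},
  [/\ q.[0] != 0, p.[0] = L * q.[0] &
      forall d, K d -> q.[d^-1] * h d = p.[d^-1]].

Lemma rational_to_ext K h h' L : (forall d, K d -> h d = h' d) ->
  rational_to K h L -> rational_to K h' L.
Proof.
by move=> hh [p [q [q0 pq E]]]; exists p, q; split => // d Kd; rewrite -hh// E.
Qed.

Lemma rational_to_cst K L : rational_to K (fun=> L) L.
Proof.
by exists L%:P, 1; split => [||d _]; rewrite !hornerE ?oner_eq0 ?mulr1 ?mul1r.
Qed.

Lemma rational_to_inv K : rational_to K (fun d => d^-1) 0.
Proof.
by exists 'X, 1; split => [||d _]; rewrite !hornerE ?oner_eq0 ?mul0r.
Qed.

Lemma rational_toD K h1 h2 L1 L2 : rational_to K h1 L1 -> rational_to K h2 L2 ->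
  rational_to K (fun d => h1 d + h2 d) (L1 + L2).
Proof.
move=> [p1 [q1 [q10 pq1 E1]]] [p2 [q2 [q20 pq2 E2]]].
exists (p1 * q2 + q1 * p2), (q1 * q2); split => [||d Kd]; rewrite ?(hornerD, hornerM).
- exact: mulf_neq0.
- by rewrite pq1 pq2; ring.
- move: (E1 d Kd) (E2 d Kd).
  move: q1.[d^-1] q2.[d^-1] p1.[d^-1] p2.[d^-1] (h1 d) (h2 d).
  by move=> a1 a2 b1 b2 c1 c2 <- <-; ring.
Qed.

Lemma rational_toM K h1 h2 L1 L2 : rational_to K h1 L1 -> rational_to K h2 L2 ->
  rational_to K (fun d => h1 d * h2 d) (L1 * L2).
Proof.
move=> [p1 [q1 [q10 pq1 E1]]] [p2 [q2 [q20 pq2 E2]]].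
exists (p1 * p2), (q1 * q2); split => [||d Kd]; rewrite ?(hornerD, hornerM).
- exact: mulf_neq0.
- by rewrite pq1 pq2; ring.
- move: (E1 d Kd) (E2 d Kd).
  move: q1.[d^-1] q2.[d^-1] p1.[d^-1] p2.[d^-1] (h1 d) (h2 d).
  by move=> a1 a2 b1 b2 c1 c2 <- <-; ring.
Qed.

Lemma rational_toV K h L : L != 0 -> (forall d, K d -> h d != 0) ->
  rational_to K h L -> rational_to K (fun d => (h d)^-1) L^-1.
Proof.
move=> L0 h0 [p [q [q0 pq E]]]; exists q, p; split.
- by rewrite pq mulf_neq0.
- by rewrite pq mulKf.
- by move=> d Kd; rewrite -E// mulfK// h0.
Qed.

Lemma rational_to_sum (I : Type) (r : seq I) (P : pred I) K (h : I -> R -> R) (L : I -> R) :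
  (forall i, rational_to K (h i) (L i)) ->
  rational_to K (fun d => \sum_(i <- r | P i) h i d) (\sum_(i <- r | P i) L i).
Proof.
move=> hL; elim: r => [|i r IH].
  by rewrite big_nil; apply: rational_to_ext (rational_to_cst K 0) => d _; rewrite big_nil.
rewrite big_cons; case: ifP => Pi.
  by apply: rational_to_ext (rational_toD (hL i) IH) => d _; rewrite big_cons Pi.
by apply: rational_to_ext IH => d _; rewrite big_cons Pi.
Qed.

Lemma rational_to_prod (I : Type) (r : seq I) K (h : I -> R -> R) (L : I -> R) :
  (forall i, rational_to K (h i) (L i)) ->
  rational_to K (fun d => \prod_(i <- r) h i d) (\prod_(i <- r) L i).
Proof.
move=> hL; elim: r => [|i r IH].
  by rewrite big_nil; apply: rational_to_ext (rational_to_cst K 1) => d _; rewrite big_nil.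
rewrite big_cons.
by apply: rational_to_ext (rational_toM (hL i) IH) => d _; rewrite big_cons.
Qed.

Lemma rational_to_det n K (N : R -> 'M[R]_n) (L : 'M[R]_n) :
  (forall i j, rational_to K (fun d => N d i j) (L i j)) ->
  rational_to K (fun d => \det (N d)) (\det L).
Proof.
move=> NL; apply: rational_to_sum => s; apply: rational_toM.
  exact: rational_to_cst.
exact: rational_to_prod.
Qed.

(** The numerator is a nonzero polynomial in [d^-1]. *)
Lemma rational_to_finite_zeros K h L : L != 0 -> rational_to K h L ->
  finite_set [set d | K d /\ h d = 0].
Proof.
move=> L0 [p [q [q0 pq E]]].
have p0 : p != 0.
  by apply/eqP => p0; have := mulf_neq0 L0 q0; rewrite -pq p0 horner0 eqxx.
apply: (@sub_finite_set _ _ ((@GRing.inv R) @` [set d | root p d])); last first.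
  by apply: finite_image; exact: finite_roots.
move=> d [Kd hd]; exists d^-1; last exact: invrK.
by rewrite /= /root -E// hd mulr0.
Qed.

End RationalAtInfinity.

(** * Finiteness of the bad shifts *)

Section ShiftFiniteness.
Context {R : realType} {m : nat}.
Local Notation V := 'rV[R]_m.
Variables (D : 'M[R]_m) (g a : V) (c : R) (T : V -> 'M[R]_m).
Hypotheses (sD : D^T = D) (c0 : 0 < c).
Hypothesis linT : forall (v : V) (M : 'M[R]_m),
  T (v *m M) = \sum_k v ord0 k *: T (row k M).
Variables (U : 'M[R]_m) (l : V).
Hypothesis Ul : spectral_basis D U l.

Let UU : U *m U^T = 1%:M. Proof. by case: Ul. Qed.
Let UtU : U^T *m U = 1%:M. Proof. exact: mulmx1C. Qed.

Let A d : 'M[R]_m := D + (d * c)%:M.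
Let B d u : 'M[R]_m := T u + (d * dot u a)%:M.
Let mu d i := l ord0 i + d * c.
Let phi d i j := (mu d i + mu d j) / (`|mu d i| + `|mu d j|).
Let gt j := (g *m U^T) ord0 j.
Let Tt k : 'M[R]_m := U *m T (row k U) *m U^T.
Let at_ k := dot (row k U) a.

(** Matrix, in the eigenbasis of [D], of the derivative of the step
    multiplied by the modulus. The quotient [phi] is the divided difference
    of the absolute value at two eigenvalues; it turns the derivative of the
    matrix into the derivative of its modulus. *)
Definition rotated_derivative d : 'M[R]_m := \matrix_(k, i)
  ((k == i)%:R * (`|mu d i| - l ord0 i) +
   \sum_j gt j / `|mu d j| * phi d j i * (Tt k j i + d * at_ k * (j == i)%:R)).
Local Notation N := rotated_derivative.

Definition sylvester_solution d u : 'M[R]_m :=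
  U^T *m (\matrix_(i, j) (phi d i j * (U *m B d u *m U^T) i j)) *m U.

Let AE d : A d = in_basis U (\row_i mu d i).
Proof.
rewrite /A [in LHS](spectral_basisE Ul).
have -> : (d * c)%:M = in_basis U (const_mx (d * c)).
  by rewrite /in_basis diag_const_mx mul_mx_scalar -scalemxAl UtU scalemx1.
rewrite /in_basis -mulmxDl -mulmxDr -raddfD/=; congr (_ *m diag_mx _ *m _).
by apply/rowP => i; rewrite !mxE.
Qed.

Let basisA d : spectral_basis (A d) U (\row_i mu d i).
Proof.
split=> //; rewrite AE /in_basis mulmxA mulmxA UU mul1mx.
by [].
Qed.

Let symA d : (A d)^T = A d.
Proof. by rewrite AE in_basis_sym. Qed.

Let PE d : absmx (A d) = in_basis U (\row_i `|mu d i|).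
Proof.
by rewrite (absmxE (symA d) (basisA d)); congr in_basis; apply/rowP => i; rewrite !mxE.
Qed.

Let unitA d : (forall i, mu d i != 0) -> A d \in unitmx.
Proof.
move=> mu0.
have E : A d *m in_basis U (\row_i (mu d i)^-1) = 1%:M.
  rewrite AE in_basis_mul// -(in_basis1 UU); congr in_basis.
  by apply/rowP => i; rewrite !mxE mulfV.
by have [] := mulmx1_unit E.
Qed.

Let invP d : (forall i, mu d i != 0) ->
  invmx (absmx (A d)) = in_basis U (\row_i `|mu d i|^-1).
Proof.
move=> mu0.
have E : absmx (A d) *m in_basis U (\row_i `|mu d i|^-1) = 1%:M.
  rewrite PE in_basis_mul// -(in_basis1 UU); congr in_basis.
  by apply/rowP => i; rewrite !mxE mulfV// normr_eq0.
have uP := absmx_unit (symA d) (unitA mu0).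
by rewrite -[RHS](mulKmx uP) E mulmx1.
Qed.

Let rotate (M : 'M[R]_m) : M = U^T *m (U *m M *m U^T) *m U.
Proof. by rewrite !mulmxA UtU mul1mx -mulmxA UtU mulmx1. Qed.

Lemma sylvester_solutionP d u : (forall i, mu d i != 0) ->
  absmx (A d) *m sylvester_solution d u + sylvester_solution d u *m absmx (A d) =
  A d *m B d u + B d u *m A d.
Proof.
move=> mu0; rewrite PE AE [in RHS](rotate (B d u)) /sylvester_solution /in_basis.
set Bt := U *m B d u *m U^T; set X := \matrix_(i, j) _.
have cancelU (M1 M2 : 'M[R]_m) : (U^T *m M1 *m U) *m (U^T *m M2 *m U) =
    U^T *m (M1 *m M2) *m U.
  by rewrite !mulmxA -[_ *m U *m U^T]mulmxA UU mulmx1.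
rewrite !cancelU -!mulmxDl -!mulmxDr; congr (_ *m _ *m _).
apply/matrixP => i j.
rewrite [LHS]mxE [RHS]mxE !mul_diag_mx !mul_mx_diag !mxE /phi.
have h : `|mu d i| + `|mu d j| != 0.
  by rewrite gt_eqF// ltr_pwDl// normr_gt0.
by field.
Qed.

Let UBU d u : U *m B d u *m U^T =
  \sum_k (u *m U^T) ord0 k *: (Tt k + (d * at_ k)%:M).
Proof.
set v := u *m U^T.
have uE : u = v *m U by rewrite /v -mulmxA UtU mulmx1.
have dE : dot u a = \sum_k v ord0 k * at_ k.
  rewrite uE /dot -mulmxA mxE; apply: eq_bigr => k _; congr (_ * _).
  by rewrite /at_ /dot -row_mul [RHS]mxE.
rewrite /B {1}uE linT dE mulmxDr mulmxDl mulmx_sumr mulmx_suml.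
rewrite mul_mx_scalar -scalemxAl UU scalemx1 mulr_sumr raddf_sum -big_split/=.
apply: eq_bigr => k _; rewrite scalerDr -scalemxAr -scalemxAl; congr (_ + _).
by rewrite scale_scalar_mx mulrCA.
Qed.

Lemma rotated_derivativeP d u : (forall i, mu d i != 0) ->
  u *m (absmx (A d) - D) + modulus_step (A d) g *m sylvester_solution d u =
  u *m (U^T *m N d *m U).
Proof.
move=> mu0; rewrite /modulus_step invP// PE [in LHS](spectral_basisE Ul).
set v := u *m U^T.
have -> : u *m (in_basis U (\row_i `|mu d i|) - in_basis U l) =
    v *m (diag_mx (\row_i `|mu d i|) - diag_mx l) *m U.
  by rewrite /in_basis -mulmxBl -mulmxBr !mulmxA.
have -> : g *m in_basis U (\row_i `|mu d i|^-1) *m sylvester_solution d u =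
    g *m U^T *m diag_mx (\row_i `|mu d i|^-1) *m
    (\matrix_(i, j) (phi d i j * (U *m B d u *m U^T) i j)) *m U.
  by rewrite /in_basis /sylvester_solution !mulmxA -[_ *m U *m U^T]mulmxA UU mulmx1.
rewrite !mulmxA -/v -mulmxDl; congr (_ *m _); apply/rowP => i.
rewrite mulmxBr mxE [in LHS]mxE !mul_mx_diag [in LHS]mxE.
rewrite [in RHS]mxE.
under [RHS]eq_bigr do rewrite [X in _ * X]mxE mulrDr.
rewrite big_split/=; congr (_ + _).
  rewrite (bigD1 i)//= big1 ?addr0 => [|k ki]; first by rewrite eqxx mul1r !mxE mulrBr.
  by rewrite (negbTE ki) mul0r mulr0.
under [RHS]eq_bigr do rewrite mulr_sumr.
rewrite exchange_big/= [in LHS]mxE; apply: eq_bigr => j _.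
rewrite [X in X * _ = _]mxE [X in _ * X = _]mxE [X in _ * X * _ = _]mxE UBU.
rewrite summxE !mulr_sumr; apply: eq_bigr => k _.
rewrite -/v [X in _ * (_ * X) = _]mxE [X in _ * (_ * (_ * X)) = _]mxE.
rewrite [X in _ * (_ * (_ * (_ + X))) = _]mxE -mulr_natr /gt.
rewrite (_ : 0 = ord0)//; ring.
Qed.

Let pattern (s : {ffun 'I_m -> bool}) := [set d : R | d != 0 /\
  forall i, mu d i != 0 /\ (0 < mu d i) = s i].
Let sg (s : {ffun 'I_m -> bool}) i : R := if s i then 1 else -1.

Let abs_mu s d i : pattern s d -> `|mu d i| = sg s i * mu d i.
Proof.
move=> [_ /(_ i)[mu0 mus]]; rewrite /sg -mus; case: (ltrgtP (mu d i) 0) => h.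
- by rewrite ltr0_norm// mulN1r.
- by rewrite gtr0_norm// mul1r.
- by rewrite h eqxx in mu0.
Qed.

(** [nu d i] is the eigenvalue [mu d i] divided by [d]; it tends to [c]. *)
Let nu d i := l ord0 i * d^-1 + c.

Let muE s d i : pattern s d -> mu d i = d * nu d i.
Proof. by move=> [d0 _]; rewrite /mu /nu mulrDr mulrCA mulfV// mulr1. Qed.

Let nu_rational s i : rational_to (pattern s) (fun d => nu d i) c.
Proof.
rewrite -[c]add0r -[X in X + c](mulr0 (l ord0 i)).
apply: rational_toD; last exact: rational_to_cst.
by apply: rational_toM; [exact: rational_to_cst|exact: rational_to_inv].
Qed.

Let nuV_rational s i : rational_to (pattern s) (fun d => (nu d i)^-1) c^-1.
Proof.
apply: rational_toV (nu_rational s i); first by rewrite gt_eqF.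
move=> d sd; have [d0 /(_ i)[+ _]] := sd; rewrite (muE i sd).
by apply: contraNneq => ->; rewrite mulr0.
Qed.

(** A summand stays bounded as [d] grows. For equal signs [phi] is a sign, and
    [d * at_ k], present for [j = i] only, is balanced by the eigenvalue in the
    denominator. For different signs [phi] is of order [d], its denominator
    being a difference of eigenvalues in which the shift cancels, and the
    eigenvalue balances it again. *)
Let vanishing_summand s i j k : rational_to (pattern s)
  (fun d => d^-1 * (gt j / `|mu d j| * phi d j i *
     (Tt k j i + d * at_ k * (j == i)%:R))) 0.
Proof.
have inv0 := rational_to_inv (pattern s).
have cst := rational_to_cst (pattern s).
have prod0 h h' L : rational_to (pattern s) h L -> rational_to (pattern s) h' 0 ->
    rational_to (pattern s) (fun d => h d * h' d) 0.
  by move=> hL h0; rewrite -(mulr0 L); exact: rational_toM.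
have nu0 d i' : pattern s d -> nu d i' != 0.
  move=> sd; have [d0 /(_ i')[+ _]] := sd; rewrite (muE i' sd).
  by apply: contraNneq => ->; rewrite mulr0.
have abs_neq0 d j1 j2 : pattern s d -> `|mu d j1| + `|mu d j2| != 0.
  move=> [d0 mus]; have [m1 _] := mus j1.
  by rewrite gt_eqF// ltr_pwDl// normr_gt0.
have [ji|ji] := eqVneq j i.
  apply: (@rational_to_ext _ _ (fun d => (gt j * (nu d j)^-1) *
      (d^-1 * (d^-1 * Tt k j i + at_ k)))).
    move=> d sd; have [d0 _] := sd; rewrite /phi -ji !(abs_mu _ sd) !(muE _ sd).
    have n0 := nu0 d j sd; move: (nu d j) n0 => n n0.
    have h : n + n != 0 by rewrite -mulr2n mulrn_eq0.
    rewrite (_ : true%:R = 1 :> R)// /sg; case: (s j); field;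
      by rewrite n0 d0 -!mulrDr ?mulf_neq0 ?oppr_eq0 ?oner_eq0.
  apply: prod0; first by apply: rational_toM; [exact: cst|exact: nuV_rational].
  rewrite -(mul0r (0 * Tt k j i + at_ k)); apply: rational_toM => //.
  by apply: rational_toD => //; exact: rational_toM.
have [sji|sji] := eqVneq (s j) (s i).
  apply: (@rational_to_ext _ _ (fun d => (gt j * sg s j * (nu d j)^-1 * sg s i * Tt k j i) *
      (d^-1 * d^-1))).
    move=> d sd; have [d0 _] := sd; have := abs_neq0 d j i sd.
    have n0 := nu0 d j sd.
    rewrite mulr0 addr0 /phi !(abs_mu _ sd) !(muE _ sd) /sg sji.
    move: (nu d j) n0 (nu d i) => n n0 n' h.
    have h' : n + n' != 0.
      apply: contraNneq h => h; case: (s i); rewrite -!mulrDr h !mulr0//.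
    case: (s i) {h}; field;
      by rewrite n0 d0 -!mulrDr ?mulf_neq0 ?oppr_eq0 ?oner_eq0.
  apply: (prod0 _ _ _ _ (prod0 _ _ _ inv0 inv0)).
  exact: (rational_toM (rational_toM (rational_toM (cst (gt j * sg s j))
    (nuV_rational s j)) (cst (sg s i))) (cst (Tt k j i))).
apply: (@rational_to_ext _ _ (fun d => (gt j * (nu d j)^-1 * (nu d j + nu d i) * Tt k j i
   / (l ord0 j - l ord0 i)) * d^-1)).
  move=> d sd; have [d0 _] := sd; have := abs_neq0 d j i sd.
  have n0 := nu0 d j sd.
  have -> : l ord0 j - l ord0 i = d * nu d j - d * nu d i.
    by rewrite -!(muE _ sd) /mu; ring.
  rewrite mulr0 addr0 /phi !(abs_mu _ sd) !(muE _ sd).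
  move: (nu d j) n0 (nu d i) => n n0 n'.
  have -> : sg s i = - sg s j.
    by move: sji; rewrite /sg; case: (s j); case: (s i); rewrite ?opprK.
  move=> h; have h' : n - n' != 0.
    apply: contraNneq h => h.
    by rewrite mulNr -mulrBr -mulrBr h !mulr0.
  have hd : d * n - d * n' != 0 by rewrite -mulrBr mulf_neq0.
  rewrite /sg; case: (s j) {h}; field; first by rewrite mulN1r hd n0 d0.
  by rewrite hd n0 d0 andbT mulN1r addrC -opprB oppr_eq0 hd.
apply: (prod0 _ _ _ _ inv0).
exact: (rational_toM (rational_toM (rational_toM (rational_toM (cst (gt j))
  (nuV_rational s j)) (rational_toD (nu_rational s j) (nu_rational s i)))
  (cst (Tt k j i))) (cst (l ord0 j - l ord0 i)^-1)).
Qed.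

(** On the shifts with a given pattern of signs, the matrix divided by [d] is
    a rational function of [d] whose value at infinity is the diagonal matrix
    of the signs times [c]. That value is invertible even when no large [d]
    has this pattern, so the determinant is not identically zero. *)
Lemma rotated_derivative_finite s :
  finite_set [set d | pattern s d /\ \det (N d) = 0].
Proof.
pose L : 'M[R]_m := diag_mx (\row_i (sg s i * c)).
have L0 : \det L != 0.
  rewrite det_diag; apply/prodf_neq0 => i _; rewrite mxE; apply: mulf_neq0; last by rewrite gt_eqF.
  by rewrite /sg; case: (s i); rewrite ?oppr_eq0 oner_eq0.
have NL : rational_to (pattern s) (fun d => \det (d^-1 *: N d)) (\det L).
  apply: rational_to_det => k i.
  pose F d := (k == i)%:R * (sg s i * nu d i - l ord0 i * d^-1) +
    \sum_j d^-1 * (gt j / `|mu d j| * phi d j i * (Tt k j i + d * at_ k * (j == i)%:R)).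
  apply: (@rational_to_ext _ _ F).
    move=> d sd; have [d0 _] := sd.
    rewrite [RHS]mxE [X in _ = _ * X]mxE [RHS]mulrDr mulr_sumr /F; congr (_ + _).
    rewrite (abs_mu _ sd) (muE _ sd).
    by field.
  have -> : L k i = (k == i)%:R * (sg s i * c - l ord0 i * 0) + \sum_(j < m) 0.
    rewrite mulr0 subr0 big1// addr0 !mxE.
    by have [->|ki] := eqVneq k i; rewrite ?mulr1n ?mulr0n ?mul1r ?mul0r.
  apply: rational_toD; last by apply: rational_to_sum => j; exact: vanishing_summand.
  apply: rational_toM; first exact: rational_to_cst.
  apply: rational_toD.
    by apply: rational_toM; [exact: rational_to_cst|exact: nu_rational].
  rewrite -mulNr; apply: (@rational_to_ext _ _ (fun d => - l ord0 i * d^-1)).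
    by move=> d _; rewrite mulNr.
  by apply: rational_toM; [exact: rational_to_cst|exact: rational_to_inv].
apply: sub_finite_set (rational_to_finite_zeros L0 NL).
by move=> d [sd dN] /=; split => //; rewrite detZ dN mulr0.
Qed.

Lemma finite_bad_shifts : finite_set [set d | ~ (A d \in unitmx /\
  exists2 X : V -> 'M[R]_m,
    (forall u, absmx (A d) *m X u + X u *m absmx (A d) = A d *m B d u + B d u *m A d) &
    exists2 k, 0 < k & forall u,
      k * `|u| <= `|u *m (absmx (A d) - D) + modulus_step (A d) g *m X u|)].
Proof.
pose Z i := [set d | mu d i = 0].
pose Y s := [set d | pattern s d /\ \det (N d) = 0].
apply: (@sub_finite_set _ _ ([set 0] `|` \bigcup_i Z i `|` \bigcup_s Y s)).
  move=> d bad; apply: contrapT => nZ; apply: bad.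
  have d0 : d != 0 by apply/eqP => d0; apply: nZ; left; left.
  have mu0 i : mu d i != 0 by apply/eqP => di; apply: nZ; left; right; exists i.
  have dN : \det (N d) != 0.
    apply/eqP => dN; apply: nZ; right; exists [ffun i => 0 < mu d i] => //.
    by split => //; split => // i; rewrite ffunE.
  split; first exact: unitA.
  exists (sylvester_solution d); first by move=> u; exact: sylvester_solutionP.
  have uM : U^T *m N d *m U \in unitmx.
    rewrite !unitmx_mul unitmx_tr; have [-> _] := mulmx1_unit UU.
    by rewrite /= andbT unitmxE unitfE.
  have [k k0 kM] := unit_coercive uM.
  by exists k => // u; rewrite rotated_derivativeP.
rewrite !finite_setU; split; first split.
- exact: finite_set1.
- apply: bigcup_finite => // i _; apply: (@sub_finite_set _ _ [set - l ord0 i / c]).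
    move=> d /= /eqP; rewrite /mu addrC addr_eq0 => /eqP <-.
    by rewrite mulfK ?gt_eqF.
  exact: finite_set1.
- by apply: bigcup_finite => // s _; exact: rotated_derivative_finite.
Qed.

End ShiftFiniteness.

(** * Preimages of null sets under the step *)

Section NewQNewtonStep.
Context {R : realType} {m : nat}.
Local Notation V := 'rV[R]_m.
Local Notation mu := (@lebesgue_outer R m).
Variables (f : V -> R) (alpha : R).
Hypotheses (a0 : 0 < alpha) (fC : Ck 3 f).
Local Notation A := (shifted_hessian f alpha).
Local Notation g := (gradient f).

Definition fixed_step (d : R) (y : V) : V := y - modulus_step (A d y) (g y).

(** Defined so as to be open: measurability of the irregular points needs no
    further argument. *)
Definition regular_at (d : R) : set V := [set x | exists2 U, nbhs x U &
  (forall y, U y -> A d y \in unitmx) /\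
  exists2 c, 0 < c & expanding_on U (fixed_step d) c].

Lemma regular_at_open d : open (regular_at d).
Proof.
rewrite openE => x [U xU [Uu Uc]].
apply: filterS (nbhs_interior xU) => y yU.
by exists U.
Qed.

Lemma regular_point x d (X : V -> 'M[R]_m) (a : V) (k : R) :
  (forall d, strict_diff (A d) x (fun u => hess_deriv f x u + (d * dot u a)%:M)) ->
  A d x \in unitmx ->
  (forall u, absmx (A d x) *m X u + X u *m absmx (A d x) =
    A d x *m (hess_deriv f x u + (d * dot u a)%:M) +
    (hess_deriv f x u + (d * dot u a)%:M) *m A d x) ->
  0 < k ->
  (forall u, k * `|u| <= `|u *m (absmx (A d x) - hessian f x)
      + modulus_step (A d x) (g x) *m X u|) ->
  regular_at d x.
Proof.
move=> Ad uA PX k0 kM.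
have sA := shifted_sym alpha fC d.
have lA := shifted_loc_lip a0 fC d x.
have gD := gradient_strict_diff fC x.
have PsX := modulus_strict_diff sA lA uA (Ad d) PX.
have HX := modulus_step_expansion sA lA uA gD PsX.
have [U xU [c c0 Uc]] := expanding_of_expansion sA lA uA k0 kM HX.
exists (U `&` [set y | A d y \in unitmx]).
  by apply: filterI => //; exact: unit_near.
split; first by move=> y [].
by exists c => // y z [Uy _] [Uz _]; exact: Uc.
Qed.

Lemma hess_deriv_comb x (v : V) (M : 'M[R]_m) :
  hess_deriv f x (v *m M) = \sum_k v ord0 k *: hess_deriv f x (row k M).
Proof.
apply/matrixP => i j; rewrite summxE mxE /dirder.
under [RHS]eq_bigr do rewrite mxE [X in _ * X]mxE /dirder mulr_sumr.
rewrite exchange_big/=; apply: eq_bigr => k _.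
rewrite [X in X * _]mxE mulr_suml; apply: eq_bigr => l _.
by rewrite [X in _ = _ * (X * _)]mxE mulrA.
Qed.

Lemma finite_irregular_shifts x : g x != 0 ->
  finite_set [set d | ~ regular_at d x].
Proof.
move=> g0; have [a Ad] := shifted_strict_diff alpha fC g0.
have c0 := shift_scale_gt0 alpha g0.
have sD := hessian_sym fC x.
have [U [l Ul]] := real_spectral sD.
apply: sub_finite_set (finite_bad_shifts (g x) a c0 (hess_deriv_comb x) Ul).
move=> d /= nreg [uA [X PX [k k0 kM]]]; apply: nreg.
exact: (regular_point Ad uA PX k0 kM).
Qed.

Lemma noncritical_open : open [set x | g x != 0].
Proof.
rewrite openE => x /= gx.
have g0 : 0 < `|g x| / 2 by rewrite divr_gt0// normr_gt0.
apply: filterS (loc_lip_near (gradient_loc_lip fC x) g0) => y yg.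
apply/eqP => gy; move: yg; rewrite gy sub0r normrN.
apply/negP; rewrite -ltNge; have : 0 < `|g x| by rewrite normr_gt0.
lra.
Qed.

(** For each noncritical point only finitely many shifts are irregular. *)
Lemma irregular_null : exists2 E : set R, countable E &
  forall d, ~ E d -> mu ([set x | g x != 0] `\` regular_at d) = 0%E.
Proof.
apply: (@null_slices _ _ (fun d => [set x | g x != 0] `\` regular_at d)).
  move=> d; rewrite setDE; apply: caratheodory_measurable_setI.
    exact/open_measurable_outer/noncritical_open.
  exact/caratheodory_measurable_setC/open_measurable_outer/regular_at_open.
move=> x; have [g0|g0] := eqVneq (g x) 0.
  rewrite (_ : [set d | _] = set0)//; apply/seteqP; split => // d [/=].
  by rewrite g0 eqxx.
by apply: sub_finite_set (finite_irregular_shifts g0) => d [].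
Qed.

Variable delta : 'I_m.+1 -> R.
Hypothesis injd : injective delta.
Local Notation H := (nqn_step f alpha delta).

Lemma nqn_wE y : nqn_mx f alpha delta y \in unitmx ->
  nqn_w f alpha delta y = modulus_step (nqn_mx f alpha delta y) (g y).
Proof.
move=> uA; set B := nqn_mx _ _ _ _ in uA *.
have sB : B^T = B by exact: shifted_sym.
rewrite /nqn_w /nqn_v -/B -mulmxBr -sgnmx_def /modulus_step.
apply: (can_inj (mulmxK (absmx_unit sB uA))); rewrite mulmxKV ?absmx_unit//.
rewrite absmx_def mulmxA -[_ *m sgnmx B *m B]mulmxA sgnmx_comm// mulmxA.
by rewrite mulmxKV// -mulmxA sgnmx_sqr// mulmx1.
Qed.

(** A shift [d] is singular when [- d * c] is an eigenvalue of the Hessian, for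
    [c] the positive factor of the shift, and [m.+1] distinct shifts are too
    many for the [m] eigenvalues. *)
Lemma nqn_index_unit y : g y != 0 -> nqn_mx f alpha delta y \in unitmx.
Proof.
move=> g0; rewrite /nqn_mx /nqn_index (negbTE g0).
have c0 := shift_scale_gt0 alpha g0.
have [j uj] : exists j, A (delta j) y \in unitmx.
  apply/existsP; rewrite -[X in is_true X]negbK negb_exists; apply/negP => /forallP nu.
  pose p := char_poly (hessian f y).
  pose s := [seq - (delta j * shift_scale f alpha y) | j <- enum 'I_m.+1].
  have us : uniq s.
    rewrite map_inj_uniq ?enum_uniq// => i j /oppr_inj.
    by move=> /(mulIf (lt0r_neq0 c0)); exact: injd.
  have rs : all (root p) s.
    apply/allP => _ /mapP[j _ ->]; have := nu j.
    rewrite unitmxE unitfE negbK => /eqP dj.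
    rewrite -eigenvalue_root_char; apply/eigenvalueP.
    have : ~~ row_free (A (delta j) y) by rewrite row_free_unit unitmxE unitfE dj eqxx.
    rewrite -kermx_eq0 => /rowV0Pn[v /sub_kermxP vA v0].
    exists v => //; move: vA; rewrite /shifted_hessian mulmxDr mul_mx_scalar => /eqP.
    by rewrite addr_eq0 scaleNr => /eqP.
  have := max_poly_roots (monic_neq0 (char_poly_monic _)) rs us.
  by rewrite size_char_poly size_map size_enum_ord ltnn.
rewrite /arg_min /extremum; case: pickP => [i /andP[]//|none].
case: (@arg_minnP _ j (fun j => A (delta j) y \in unitmx) (fun j => nat_of_ord j) uj) => i ui imin.
have := none i; rewrite /= ui /= => /negbT/negP; case.
by apply/forallP => k; apply/implyP; exact: imin.
Qed.

Lemma nqn_mx_first y : A (delta ord0) y \in unitmx ->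
  nqn_mx f alpha delta y = A (delta ord0) y.
Proof.
move=> u0; rewrite /nqn_mx /nqn_index; case: ifP => // _.
case: arg_minnP => // i ui /(_ ord0 u0); rewrite leqn0 => /eqP i0.
by congr (A (delta _) y); apply: val_inj.
Qed.

Lemma nqn_step_first y : A (delta ord0) y \in unitmx ->
  H y = fixed_step (delta ord0) y.
Proof.
move=> u0; have E := nqn_mx_first u0.
by rewrite /nqn_step nqn_wE E.
Qed.

Lemma nqn_step_critical y : g y = 0 -> H y = y.
Proof.
move=> g0; rewrite /nqn_step /nqn_w /nqn_v g0 !mul0mx subr0.
by rewrite subr0.
Qed.

(** Outside a null set a point is either critical, hence fixed, or regular for
    the first shift, where the step is locally expanding by some factor. *)
Lemma null_preimage_nqn_step (N : set V) :
  mu ([set x | g x != 0] `\` regular_at (delta ord0)) = 0%E ->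
  mu N = 0%E -> mu (H @^-1` N) = 0%E.
Proof.
move=> irr N0.
apply: (@null_subset _ _ _ (N `|` ([set x | g x != 0] `\` regular_at (delta ord0))
   `|` (regular_at (delta ord0) `&` fixed_step (delta ord0) @^-1` N))).
  move=> x /= Hx; have [gx|gx] := eqVneq (g x) 0.
    by left; left; move: Hx; rewrite nqn_step_critical.
  have [reg|nreg] := pselect (regular_at (delta ord0) x).
    right; split => //=; have [U xU [Uu _]] := reg.
    by rewrite -nqn_step_first//; apply: Uu; exact: nbhs_singleton.
  by left; right.
apply: null_setU; first exact: null_setU.
apply: null_preimage_locally_expanding => // x [U xU [_ [c c0 Uc]]].
by exists U => //; exists c.
Qed.

Lemma null_preimage_nqn_iter (N : set V) n :
  mu ([set x | g x != 0] `\` regular_at (delta ord0)) = 0%E ->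
  mu N = 0%E -> mu [set x | N (nqn_seq f alpha delta x n)] = 0%E.
Proof.
move=> irr N0; elim: n => [//|n IH].
have -> : [set x | N (nqn_seq f alpha delta x n.+1)] =
    H @^-1` [set x | N (nqn_seq f alpha delta x n)].
  by apply/funext => x; rewrite /preimage /nqn_seq/= -iterS iterSr.
exact: null_preimage_nqn_step.
Qed.

End NewQNewtonStep.

(** * Limits are critical points *)

Section LimitCritical.
Context {R : realType} {m : nat}.
Local Notation V := 'rV[R]_m.
Variables (f : V -> R) (alpha : R).
Hypotheses (a0 : 0 < alpha) (fC : Ck 3 f).
Local Notation A := (shifted_hessian f alpha).
Local Notation g := (gradient f).
Variable delta : 'I_m.+1 -> R.
Hypothesis injd : injective delta.
Local Notation H := (nqn_step f alpha delta).

(** The gradient is the step times the modulus of the shifted Hessian, and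
    the [m.+1] shifted Hessians are bounded near [x]. *)
Lemma step_lower_bound x : g x != 0 -> exists2 c, 0 < c &
  \forall y \near x, c <= `|y - H y|.
Proof.
move=> gx.
have G0 : 0 < `|g x| / 2 by rewrite divr_gt0// normr_gt0.
pose K := \sum_j (`|A (delta j) x| + 1).
have K0 : 0 < K.
  by rewrite /K big_ord_recl ltr_pwDl ?ltr_wpDl// sumr_ge0// => j _; rewrite addr_ge0.
have HK : \forall y \near x, forall j, `|A (delta j) y| <= K.
  have Hj j : \forall y \near x, `|A (delta j) y| <= K.
    apply: filterS (loc_lip_near (shifted_loc_lip a0 fC (delta j) x) ltr01) => y yj.
    rewrite -[A (delta j) y](subrK (A (delta j) x)) (le_trans (ler_normD _ _))//.
    rewrite /K (bigD1 j)//= -[X in X <= _]addr0 lerD//.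
      by rewrite addrC lerD2l.
    by apply: sumr_ge0 => i _; rewrite addr_ge0.
  exact: (@filter_forall _ _ (fun j y => `|A (delta j) y| <= K) _ _ Hj).
have m1 : 0 < m%:R + 1 :> R by rewrite ltr_wpDl.
pose L := (m%:R + 1) * ((m%:R + 1) * K).
have L0 : 0 < L by rewrite !mulr_gt0.
exists (`|g x| / 2 / L); first by rewrite divr_gt0.
apply: filterS3 (loc_lip_near (gradient_loc_lip fC x) G0) HK
  (open_nbhs_nbhs (conj (noncritical_open fC) gx)) => y yg yK gy.
have uy := nqn_index_unit alpha injd gy.
set B := nqn_mx f alpha delta y in uy.
have sB : B^T = B by exact: shifted_sym.
have -> : y - H y = modulus_step B (g y).
  by rewrite /nqn_step (nqn_wE fC uy) opprB addrC subrK.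
have BK : `|absmx B| <= (m%:R + 1) * K.
  rewrite absmx_def (le_trans (mxnorm_mul _ _))//.
  rewrite -[leRHS]mulr1; apply: ler_pM => //.
  - by apply: ler_pM; rewrite ?lerDl//; exact: yK.
  - exact: sgnmx_norm_le1.
rewrite ler_pdivrMr//.
have gE : g y = modulus_step B (g y) *m absmx B.
  by rewrite /modulus_step mulmxKV// absmx_unit.
have h1 : `|g y| <= `|modulus_step B (g y)| * L.
  rewrite [X in `|X| <= _]gE (le_trans (mxnorm_mul _ _))// mulrAC mulrC.
  apply: ler_wpM2l => //; apply: ler_pM => //; rewrite lerDl//.
apply: le_trans h1.
have := lerB_dist (g x) (g y); rewrite distrC; lra.
Qed.

Lemma nqn_seqS x0 n :
  nqn_seq f alpha delta x0 n.+1 = H (nqn_seq f alpha delta x0 n).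
Proof. by rewrite /nqn_seq iterS. Qed.

Lemma limit_steps (u : nat -> V) (h : V -> V) (x : V) (c : R) : 0 < c ->
  u n @[n --> \oo] --> x -> (forall n, u n.+1 = h (u n)) ->
  (\forall y \near x, c <= `|y - h y|) -> False.
Proof.
move=> c0 xn uS Hc.
have xS : u n.+1 @[n --> \oo] --> x by rewrite (@cvg_shiftS _ u).
have c2 : 0 < c / 2 by rewrite divr_gt0.
have e1 : \forall n \near \oo, `|x - u n| < c / 2.
  by move/cvgrPdist_lt : xn; apply.
have e2 : \forall n \near \oo, `|x - u n.+1| < c / 2.
  by move/cvgrPdist_lt : xS; apply.
have e3 : \forall n \near \oo, c <= `|u n - h (u n)| := xn _ Hc.
have [n [n1 n2 n3]] : exists n, [/\ `|x - u n| < c / 2, `|x - u n.+1| < c / 2 &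
    c <= `|u n - u n.+1|].
  apply: (@filter_ex _ \oo); apply: filterS3 e1 e2 e3 => n h1 h2 h3.
  by split => //; rewrite uS.
have aux (r s t : R) : r < c / 2 -> s < c / 2 -> c <= t -> t <= r + s -> False.
  by move=> *; lra.
apply: (aux _ _ _ n1 n2 n3); rewrite (distrC x).
by apply: le_trans (ler_normD _ _); rewrite addrA subrK.
Qed.

Lemma limit_critical x0 x : nqn_seq f alpha delta x0 n @[n --> \oo] --> x -> g x = 0.
Proof.
move=> xn; apply/eqP; apply: contrapT => /negP/step_lower_bound[c c0 Hc].
exact: (limit_steps c0 xn (nqn_seqS x0) Hc).
Qed.

End LimitCritical.

(** * Orbits staying near a saddle *)

Section UnstableCone.
Context {R : realType} {m : nat}.
Local Notation V := 'rV[R]_m.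
Local Notation mu := (@lebesgue_outer R m).

Definition stay (h : V -> V) (Q : set V) : set V := [set x | forall n, Q (iter n h x)].

(** Two orbits whose difference starts in the cone around the expanded
    directions separate geometrically, so they cannot both stay in a bounded set. *)
Lemma stay_cone (h : V -> V) (Q : set V) (pa pb : 'M[R]_m) (M : R) :
  (forall y z, Q y -> Q z -> `|(y - z) *m pb| <= M) ->
  (forall y z, Q y -> Q z -> `|(y - z) *m pa| <= `|(y - z) *m pb| ->
     `|(h y - h z) *m pa| <= `|(h y - h z) *m pb| /\
     3 / 2 * `|(y - z) *m pb| <= `|(h y - h z) *m pb|) ->
  forall y z, stay h Q y -> stay h Q z ->
  `|(y - z) *m pb| <= `|(y - z) *m pa|.
Proof.
move=> QM Qh y z Sy Sz; rewrite leNgt; apply/negP => ab.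
have b0 : 0 < `|(y - z) *m pb| by exact: le_lt_trans ab.
(* The growth [(3 / 2) ^ n] is bounded below by [1 + n / 2]. *)
have key n : `|(iter n h y - iter n h z) *m pa| <= `|(iter n h y - iter n h z) *m pb|
    /\ (1 + n%:R / 2) * `|(y - z) *m pb| <= `|(iter n h y - iter n h z) *m pb|.
  elim: n => [|n [IH1 IH2]]; first by rewrite /= mul0r addr0 mul1r; split => //; exact: ltW.
  have [h1 h2] := Qh _ _ (Sy n) (Sz n) IH1.
  split => //; rewrite !iterS; apply: le_trans h2.
  have n0 : 0 <= n%:R :> R by [].
  rewrite -natr1; nra.
have M0 : 0 <= M by apply: le_trans (QM _ _ (Sy 0%N) (Sz 0%N)).
have t0 : 0 <= M / `|(y - z) *m pb| * 2 by rewrite mulr_ge0// divr_ge0.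
have [N NP] : exists N : nat, M / `|(y - z) *m pb| * 2 < N%:R.
  by have /andP[_ lt] := Num.Theory.truncn_itv t0;
    exists (Num.truncn (M / `|(y - z) *m pb| * 2)).+1.
have [_ big_] := key N.
have := le_trans big_ (QM _ _ (Sy _) (Sz _)).
rewrite leNgt => /negP; apply.
rewrite -ltr_pdivrMr//; move: NP; set q := M / _; set w := N%:R => NP; lra.
Qed.

(** On the closure of the staying points, differences avoid the open cone
    around the expanded directions, and in particular the line of [e]. *)
Lemma stay_null (h : V -> V) (Q : set V) (pa pb : 'M[R]_m) (M : R) (e : V) :
  (forall y z, Q y -> Q z -> `|(y - z) *m pb| <= M) ->
  (forall y z, Q y -> Q z -> `|(y - z) *m pa| <= `|(y - z) *m pb| ->
     `|(h y - h z) *m pa| <= `|(h y - h z) *m pb| /\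
     3 / 2 * `|(y - z) *m pb| <= `|(h y - h z) *m pb|) ->
  e *m pa = 0 -> e *m pb != 0 ->
  mu (stay h Q) = 0%E.
Proof.
move=> QM Qh ea eb.
have cone := stay_cone QM Qh.
apply: (@null_subset _ _ _ (closure (stay h Q))); first exact: subset_closure.
apply: (@null_of_line_sections _ _ _ e); first exact: closed_closure.
move=> x y t cx cy xy.
have ccone : `|(x - y) *m pb| <= `|(x - y) *m pa|.
  apply/ler_addgt0Pr => r r0.
  pose C := m%:R * `|pa| + m%:R * `|pb| + 1.
  have C0 : 0 < C by rewrite ltr_wpDl// addr_ge0// mulr_ge0.
  have s0 : 0 < r / C / 2 by rewrite !divr_gt0.
  have [x' [Sx' x'x]] := cx _ (nbhsx_ballx x (r / C / 2) s0).
  have [y' [Sy' y'y]] := cy _ (nbhsx_ballx y (r / C / 2) s0).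
  move: x'x y'y; rewrite mx_norm_ball /ball_/= => x'x y'y.
  have d1 : `|(x - y) - (x' - y')| <= r / C.
    have -> : (x - y) - (x' - y') = (x - x') - (y - y').
      by rewrite !opprB addrACA [in RHS]addrACA; congr (_ + _); rewrite addrC.
    by apply: (le_trans (ler_normB _ _)); lra.
  have c1 := cone _ _ Sx' Sy'.
  have near_ (q : 'M[R]_m) : `|((x - y) - (x' - y')) *m q| <= m%:R * `|q| * (r / C).
    rewrite (le_trans (mxnorm_mul _ _))// mulrAC.
    by rewrite ler_wpM2l// mulr_ge0.
  have na := near_ pa; have nb := near_ pb.
  have h1 := ler_normD (((x - y) - (x' - y')) *m pb) ((x' - y') *m pb).
  have h2 := lerB_dist ((x' - y') *m pa) ((x - y) *m pa).
  rewrite -mulmxDl subrK in h1.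
  rewrite -mulmxBl -(opprB (x - y)) mulNmx normrN in h2.
  have rC : (m%:R * `|pa| + m%:R * `|pb|) * (r / C) <= r.
    rewrite mulrA ler_pdivrMr// mulrC; apply: ler_wpM2l; first exact: ltW.
    by rewrite /C lerDl.
  rewrite mulrDl in rC; lra.
move: ccone; rewrite xy -!scalemxAl ea scaler0 normr0 normrZ.
by rewrite pmulr_lle0 ?normr_gt0// normr_le0 => /eqP.
Qed.

(** Since [S] is an involution other than the identity, [(1 - S) / 2] is a
    nonzero projection, and [h] is, up to a small Lipschitz error, twice this
    projection: its range is expanded and its kernel contracted. *)
Lemma saddle_stay_null (h : V -> V) (p : V) (S : 'M[R]_m) :
  S *m S = 1%:M -> S != 1%:M ->
  strict_diff h p (fun u => u *m (1%:M - S)) ->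
  exists2 Q, nbhs p Q & mu (stay h Q) = 0%E.
Proof.
move=> SS S1 hS.
pose pb : 'M[R]_m := 2^-1 *: (1%:M - S).
pose pa : 'M[R]_m := 2^-1 *: (1%:M + S).
have two : (2 : R) != 0 by [].
have sum1 : pa + pb = 1%:M.
  apply/matrixP => i j; rewrite !mxE.
  by move: ((i == j)%:R) (S i j) => t s; field.
have ba : pb *m pa = 0.
  rewrite /pa /pb -scalemxAl -scalemxAr mulmxDr mulmx1 mulmxBl mul1mx SS.
  by rewrite addrC addrA subrK subrr !scaler0.
have bb : pb *m pb = pb.
  by rewrite -{3}[pb]mulmx1 -sum1 mulmxDr ba add0r.
have Lb : 1%:M - S = 2 *: pb by rewrite scalerA mulfV// scale1r.
have pb0 : pb != 0.
  apply: contraNneq S1 => pb0; move: Lb; rewrite pb0 scaler0 => /eqP.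
  by rewrite subr_eq0 => /eqP <-.
have [i ib] : exists i, row i pb != 0.
  apply/existsP; rewrite -[X in is_true X]negbK negb_exists; apply/negP => /forallP z.
  case/negP: pb0; apply/eqP/row_matrixP => i; rewrite row0.
  by apply/eqP; have := z i; rewrite negbK.
pose C := m%:R * `|pa| + m%:R * `|pb| + 1.
have C0 : 0 < C by rewrite ltr_wpDl// addr_ge0// mulr_ge0.
(* In the cone the error is at most [1 / 4] of the expanded component, which
   leaves an expansion by [2 - 1 / 4 >= 3 / 2]. *)
have e0 : 0 < 8^-1 / C by rewrite divr_gt0.
have /near_pairP[r r0 rP] := hS _ e0.
exists [set y | `|y - p| < r]; first by apply/near_normP; exists r.
apply: (@stay_null h _ pa pb (C * (r + r)) (row i pb)).
- move=> y z /= yr zr; rewrite (le_trans (mxnorm_mul _ _))// mulrAC.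
  apply: ler_pM; rewrite ?mulr_ge0//.
    by rewrite /C -addrA [X in _ <= X]addrCA lerDl addr_ge0// mulr_ge0.
  have -> : y - z = (y - p) - (z - p) by rewrite opprB addrA subrK.
  by apply: (le_trans (ler_normB _ _)); lra.
- move=> y z /= yr zr uab.
  set u := y - z in uab *; set v := h y - h z.
  have := rP _ _ yr zr => /=; rewrite -/u -/v; set err := v - _ => errP.
  have vE : v = 2 *: (u *m pb) + err.
    by rewrite /err Lb scalemxAr addrC subrK.
  have u2 : `|u| <= 2 * `|u *m pb|.
    rewrite -{1}[u]mulmx1 -sum1 mulmxDr (le_trans (ler_normD _ _))//; lra.
  have err_mul (q : 'M[R]_m) : m%:R * `|q| <= C -> `|err *m q| <= 4^-1 * `|u *m pb|.
    move=> qC; rewrite (le_trans (mxnorm_mul _ _))// mulrAC.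
    apply: (@le_trans _ _ (C * (8^-1 / C * `|u|))).
      by apply: ler_pM; rewrite ?mulr_ge0.
    rewrite mulrA [C * _]mulrC divfK ?gt_eqF//; lra.
  have Ca : m%:R * `|pa| <= C by rewrite /C -addrA lerDl addr_ge0// mulr_ge0.
  have Cb : m%:R * `|pb| <= C.
    by rewrite /C -addrA [X in _ <= X]addrCA lerDl addr_ge0// mulr_ge0.
  have ea := err_mul _ Ca; have eb := err_mul _ Cb.
  have va : v *m pa = err *m pa.
    by rewrite vE mulmxDl -scalemxAl -mulmxA ba mulmx0 scaler0 add0r.
  have vb : v *m pb = 2 *: (u *m pb) + err *m pb.
    by rewrite {1}vE mulmxDl -scalemxAl -mulmxA bb.
  have := lerB_normD (2 *: (u *m pb)) (err *m pb).
  rewrite -vb normrZ ger0_norm// va => h1.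
  have b0 : 0 <= `|u *m pb| by [].
  by split; lra.
- by rewrite -row_mul ba row0.
- by rewrite -row_mul bb.
Qed.

End UnstableCone.

(** * Minima and quadratic convergence *)

Section Minimum.
Context {R : realType} {m : nat}.
Local Notation V := 'rV[R]_m.
Variables (f : V -> R) (alpha : R).
Hypotheses (a0 : 0 < alpha) (fC : Ck 3 f).
Local Notation A := (shifted_hessian f alpha).
Local Notation g := (gradient f).

Lemma dirder_gradient x u : dirder f x u = dot u (g x).
Proof. by rewrite /dirder dotE; apply: eq_bigr => k _; rewrite mxE. Qed.

Lemma positive_hessian_local_min p k : 0 < k -> g p = 0 ->
  positive_by k (hessian f p) -> local_min f p.
Proof.
move=> k0 gp kD.
have m1 : 0 < m%:R + 1 :> R by rewrite ltr_wpDl.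
have [r r0 rP] := (near_normP _ _).1 (near_diag (gradient_strict_diff fC p (divr_gt0 k0 m1))).
apply/near_normP; exists r => // y yr.
have fC1 : Ck 1 f by do 2!apply: CkW.
have [t [t0 t1 E]] := C1_mvt p y fC1.
set u := y - p in yr E.
have xr : `|p + t *: u - p| < r.
  rewrite addrC addKr normrZ ger0_norm//; apply: le_lt_trans yr.
  by rewrite ler_piMl.
have pu : p + t *: u - p = t *: u by rewrite addrC addKr.
have := rP _ xr => /=; rewrite gp subr0 pu -scalemxAl => H.
rewrite -subr_ge0 E dirder_gradient.
set q := g (p + t *: u) in H *.
have -> : q = t *: (u *m hessian f p) + (q - t *: (u *m hessian f p)).
  by rewrite addrC subrK.
rewrite dotDr dotZr dotC.
have h1 := kD u; have h2 := sqr_norm_le_dot u.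
set rest := q - _ in H *.
have h3 : `|dot u rest| <= t * (k * `|u| ^+ 2).
  apply: (le_trans (norm_dot_le _ _)).
  apply: (@le_trans _ _ ((m%:R + 1) * (`|u| * (k / (m%:R + 1) * `|t *: u|)))).
    by apply: ler_pM => //; [rewrite lerDl|exact: ler_wpM2l].
  rewrite normrZ ger0_norm// le_eqVlt; apply/orP; left; apply/eqP.
  by field; rewrite gt_eqF.
have h4 : t * (k * `|u| ^+ 2) <= t * dot (u *m hessian f p) u.
  by apply: ler_wpM2l => //; apply: le_trans h1; rewrite ler_pM2l.
move: h3; rewrite ler_norml => /andP[h3 _]; lra.
Qed.

Lemma positive_by_perturb k (B C : 'M[R]_m) : positive_by k B ->
  m%:R * (m%:R * `|B - C|) <= k / 2 -> positive_by (k / 2) C.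
Proof.
move=> kB BC v.
have -> : v *m C = v *m B - v *m (B - C) by rewrite mulmxBr opprB addrC subrK.
rewrite dotDl dotNl.
have h1 := kB v; have h2 := sqr_norm_le_dot v.
have h3 : dot (v *m (B - C)) v <= k / 2 * `|v| ^+ 2.
  apply: (le_trans (dot_le _ _)).
  apply: (@le_trans _ _ (m%:R * (m%:R * `|v| * `|B - C| * `|v|))).
    apply: ler_wpM2l => //; apply: ler_wpM2r => //; exact: mxnorm_mul.
  have -> : m%:R * (m%:R * `|v| * `|B - C| * `|v|) =
     m%:R * (m%:R * `|B - C|) * `|v| ^+ 2 by ring.
  by apply: ler_wpM2r => //; exact: sqr_ge0.
have k0 : 0 <= k / 2 by apply: le_trans BC; rewrite !mulr_ge0.
have h4 : k / 2 * `|v| ^+ 2 <= k / 2 * dot v v by exact: ler_wpM2l.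
have h5 : k * dot v v = k / 2 * dot v v + k / 2 * dot v v by field.
lra.
Qed.

(** Each component of the gradient at [y] is the increment of a function whose
    derivative is taken at some point between [p] and [y], where the Hessian
    is within a multiple of the distance from its value at [y]. *)
Lemma gradient_quadratic p : g p = 0 -> exists2 K, 0 < K &
  \forall y \near p, `|(y - p) *m hessian f y - g y| <= K * `|y - p| ^+ 2.
Proof.
move=> gp.
have [K K0 /near_pairP[r r0 rP]] := hessian_loc_lip fC p.
exists ((m%:R + 1) * K); first by rewrite mulr_gt0// ltr_wpDl.
apply/near_normP; exists r => // y yr.
apply: mxnorm_le => [|i j].
  by rewrite mulr_ge0 ?sqr_ge0// mulr_ge0 ?addr_ge0// ltW.
have pC : Ck 1 (partial f j) by apply: Ck_partial; exact: CkW.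
have [t [t0 t1 E]] := C1_mvt p y pC.
set u := y - p in yr E *; set xi := p + t *: u in E.
have gj : g y ord0 j = (u *m hessian f xi) ord0 j.
  have gpj : partial f j p = 0 by have := congr1 (fun v : V => v ord0 j) gp; rewrite !mxE.
  rewrite mxE -[LHS]subr0 -gpj E /dirder [RHS]mxE; apply: eq_bigr => k _.
  by rewrite [X in _ = _ * X]mxE.
have -> : i = ord0 by rewrite ord1.
rewrite mxE [X in _ + X]mxE gj.
have -> : (u *m hessian f y) ord0 j - (u *m hessian f xi) ord0 j =
    (u *m (hessian f y - hessian f xi)) ord0 j.
  by rewrite mulmxBr [RHS]mxE [X in _ = _ + X]mxE.
apply: (le_trans (mxnorm_coord _ _ _)); apply: (le_trans (mxnorm_mul _ _)).
have xr : `|xi - p| < r.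
  rewrite /xi addrC addKr normrZ ger0_norm//; apply: le_lt_trans yr.
  by rewrite ler_piMl.
have yx : `|y - xi| <= `|u|.
  have -> : y - xi = (1 - t) *: u.
    by rewrite /xi opprD addrA -/u scalerBl scale1r.
  by rewrite normrZ ger0_norm ?subr_ge0// ler_piMl// gerBl.
have h := rP _ _ yr xr.
have -> : (m%:R + 1) * K * `|u| ^+ 2 = (m%:R + 1) * `|u| * (K * `|u|) by ring.
apply: ler_pM => //.
  by apply: ler_wpM2r => //; rewrite lerDl.
by apply: (le_trans h); rewrite ler_pM2l.
Qed.

Lemma shifted_critical d p : g p = 0 -> A d p = hessian f p.
Proof.
move=> gp; rewrite /shifted_hessian -[enorm _ `^ _]/(shift_scale f alpha p).
by rewrite (shift_scale0 a0 gp) mulr0 raddf0 addr0.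
Qed.

(** When the shifted Hessian is positive the step is a Newton step, whose
    error times the shifted Hessian is the Taylor remainder of the gradient
    plus the shift. The shift is of the first order in [y - p], and it
    multiplies [y - p]. *)
Lemma fixed_step_quadratic d p k : 0 < k -> g p = 0 ->
  positive_by k (hessian f p) -> exists2 K, 0 < K &
  \forall y \near p, `|fixed_step f alpha d y - p| <= K * `|y - p| ^+ 2.
Proof.
move=> k0 gp kD.
have m1 : 0 < m%:R + 1 :> R by rewrite ltr_wpDl.
have [K K0 gK] := gradient_quadratic gp.
have [L L0 /near_diag cL] := shift_scale_loc_lip a0 fC p.
have Ap : positive_by k (A d p) by rewrite shifted_critical.
have sA := shifted_sym alpha fC d.
have e0 : 0 < k / 2 / ((m%:R + 1) * (m%:R + 1)) by rewrite !divr_gt0// mulr_gt0.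
have k2 : 0 < k / 2 by rewrite divr_gt0.
have Anear : \forall y \near p, positive_by (k / 2) (A d y).
  apply: filterS (loc_lip_near (shifted_loc_lip a0 fC d p) e0) => y yA.
  apply: (positive_by_perturb Ap); rewrite distrC mulrA.
  apply: (@le_trans _ _ ((m%:R + 1) * (m%:R + 1) * (k / 2 / ((m%:R + 1) * (m%:R + 1))))).
    by apply: ler_pM => //; apply: ler_pM => //; rewrite lerDl.
  by rewrite mulrC divfK ?gt_eqF// mulr_gt0.
pose M := K + `|d| * L.
have M0 : 0 < M by rewrite ltr_pwDl// mulr_ge0// ltW.
exists ((m%:R + 1) * M / (k / 2)); first by rewrite divr_gt0// mulr_gt0.
apply: filterS3 gK cL Anear => y gy cy Ay.
have S1 := sgnmx_positive (sA y) k2 Ay.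
have PA : absmx (A d y) = A d y by rewrite absmx_def S1 mulmx1.
have uA : A d y \in unitmx.
  rewrite -row_free_unit -kermx_eq0; apply/eqP/row_matrixP => i; rewrite row0.
  apply/eqP; rewrite -normr_le0 -(ler_pM2l k2) mulr0.
  apply: (le_trans (positive_norm _ k2 Ay)).
  by rewrite -row_mul mulmx_ker row0 normr0 mulr0.
rewrite mulrAC ler_pdivlMr// mulrC.
apply: (le_trans (positive_norm _ k2 Ay)).
rewrite -mulrA; apply: ler_pM => //; first by rewrite lerDl.
have -> : (fixed_step f alpha d y - p) *m A d y =
    ((y - p) *m hessian f y - g y) + (d * shift_scale f alpha y) *: (y - p).
  rewrite /fixed_step /modulus_step PA addrAC mulmxBl mulmxKV//.
  rewrite {1}/shifted_hessian mulmxDr mul_mx_scalar addrAC.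
  by [].
apply: (le_trans (ler_normD _ _)); rewrite /M mulrDl; apply: lerD => //.
rewrite normrZ normrM.
have := cy; rewrite /= (shift_scale0 a0 gp) subr0 => cy'.
have -> : `|d| * L * `|y - p| ^+ 2 = `|d| * (L * `|y - p|) * `|y - p| by ring.
by apply: ler_wpM2r => //; exact: ler_wpM2l.
Qed.

End Minimum.

Section Assembly.
Context {R : realType} {m : nat}.
Local Notation V := 'rV[R]_m.
Local Notation mu := (@lebesgue_outer R m).

(** Indexing by rational cubes makes this a countable union, whatever the
    number of saddle points. *)
Definition trapped (h : V -> V) : set V := \bigcup_(cn : ('rV[rat]_m * nat) * nat)
  [set x | mu (stay h (qcube cn.1)) = 0%E /\ stay h (qcube cn.1) (iter cn.2 h x)].

Lemma trapped_null (h : V -> V) :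
  (forall N n, mu N = 0%E -> mu [set x | N (iter n h x)] = 0%E) ->
  mu (trapped h) = 0%E.
Proof.
move=> hN; apply: null_bigcup_countType => -[c n] /=.
have [c0|c0] := pselect (mu (stay h (qcube c)) = 0%E).
  by apply: null_subset (hN _ n c0) => x [].
rewrite (_ : [set x | _] = set0) ?lebesgue_outer0//.
by apply/seteqP; split => // x [].
Qed.

Lemma trapped_limit (h : V -> V) (x p : V) (Q : set V) : nbhs p Q -> mu (stay h Q) = 0%E ->
  iter n h x @[n --> \oo] --> p -> trapped h x.
Proof.
move=> pQ Q0 xp; have [c [cQ pc]] := qcube_nbhs pQ.
have [N _ NP] := xp _ pc.
exists (c, N) => //=; split.
  by apply: null_subset Q0 => y yc n; exact: cQ.
by move=> n; rewrite -iterD; apply: (NP (n + N)%N); rewrite /= leq_addl.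
Qed.

Lemma nqn_step_near (f : V -> R) (alpha : R) (delta : 'I_m.+1 -> R) p :
  0 < alpha -> Ck 3 f -> shifted_hessian f alpha (delta ord0) p \in unitmx ->
  \forall y \near p, nqn_step f alpha delta y = fixed_step f alpha (delta ord0) y.
Proof.
move=> a0 fC uA.
have lA := shifted_loc_lip a0 fC (delta ord0) p.
apply: filterS (unit_near lA uA) => y uy.
exact: nqn_step_first.
Qed.

End Assembly.

Unset Implicit Arguments.

Theorem corollary1p2 (R : realType) (m : nat) (f : 'rV[R]_m -> R) (alpha : R)
    (halpha : 0 < alpha) (hC3 : Ck 3 f) (hMorse : Morse f) :
  exists E : set R, lebesgue_measure.-negligible E /\
    forall delta : 'I_m.+1 -> R,
      injective delta -> (forall j, ~ E (delta j)) ->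
      exists A : set 'rV[R]_m, lebesgue_outer A = 0%E /\
        forall x0, ~ A x0 ->
        forall xoo : 'rV[R]_m,
          nqn_seq f alpha delta x0 n @[n --> \oo] --> xoo ->
          local_min f xoo /\
          (fun n => enorm (nqn_seq f alpha delta x0 n.+1 - xoo)) =O_\oo
          (fun n => enorm (nqn_seq f alpha delta x0 n - xoo) ^+ 2).
Proof.
have [E cE irr] := irregular_null halpha hC3.
exists E; split.
  exists E; split => //; last exact: countable_lebesgue_measure0.
  apply: countable_measurable cE; exact: measurable_set1.
move=> delta injd dE.
pose h := nqn_step f alpha delta.
exists (trapped h); split.
  apply: trapped_null => N n N0.
  exact: (null_preimage_nqn_iter hC3 n (irr _ (dE ord0)) N0).
move=> x0 nAx0 p xp.
have gp := limit_critical halpha hC3 injd xp.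
have uD := hMorse p gp.
have Ap d := shifted_critical halpha d gp.
have sD := hessian_sym hC3 p.
have uA : shifted_hessian f alpha (delta ord0) p \in unitmx by rewrite Ap.
have hnear := nqn_step_near halpha hC3 uA.
have S1 : sgnmx (hessian f p) = 1%:M.
  apply/eqP; apply: contrapT => /negP S1; apply: nAx0.
  have hs : strict_diff h p (fun u => u *m (1%:M - sgnmx (hessian f p))).
    have := modulus_step_strict_diff_zero (shifted_sym alpha hC3 (delta ord0))
      (shifted_loc_lip halpha hC3 (delta ord0) p) uA (gradient_strict_diff hC3 p) gp (esym (Ap _)).
    rewrite Ap => Hs e e0.
    apply: filterS2 (near_fst_snd hnear) (Hs e e0) => q [q1 q2].
    by rewrite /h q1 q2.
  have [Q pQ Q0] := saddle_stay_null (sgnmx_sqr sD uD) S1 hs.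
  exact: trapped_limit pQ Q0 xp.
have [k k0 kD] := unit_coercive uD.
have kP : positive_by k (hessian f p).
  by have := absmx_positive sD kD; rewrite absmx_def S1 mulmx1.
split; first exact: (positive_hessian_local_min hC3 k0 gp kP).
have [K K0 KP] := fixed_step_quadratic halpha hC3 (delta ord0) k0 gp kP.
apply/eqO_exP; exists ((m%:R + 1) * K).
  by rewrite mulr_gt0// ltr_wpDl.
have Knear : \forall y \near p, `|nqn_step f alpha delta y - p| <= K * `|y - p| ^+ 2.
  by apply: filterS2 hnear KP => y ->.
have xn : \forall n \near \oo,
    `|nqn_step f alpha delta (nqn_seq f alpha delta x0 n) - p|
    <= K * `|nqn_seq f alpha delta x0 n - p| ^+ 2 := xp _ Knear.
apply: filterS xn => n Hn.
rewrite nqn_seqS.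
move: (nqn_seq f alpha delta x0 n) Hn => y Hy.
rewrite !ger0_norm ?enorm_ge0 ?sqr_ge0//.
apply: (le_trans (enorm_le_norm _)); rewrite -mulrA; apply: ler_pM => //.
  by rewrite lerDl.
apply: (le_trans Hy); rewrite ler_pM2l// ler_pXn2r ?nnegrE ?enorm_ge0//.
exact: norm_le_enorm.
Qed.
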